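(* Let $M$ be a contact sub-Riemannian manifold and $q\in M$. Then there exists a sequence $\{q_n\}_{n\in\mathbb{N}}$ in $M$ such that $$\lim_{n\to\infty}q_n=q\qquad\text{and}\qquad\lim_{n\to\infty}\nu(q_n)=\infty .$$
   Context: A contact sub-Riemannian manifold is a connected odd-dimensional manifold $M$ with a hyperplane distribution $\mathcal D\subset TM$, locally $\mathcal D=\ker\alpha$ for a one-form $\alpha$ with $d\alpha|_{\mathcal D}$ non-degenerate, and a smooth metric on $\mathcal D$. A geodesic is a non-constant Lipschitz curve $\gamma:[0,1]\to M$, tangent to $\mathcal D$ a.e., which is locally a minimizer of the energy $\frac12\int\|\dot\gamma\|^2dt$ between its endpoints. $\nu(p)$ is the number of ''local'' geodesics joining $q$ and $p$, i.e. geodesics from $q$ to $p$ whose image is contained in a (fixed) coordinate chart around $q$. *)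

(* Defs.v *)
From HB Require Import structures.
From mathcomp Require Import all_boot all_order all_algebra.
From mathcomp Require Import all_classical all_reals all_analysis.

Set Implicit Arguments.
Unset Strict Implicit.
Unset Printing Implicit Defensive.

Import Order.TTheory GRing.Theory Num.Theory.
Import numFieldNormedType.Exports.

Local Open Scope classical_set_scope.
Local Open Scope ring_scope.

Section smooth.
Context {R : realType} {d : nat}.
Implicit Types (U : set 'rV[R]_d) (f : 'rV[R]_d -> R).

(* Only meant for open [U], where it is the usual class C^k. *)
Fixpoint class_C (k : nat) U f : Prop :=
  (forall x, U x -> {for x, continuous f}) /\
  if k is k'.+1 then
    forall i : 'I_d,
      (forall x, U x -> derivable f x (delta_mx 0 i)) /\
      class_C k' U ('D_(delta_mx 0 i) f)
  else True.

Definition smooth_on U f : Prop := forall k, class_C k U f.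

Definition smooth_map_on U (F : 'rV[R]_d -> 'rV[R]_d) : Prop :=
  forall i : 'I_d, smooth_on U (fun x => F x 0 i).

End smooth.

(* The values of [cmap] outside [cdom], and of [cinv] outside the image of [cdom],
   are irrelevant. *)
Record chart (R : realType) (d : nat) (M : topologicalType) := Chart {
  cdom : set M;
  cmap : M -> 'rV[R]_d;
  cinv : 'rV[R]_d -> M;
  cdom_open : open cdom;
  cimg_open : open (cmap @` cdom);
  cmapK : forall p, cdom p -> cinv (cmap p) = p;
  cmap_continuous : forall p, cdom p -> {for p, continuous cmap};
  cinv_continuous : forall x, (cmap @` cdom) x -> {for x, continuous cinv}
}.

Section charts.
Context {R : realType} {d : nat} {M : topologicalType}.
Implicit Types c : chart R d M.

Definition cimg c : set 'rV[R]_d := cmap c @` cdom c.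

Definition transition c c' : 'rV[R]_d -> 'rV[R]_d := cmap c' \o cinv c.

Definition compatible c c' : Prop :=
  smooth_map_on (cmap c @` (cdom c `&` cdom c')) (transition c c') /\
  smooth_map_on (cmap c' @` (cdom c `&` cdom c')) (transition c' c).

(* Change of the components, at [p], of a tangent vector with components [v]
   in the chart [c]. *)
Definition change_coord c c' (p : M) (v : 'rV[R]_d) : 'rV[R]_d :=
  'D_v (transition c c') (cmap c p).

End charts.

Record smooth_manifold (R : realType) (d : nat) := SmoothManifold {
  carrier :> topologicalType;
  manifold_hausdorff : hausdorff_space carrier;
  manifold_second_countable : @second_countable carrier;
  atlas : set (chart R d carrier);
  atlas_cover : forall p, exists2 c, atlas c & cdom c p;
  atlas_compatible : forall c c', atlas c -> atlas c' -> compatible c c';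
  atlas_maximal : forall c, (forall c', atlas c' -> compatible c c') -> atlas c
}.

Section one_forms.
Context {R : realType} {d : nat}.
(* A one-form on an open set of R^d, given by its components. *)
Implicit Types alpha : 'rV[R]_d -> 'rV[R]_d.

Definition form_app alpha (x v : 'rV[R]_d) : R :=
  \sum_(i < d) alpha x 0 i * v 0 i.

(* d alpha (v, w) = v (alpha w) - w (alpha v) - alpha [v, w], where the last
   term vanishes because v and w are constant vector fields. *)
Definition form_diff alpha (x v w : 'rV[R]_d) : R :=
  'D_v (fun y => form_app alpha y w) x - 'D_w (fun y => form_app alpha y v) x.

End one_forms.

(* [distr c p] and [metric c p] are the distribution and the metric at [p] read
   in the components of the chart [c]; they are relevant only when
   [atlas c] and [cdom c p], and [metric c p] only on [distr c p]. In dimension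
   1 the definition of a contact distribution degenerates to [D = 0], which is
   excluded. *)
Record contact_subriemannian_manifold (R : realType) (d : nat) := ContactSR {
  csr_manifold :> smooth_manifold R d;
  csr_connected : connected [set: csr_manifold];
  csr_dim_odd : odd d;
  csr_dim_gt1 : (1 < d)%N;
  distr : chart R d csr_manifold -> csr_manifold -> set 'rV[R]_d;
  distr_change_coord : forall c c' p v,
    atlas c -> atlas c' -> cdom c p -> cdom c' p ->
    distr c p v <-> distr c' p (change_coord c c' p v);
  distr_contact : forall c x, atlas c -> cimg c x ->
    exists (W : set 'rV[R]_d) (alpha : 'rV[R]_d -> 'rV[R]_d),
      [/\ open_nbhs x W, W `<=` cimg c, smooth_map_on W alpha &
        forall y, W y ->
          [/\ alpha y != 0,
              forall v, distr c (cinv c y) v <-> form_app alpha y v = 0 &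
              forall v, distr c (cinv c y) v ->
                (forall w, distr c (cinv c y) w -> form_diff alpha y v w = 0) ->
                v = 0]];
  metric : chart R d csr_manifold -> csr_manifold ->
    'rV[R]_d -> 'rV[R]_d -> R;
  metric_change_coord : forall c c' p v w,
    atlas c -> atlas c' -> cdom c p -> cdom c' p ->
    distr c p v -> distr c p w ->
    metric c' p (change_coord c c' p v) (change_coord c c' p w) =
      metric c p v w;
  metric_linear : forall c p (a : R) u v w, atlas c -> cdom c p ->
    distr c p u -> distr c p v -> distr c p w ->
    metric c p (a *: u + v) w = a * metric c p u w + metric c p v w;
  metric_symmetric : forall c p v w, atlas c -> cdom c p ->
    distr c p v -> distr c p w -> metric c p v w = metric c p w v;
  metric_pos : forall c p v, atlas c -> cdom c p ->
    distr c p v -> v != 0 -> 0 < metric c p v v;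
  metric_smooth : forall c (W : set 'rV[R]_d) (X Y : 'rV[R]_d -> 'rV[R]_d),
    atlas c -> open W -> W `<=` cimg c ->
    smooth_map_on W X -> smooth_map_on W Y ->
    (forall x, W x -> distr c (cinv c x) (X x)) ->
    (forall x, W x -> distr c (cinv c x) (Y x)) ->
    smooth_on W (fun x => metric c (cinv c x) (X x) (Y x))
}.

Section geodesics.
Context {R : realType} {d : nat} (M : contact_subriemannian_manifold R d).
(* Curves are total functions, of which only the restriction to the interval
   at hand matters. *)
Implicit Types (c : chart R d M) (g : R -> M) (a b t : R).

Definition velocity c g t : 'rV[R]_d := derive1 (cmap c \o g) t.

(* On a compact interval this is the Lipschitz property with respect to any
   Riemannian metric of M. *)
Definition lipschitz_curve a b g : Prop :=
  forall c t, atlas c -> a <= t <= b -> cdom c (g t) ->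
    exists V : set R, [/\ nbhs t V,
      forall s, V s -> a <= s <= b -> cdom c (g s) &
      [lipschitz cmap c (g s) | s in V `&` `[a, b]]].

Definition horizontal a b g : Prop :=
  {ae lebesgue_measure, forall t : R, a <= t <= b ->
    forall c, atlas c -> cdom c (g t) ->
      derivable (cmap c \o g) t 1 /\ distr c (g t) (velocity c g t)}.

Definition admissible a b g : Prop :=
  lipschitz_curve a b g /\ horizontal a b g.

(* At the times where the curve is differentiable and tangent to the
   distribution, the set below is a singleton by [metric_change_coord]. *)
Definition sq_speed g t : R :=
  xget 0 [set e | exists c, [/\ atlas c, cdom c (g t) &
    e = metric c (g t) (velocity c g t) (velocity c g t)]].

Definition energy a b g : \bar R :=
  ((2^-1)%:E * \int[lebesgue_measure]_(t in `[a, b]) (sq_speed g t)%:E)%E.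

Definition energy_minimizer a b g : Prop :=
  forall h, admissible a b h -> h a = g a -> h b = g b ->
    (energy a b g <= energy a b h)%E.

Definition geodesic g : Prop :=
  [/\ admissible 0 1 g,
      (exists2 t : R, 0 <= t <= 1 & g t <> g 0) &
      forall t, 0 <= t <= 1 -> exists2 e : R, 0 < e &
        forall a b, 0 <= a -> a < b -> b <= 1 ->
          `|a - t| < e -> `|b - t| < e -> energy_minimizer a b g].

Definition local_geodesics c (q p : M) : set (R -> M) :=
  [set g | [/\ geodesic g, g 0 = q, g 1 = p & g @` `[0, 1] `<=` cdom c]].

(* Geodesics are counted as maps on [0, 1]. *)
Definition nu c (q p : M) : \bar R :=
  counting [set (fun t : `[0%R, 1%R :> R]%classic => g (\val t))
           | g in local_geodesics c q p].

End geodesics.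

(* Main.v *)
(* Normal extremals through a point are geodesics: if [(y, p)] solves the Hamiltonian system,
   then [p . w + psi |w| ^ 2 + H t] with [w = h - y] grows along any competitor [h] at most like
   its energy (Fenchel's inequality plus a Taylor expansion of [H]), and it bounds from below
   the energy of competitors leaving a small box. It remains to find many extremals from [q]
   to the same nearby point. In coordinates where the distribution is spanned by the fields
   [b_i + a_i e], the rescaling [y = y0 + eta ^ 2 X . b + eta ^ 3 Z e] makes the system an
   [O(eta)] perturbation of the Heisenberg-type system [X' = U, U' = s U J], where [s] is the
   conserved vertical momentum. Prescribe [X 0 = 0] and [X 1 = xi]; for [s] off the resonances
   a contraction argument solves the perturbed system, with a solution Lipschitz in [s]. The
   vertical displacement at time 1 tends, as [eta] goes to 0, to an explicit function of [s]
   that blows up to the right of each [2 k pi / al], where [al ^ 2] is the eigenvalue of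
   [- J ^ 2] at [xi]. So for [eta] small enough each of finitely many intervals next to these
   poles contains an [s] whose extremal ends at the common target
   [y0 + eta ^ 2 xi . b + eta ^ 4 Zh e]; different intervals give different initial
   velocities, hence different geodesics. *)
Require Import Defs.
From HB Require Import structures.
From mathcomp Require Import all_boot all_order all_algebra.
From mathcomp Require Import all_classical all_reals all_analysis.
From mathcomp Require Import measurable_realfun ring lra.
From mathcomp Require complex.

Set Implicit Arguments.
Unset Strict Implicit.
Unset Printing Implicit Defensive.

Import Order.TTheory GRing.Theory Num.Theory.
Import numFieldNormedType.Exports.

Local Open Scope classical_set_scope.
Local Open Scope ring_scope.

(** * Calculus of bounded bilinear maps *)

Section matrix_norm.
Context {R : realType}.

Lemma ler_norm_mx m n (A : 'M[R]_(m, n)) i j : `|A i j| <= `|A|.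
Proof.
rewrite [leRHS]/Num.Def.normr/= mx_normrE.
by apply: le_trans; last exact: (le_bigmax _ _ (i, j)).
Qed.

Lemma mx_norm_le m n (A : 'M[R]_(m, n)) (C : R) : 0 <= C ->
  (forall i j, `|A i j| <= C) -> `|A| <= C.
Proof.
by move=> C0 AC; rewrite /Num.Def.normr/= mx_normrE (bigmax_le _ C0)//= => -[].
Qed.

Lemma norm_trmx m n (A : 'M[R]_(m, n)) : `|A^T| = `|A|.
Proof.
have le_trmx p q (B : 'M[R]_(p, q)) : `|B^T| <= `|B|.
  by apply: mx_norm_le => // i j; rewrite mxE ler_norm_mx.
by apply/le_anti; rewrite le_trmx -[X in `|X| <= _]trmxK le_trmx.
Qed.

Lemma norm_mulmx_le m n p (A : 'M[R]_(m, n)) (B : 'M[R]_(n, p)) :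
  `|A *m B| <= n%:R * (`|A| * `|B|).
Proof.
apply: mx_norm_le => [|i j]; first by rewrite !mulr_ge0.
rewrite mxE (le_trans (ler_norm_sum _ _ _))//.
rewrite mulr_natl -[X in _ *+ X]card_ord -sumr_const; apply: ler_sum => k _.
by rewrite normrM ler_pM// ler_norm_mx.
Qed.

End matrix_norm.

Section product_norm.
Context {R : realType} {U V : normedModType R}.

Lemma norm_fst_le (z : U * V) : `|z.1| <= `|z|.
Proof. by rewrite prod_normE/= le_max lexx. Qed.

Lemma norm_snd_le (z : U * V) : `|z.2| <= `|z|.
Proof. by rewrite prod_normE/= le_max lexx orbT. Qed.

End product_norm.

Section bilinear_calculus.
Context {R : realType} {U V W : normedModType R}.
Variables (op : {bilinear U -> V -> W}) (k : R).
Hypothesis op_bounded : forall u v, `|op u v| <= k * (`|u| * `|v|).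

Lemma bilinear_subE u u' v v' : op u v - op u' v' = op (u - u') v + op u' (v - v').
Proof. by rewrite linearBl linearBr subrKA. Qed.

Lemma bilinear_remainderE u u' du v v' dv :
  op u' v' - op u v - (op du v + op u dv) =
  op (u' - u - du) v' + op du (v' - v) + op u (v' - v - dv).
Proof.
rewrite !(linearBl, linearBr) !addrA subrK (addrAC _ (- op du v) (op u v')) subrK.
by rewrite opprD addrA (addrAC _ (- op u v)).
Qed.

Lemma bounded_bilinear_continuous : continuous (fun q => op q.1 q.2).
Proof.
move=> [u v]; apply/cvgrPdist_le => e e0.
pose M := `|k| * (`|u| + `|v| + 1) + 1.
have M0 : 0 < M by rewrite ltr_wpDl// mulr_ge0 ?addr_ge0.
have r0 : 0 < Num.min 1 (e / M) by rewrite lt_min ltr01 divr_gt0.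
have : \forall q \near (u, v), `|(u, v) - q| < Num.min 1 (e / M).
  exact: (@cvgr_dist_lt _ _ _ (nbhs (u, v))).
apply: filterS => -[u' v']; rewrite prod_normE/= gt_max !lt_min => /andP[/andP[u1 ue] /andP[_ ve]].
rewrite bilinear_subE.
have {}ub : `|u'| <= `|u| + 1.
  by rewrite -lerBlDl (le_trans (lerB_dist _ _))// distrC ltW.
have bound x y a b : `|x| <= a -> `|y| <= b -> `|op x y| <= `|k| * (a * b).
  move=> xa yb; rewrite (le_trans (op_bounded x y))// (le_trans (ler_wpM2r _ (ler_norm k)))//.
  by rewrite ler_wpM2l// ler_pM.
rewrite (le_trans (ler_normD _ _))//.
rewrite (le_trans (lerD (bound _ _ _ _ (ltW ue) (lexx _)) (bound _ _ _ _ ub (ltW ve))))//.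
rewrite (_ : _ + _ = (M - 1) * (e / M)); last by rewrite /M; ring.
rewrite -[leRHS](@divfK _ M) ?gt_eqF// mulrC ler_wpM2l ?divr_ge0// ?ltW//.
by rewrite gtrBl.
Qed.

Lemma continuous_bounded_bilinear {T : topologicalType} (F : T -> U) (G : T -> V) x :
  {for x, continuous F} -> {for x, continuous G} -> {for x, continuous (fun y => op (F y) (G y))}.
Proof.
move=> cF cG; apply: (@continuous_comp _ _ _ (fun y => (F y, G y)) (fun q => op q.1 q.2)).
  by have := cvg_pair cF cG; exact.
exact: bounded_bilinear_continuous.
Qed.

Lemma is_diff_bounded_bilinear (E : normedModType R) (F dF : E -> U) (G dG : E -> V) x :
  is_diff x F dF -> is_diff x G dG ->
  is_diff x (fun y => op (F y) (G y)) (fun h => op (dF h) (G x) + op (F x) (dG h)).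
Proof.
move=> HF HG; have cop := bounded_bilinear_continuous.
have Hop : is_diff (F x, G x) (fun q => op q.1 q.2) (fun q => op (F x) q.2 + op q.1 (G x)).
  by apply: DiffDef; [exact: differentiable_bilin|rewrite diff_bilin].
have := is_diff_comp (is_diff_pair HF HG) Hop.
by move=> dop; apply: is_diff_eq dop _; apply: funext => h; rewrite /= addrC.
Qed.

Lemma is_diff_bounded_bilinearl (E : normedModType R) (F dF : E -> U) (v : V) x :
  is_diff x F dF -> is_diff x (fun y => op (F y) v) (fun h => op (dF h) v).
Proof.
move=> HF; apply: is_diff_eq (is_diff_bounded_bilinear HF (is_diff_cst v x)) _.
by apply: funext => h; rewrite linear0r addr0.
Qed.

Lemma is_diff_bounded_bilinearr (E : normedModType R) (u : U) (G dG : E -> V) x :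
  is_diff x G dG -> is_diff x (fun y => op u (G y)) (fun h => op u (dG h)).
Proof.
move=> HG; apply: is_diff_eq (is_diff_bounded_bilinear (is_diff_cst u x) HG) _.
by apply: funext => h; rewrite linear0l add0r.
Qed.

Lemma is_derive_bounded_bilinear (F : R -> U) (G : R -> V) (t : R) dF dG :
  is_derive t 1 F dF -> is_derive t 1 G dG ->
  is_derive t 1 (fun s => op (F s) (G s)) (op dF (G t) + op (F t) dG).
Proof.
move=> [/derivable1_diffP dFt <-] [/derivable1_diffP dGt <-].
have [dop eop] := is_diff_bounded_bilinear (differentiableP dFt) (differentiableP dGt).
by split; [exact/derivable1_diffP|rewrite !deriveE// eop].
Qed.

End bilinear_calculus.

Section dot_product.
Context {R : realType}.

Definition dot {d} (u v : 'rV[R]_d) : R := (u *m v^T) 0 0.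

Lemma dotC d (u v : 'rV[R]_d) : dot u v = dot v u.
Proof. by rewrite /dot -[in LHS](trmxK u) -trmx_mul mxE. Qed.

Lemma dotDl d (u v w : 'rV[R]_d) : dot (u + v) w = dot u w + dot v w.
Proof. by rewrite /dot mulmxDl mxE. Qed.

Lemma dotDr d (u v w : 'rV[R]_d) : dot u (v + w) = dot u v + dot u w.
Proof. by rewrite !(dotC u) dotDl. Qed.

Lemma dotZl d a (u v : 'rV[R]_d) : dot (a *: u) v = a * dot u v.
Proof. by rewrite /dot -scalemxAl mxE. Qed.

Lemma dotZr d a (u v : 'rV[R]_d) : dot u (a *: v) = a * dot u v.
Proof. by rewrite !(dotC u) dotZl. Qed.

Lemma dotNl d (u v : 'rV[R]_d) : dot (- u) v = - dot u v.
Proof. by rewrite -scaleN1r dotZl mulN1r. Qed.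

Lemma dotNr d (u v : 'rV[R]_d) : dot u (- v) = - dot u v.
Proof. by rewrite dotC dotNl dotC. Qed.

Lemma dotBl d (u v w : 'rV[R]_d) : dot (u - v) w = dot u w - dot v w.
Proof. by rewrite dotDl dotNl. Qed.

Lemma dotBr d (u v w : 'rV[R]_d) : dot u (v - w) = dot u v - dot u w.
Proof. by rewrite dotDr dotNr. Qed.

Lemma dot0l d (u : 'rV[R]_d) : dot 0 u = 0.
Proof. by rewrite /dot mul0mx mxE. Qed.

Lemma dot_mulmx m n (u : 'rV[R]_m) (A : 'M[R]_(m, n)) (v : 'rV[R]_n) :
  dot (u *m A) v = dot u (v *m A^T).
Proof. by rewrite /dot trmx_mul trmxK mulmxA. Qed.

Lemma dot_sum d (u v : 'rV[R]_d) : dot u v = \sum_l u 0 l * v 0 l.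
Proof. by rewrite /dot mxE; apply: eq_bigr => l _; rewrite mxE. Qed.

Lemma dot_delta d (u : 'rV[R]_d) i : dot u (delta_mx 0 i) = u 0 i.
Proof. by rewrite /dot trmx_delta -colE mxE. Qed.

Lemma dot_sqr_ge0 d (u : 'rV[R]_d) : 0 <= dot u u.
Proof. by rewrite dot_sum; apply: sumr_ge0 => l _; rewrite -expr2 sqr_ge0. Qed.

Lemma dot_sqr_gt0 d (u : 'rV[R]_d) : u != 0 -> 0 < dot u u.
Proof.
rewrite lt0r dot_sqr_ge0 andbT; apply: contraNN.
rewrite dot_sum psumr_eq0 => [/allP u0|l _]; last by rewrite -expr2 sqr_ge0.
by apply/eqP/rowP => l; have := u0 l (mem_index_enum l); rewrite mxE mulf_eq0 orbb => /eqP.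
Qed.

Lemma norm_dot_le d (u v : 'rV[R]_d) : `|dot u v| <= d%:R * (`|u| * `|v|).
Proof. by rewrite (le_trans (ler_norm_mx _ _ _))// (le_trans (norm_mulmx_le _ _))// norm_trmx. Qed.

Lemma sqr_norm_le_dot d (u : 'rV[R]_d) : `|u| ^+ 2 <= dot u u.
Proof.
have [->|u0] := eqVneq u 0; first by rewrite normr0 expr0n dot_sqr_ge0.
have [[i l] nu] : exists i, `|u| = `|u i.1 i.2| by apply: (@mx_norm_neq0 _ 1 d u);
  rewrite -[mx_norm u]/`|u| normr_eq0.
rewrite nu/= ord1 real_normK ?num_real// dot_sum (bigD1 l)//= -expr2 lerDl.
by apply: sumr_ge0 => j _; rewrite -expr2 sqr_ge0.
Qed.

Lemma dot_is_bilinear d : bilinear_for (GRing.Scale.Law.clone _ _ *:%R _)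
  (GRing.Scale.Law.clone _ _ *:%R _) (@dot d).
Proof. by split=> [v a u u'|u a v v'] /=; rewrite (dotDl, dotDr) (dotZl, dotZr). Qed.

HB.instance Definition _ d := bilinear_isBilinear.Build R 'rV[R]_d 'rV[R]_d R
  _ _ (@dot d) (dot_is_bilinear d).

Lemma dot_is_linear d (u : 'rV[R]_d) : linear (dot u).
Proof. by move=> a v w; rewrite dotDr dotZr. Qed.

HB.instance Definition _ d (u : 'rV[R]_d) := GRing.isLinear.Build R 'rV[R]_d R _
  (dot u) (dot_is_linear u).

End dot_product.

Section matrix_calculus.
Context {R : realType}.

Lemma is_derive_mxP (V : normedModType R) m n (F : V -> 'M[R]_(m, n)) t v (l : 'M[R]_(m, n)) :
  is_derive t v F l <-> forall i j, is_derive t v (fun s => F s i j) (l i j).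
Proof.
split=> [[dF <-] i j|dentries].
  by have /derivable_mxP dFij := dF; split => //; rewrite derive_mx// mxE.
have dF : derivable F t v by apply/derivable_mxP => i j; have [] := dentries i j.
by split=> //; rewrite derive_mx//; apply/matrixP => i j; rewrite mxE; have [] := dentries i j.
Qed.

Lemma is_derive_mulmx m n p (A : R -> 'M[R]_(m, n)) (B : R -> 'M[R]_(n, p)) (t : R) dA dB :
  is_derive t 1 A dA -> is_derive t 1 B dB ->
  is_derive t 1 (fun s => A s *m B s) (dA *m B t + A t *m dB).
Proof. exact/is_derive_bounded_bilinear/norm_mulmx_le. Qed.

Lemma is_derive_dot d (u v : R -> 'rV[R]_d) (t : R) du dv :
  is_derive t 1 u du -> is_derive t 1 v dv ->
  is_derive t 1 (fun s => dot (u s) (v s)) (dot du (v t) + dot (u t) dv).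
Proof. exact/is_derive_bounded_bilinear/norm_dot_le. Qed.

Lemma is_derive_mul (f g : R -> R) (t df dg : R) :
  is_derive t 1 f df -> is_derive t 1 g dg ->
  is_derive t 1 (fun s => f s * g s) (df * g t + f t * dg).
Proof.
move=> hf hg; have := is_deriveM hf hg; rewrite addrC.
by move=> /is_derive_eq; apply; rewrite -[g t *: df]mulrC.
Qed.

Lemma scale_is_bilinear (V : lmodType R) :
  bilinear_for (GRing.Scale.Law.clone _ _ *:%R _) (GRing.Scale.Law.clone _ _ *:%R _)
    (@GRing.scale R V).
Proof.
by split=> [v a x y|a b v w] /=; rewrite ?scalerDl ?scalerDr !scalerA// mulrC.
Qed.

HB.instance Definition _ (V : lmodType R) := bilinear_isBilinear.Build R R V V
  _ _ (@GRing.scale R V) (@scale_is_bilinear V).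

Lemma norm_scale_le (V : normedModType R) (a : R) (v : V) : `|a *: v| <= 1 * (`|a| * `|v|).
Proof. by rewrite normrZ mul1r. Qed.

Lemma is_derive_mulmxl m n p (A : R -> 'M[R]_(m, n)) (B : 'M[R]_(n, p)) (t : R) dA :
  is_derive t 1 A dA -> is_derive t 1 (fun s => A s *m B) (dA *m B).
Proof.
by move=> dAt; apply: is_derive_eq (is_derive_mulmx dAt (is_derive_cst B t 1)) _;
  rewrite mulmx0 addr0.
Qed.

Lemma is_derive_scalel (V : normedModType R) (f : R -> R) (v : V) (t df : R) :
  is_derive t 1 f df -> is_derive t 1 (fun s => f s *: v) (df *: v).
Proof.
move=> dft; have := is_derive_bounded_bilinear (@norm_scale_le V) dft (is_derive_cst v t 1).
by move=> /is_derive_eq; apply; rewrite linear0r addr0.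
Qed.

Lemma is_derive_cmul (k : R) (f : R -> R) (t df : R) :
  is_derive t 1 f df -> is_derive t 1 (fun s => k * f s) (k * df).
Proof. exact: is_deriveZ. Qed.

Lemma is_derive_comp_diff (V W : normedModType R) (f : V -> W) (x : R -> V) (t : R) v :
  differentiable f (x t) -> is_derive t 1 x v -> is_derive t 1 (f \o x) ('d f (x t) v).
Proof.
move=> df [/derivable1_diffP dx <-]; have dfx := differentiable_comp dx df.
by split; [exact/derivable1_diffP|rewrite !deriveE// diff_comp].
Qed.

Lemma is_derive_fst (V W : normedModType R) (x : R -> V * W) (t : R) v :
  is_derive t 1 x v -> is_derive t 1 (fun s => (x s).1) v.1.
Proof.
move=> dx; have cfst (z : V * W) : {for z, continuous fst} by exact: cvg_fst.
have := is_derive_comp_diff (linear_differentiable (f := fst) (x t) cfst) dx.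
by rewrite diff_lin.
Qed.

Lemma is_derive_snd (V W : normedModType R) (x : R -> V * W) (t : R) v :
  is_derive t 1 x v -> is_derive t 1 (fun s => (x s).2) v.2.
Proof.
move=> dx; have csnd (z : V * W) : {for z, continuous snd} by exact: cvg_snd.
have := is_derive_comp_diff (linear_differentiable (f := snd) (x t) csnd) dx.
by rewrite diff_lin.
Qed.

Lemma is_derive_continuous (V : normedModType R) (f : R -> V) (x : R) l :
  is_derive x 1 f l -> {for x, continuous f}.
Proof. by move=> [/derivable1_diffP df _]; exact: differentiable_continuous. Qed.

Lemma is_derive_line (V W : normedModType R) (f : V -> W) w e (s : R) l :
  is_derive (w + s *: e) e f l -> is_derive s 1 (fun s => f (w + s *: e)) l.
Proof.
have quotientE : (fun h : R => h^-1 *: (((fun s => f (w + s *: e)) \o shift s)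
  (h *: (1 : R)) - f (w + s *: e)))
    = (fun h : R => h^-1 *: ((f \o shift (w + s *: e)) (h *: e) - f (w + s *: e))).
  apply: funext => h /=; congr (_ *: (f _ - _)).
  by rewrite [h *: 1]mulr1 scalerDl addrCA.
by move=> [df dl]; split; [rewrite /derivable quotientE|rewrite /derive quotientE].
Qed.

Definition grad d (f : 'rV[R]_d -> R) (x : 'rV[R]_d) : 'rV[R]_d :=
  \row_l 'D_(delta_mx 0 l) f x.

Lemma diff_grad d (f : 'rV[R]_d -> R) x v : differentiable f x ->
  'd f x v = dot (grad f x) v.
Proof.
move=> df; rewrite [v in LHS]row_sum_delta linear_sum dot_sum; apply: eq_bigr => l _.
by rewrite linearZ mxE deriveE//= mulrC.
Qed.

End matrix_calculus.


(** * Lipschitz functions and primitives *)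

Section real_line.
Context {R : realType}.
Implicit Types (a b s t : R) (P : R -> Prop).

Lemma first_failure P a b : P a ->
  (forall s, a <= s < b -> (forall r, a <= r <= s -> P r) ->
     exists2 s', s < s' & forall r, s < r <= s' -> r <= b -> P r) ->
  (forall s, a <= s <= b -> P s) \/
  exists2 s, a < s <= b & ~ P s /\ forall r, a <= r < s -> P r.
Proof.
move=> Pa right_open; have [?|] := pselect (forall s, a <= s <= b -> P s); first by left.
move=> /existsNP[s0 /not_implyP[/andP[as0 s0b] nPs0]]; right.
pose A := [set s | a <= s <= b /\ ~ P s].
have infA : has_inf A by split; [exists s0; split; rewrite ?as0|exists a => s [/andP[]]].
pose m := inf A.
have am : a <= m by apply: lb_le_inf; [exact: infA.1|move=> s [/andP[]]].
have ms0 : m <= s0 by apply: ge_inf; [exact: infA.2|split; rewrite ?as0].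
have before r : a <= r < m -> P r.
  move=> /andP[ar rm]; apply: contrapT => nPr.
  suff : m <= r by rewrite leNgt rm.
  by apply: ge_inf; [exact: infA.2|split; rewrite // ar (ltW (lt_le_trans rm _))// (le_trans ms0)].
have nPm : ~ P m.
  move=> Pm; have mb : m < b.
    rewrite lt_neqAle (le_trans ms0)// andbT; apply/eqP => mb.
    by apply: nPs0; have -> // : s0 = m by apply/le_anti; rewrite ms0 {1}mb s0b.
  have [||s' ms' Ps'] := right_open m; first by rewrite am.
    by move=> r /andP[ar]; rewrite le_eqVlt => /predU1P[->//|rm]; apply: before; rewrite ar.
  have /(inf_adherent)/(_ infA)[s [/andP[as_ sb] nPs]] : 0 < s' - m by rewrite subr_gt0.
  rewrite -/m addrC subrK => ss'; apply: (nPs); have : m <= s.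
    by apply: ge_inf; [exact: infA.2|split; rewrite ?as_].
  by rewrite le_eqVlt => /predU1P[<-//|ms]; apply: Ps' => //; rewrite ms ltW.
exists m => //; rewrite lt_neqAle am (le_trans ms0)// !andbT.
by apply/eqP => ma; apply: nPm; rewrite -ma.
Qed.

Lemma uniform_bound (I : finType) (P : I -> R -> Prop) :
  (forall i C D, C <= D -> P i C -> P i D) -> (forall i, exists2 C, 0 <= C & P i C) ->
  exists2 C, 0 <= C & forall i, P i C.
Proof.
move=> monoP PI; have {PI}/choice[C HC] i : exists C, P i C by have [C _ PC] := PI i; exists C.
exists (\big[Num.max/0]_i C i) => [|i]; first exact: bigmax_ge_id.
by apply: monoP (HC i); exact: le_bigmax.
Qed.

Definition clamp a b t := Num.max a (Num.min b t).

Lemma clamp_itv a b t : a <= b -> a <= clamp a b t <= b.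
Proof. by move=> ab; rewrite /clamp le_max lexx/= ge_max ab/= ge_min lexx. Qed.

Lemma clamp_id a b t : a <= t <= b -> clamp a b t = t.
Proof. by move=> /andP[at_ tb]; rewrite /clamp (min_idPr tb) (max_idPr at_). Qed.

Lemma norm_maxB a s t : `|Num.max a s - Num.max a t| <= `|s - t|.
Proof.
wlog st : s t / s <= t.
  by move=> ordered; have [/ordered//|/ltW/ordered] := leP s t; rewrite distrC (distrC t).
rewrite distrC (distrC s) !ger0_norm ?subr_ge0 ?ge_max ?le_max ?lexx ?st ?orbT//.
by case: (leP a s) => ?; case: (leP a t) => ?; lra.
Qed.

Lemma clamp_nonexpansive a b s t : `|clamp a b s - clamp a b t| <= `|s - t|.
Proof.
apply: (le_trans (norm_maxB _ _ _)).
have minE x : Num.min b x = - Num.max (- b) (- x) by rewrite oppr_max !opprK.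
rewrite !minE opprK addrC (le_trans (norm_maxB _ _ _))//.
by rewrite opprK addrC.
Qed.

End real_line.

Section lipschitz.
Context {R : realType}.

Lemma klipschitzP (V W : normedModType R) (K : R) (A : set V) (f : V -> W) :
  K.-lipschitz_A f <-> forall x y, A x -> A y -> `|f x - f y| <= K * `|x - y|.
Proof.
by split=> [f_lip x y Ax Ay|f_lip [x y] [/= Ax Ay]]; [exact: (f_lip (x, y))|exact: f_lip].
Qed.

Lemma klipschitz_weaken (V W : normedModType R) (K L : R) (A : set V) (f : V -> W) :
  K <= L -> K.-lipschitz_A f -> L.-lipschitz_A f.
Proof.
move=> KL /klipschitzP f_lip; apply/klipschitzP => x y Ax Ay.
by rewrite (le_trans (f_lip _ _ Ax Ay))// ler_wpM2r.
Qed.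

Lemma klipschitz_subset (V W : normedModType R) (K : R) (A B : set V) (f : V -> W) :
  A `<=` B -> K.-lipschitz_B f -> K.-lipschitz_A f.
Proof. by move=> AB /klipschitzP f_lip; apply/klipschitzP => x y /AB Bx /AB; exact: f_lip. Qed.

Lemma lipschitzP (V W : normedModType R) (A : set V) (f : V -> W) :
  [lipschitz f x | x in A] <-> exists2 K, 0 <= K & K.-lipschitz_A f.
Proof.
split=> [/pinfty_ex_gt0[K K0 f_lip]|[K K0 f_lip]]; first by exists K => //; exact: ltW.
exists K; split; first exact: num_real.
by move=> L KL; apply: klipschitz_weaken f_lip; exact: ltW.
Qed.

Lemma klipschitz_segmentP (V : normedModType R) (K a b : R) (f : R -> V) :
  K.-lipschitz_`[a, b] f <->
  forall s t, a <= s -> s <= t -> t <= b -> `|f t - f s| <= K * (t - s).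
Proof.
split=> [/klipschitzP f_lip s t as_ st tb|f_lip].
  rewrite -[t - s in leRHS]ger0_norm ?subr_ge0//.
  by apply: f_lip; rewrite /= in_itv/= ?as_ ?tb ?(le_trans st tb) ?(le_trans as_ st).
apply/klipschitzP => s t /=; rewrite !in_itv /= => /andP[as_ sb] /andP[at_ tb].
by have [st|/ltW st] := leP s t;
  [rewrite distrC (distrC s)|]; rewrite [`|_ - _| in leRHS]ger0_norm ?subr_ge0//; exact: f_lip.
Qed.

Lemma klipschitz_glue (V : normedModType R) (K a m b : R) (f : R -> V) :
  K.-lipschitz_`[a, m] f -> K.-lipschitz_`[m, b] f -> K.-lipschitz_`[a, b] f.
Proof.
move=> /klipschitz_segmentP Kam /klipschitz_segmentP Kmb.
apply/klipschitz_segmentP => s t as_ st tb.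
have [tm|/ltW mt] := leP t m; first exact: Kam.
have [ms|/ltW sm] := leP m s; first exact: Kmb.
rewrite -(subrKA (f m)) (le_trans (ler_normD _ _))//.
apply: (@le_trans _ _ (K * (t - m) + K * (m - s))); last by lra.
by apply: lerD; [exact: Kmb|exact: Kam].
Qed.

Lemma klipschitz_continuous (V W : normedModType R) (K : R) (f : V -> W) :
  K.-lipschitz f -> continuous f.
Proof.
move=> /klipschitzP f_lip x; apply/cvgrPdist_lt => e e0; near=> y.
apply: le_lt_trans (f_lip x y I I) _.
apply: (@le_lt_trans _ _ ((`|K| + 1) * `|x - y|)).
  by rewrite ler_wpM2r// (le_trans (ler_norm _))// lerDl.
rewrite -ltr_pdivlMl ?ltr_wpDl//; near: y.
by apply: (@cvgr_dist_lt _ _ _ (nbhs x)) => //; rewrite mulr_gt0 ?invr_gt0 ?ltr_wpDl.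
Unshelve. all: by end_near. Qed.

Lemma klipschitz_clamp (V : normedModType R) (K a b : R) (f : R -> V) : a <= b -> 0 <= K ->
  K.-lipschitz_`[a, b] f -> K.-lipschitz (f \o clamp a b).
Proof.
move=> ab K0 /klipschitzP f_lip; apply/klipschitzP => s t _ _.
apply: (le_trans (f_lip _ _ _ _)); rewrite /= ?in_itv/= ?clamp_itv//.
by rewrite ler_wpM2l// clamp_nonexpansive.
Qed.

Lemma continuous_clamp (V : normedModType R) (a b : R) (f : R -> V) : a <= b ->
  {in `[a, b], continuous f} -> continuous (f \o clamp a b).
Proof.
move=> ab cf t; apply: continuous_comp; last by apply: cf; rewrite in_itv/= clamp_itv.
apply: (@klipschitz_continuous _ _ 1); apply/klipschitzP => x y _ _.
by rewrite mul1r clamp_nonexpansive.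
Qed.

Lemma locally_lipschitz_segment (V : normedModType R) (a b : R) (f : R -> V) :
  (forall t, a <= t <= b -> exists2 N, nbhs t N & [lipschitz f x | x in N `&` `[a, b]]) ->
  [lipschitz f x | x in `[a, b]].
Proof.
move=> loc; have [ab|ba] := leP a b; last first.
  by rewrite set_itv_ge ?bnd_simp -?ltNge//; exact: lipschitz_set0.
pose P s := exists2 K, 0 <= K & K.-lipschitz_`[a, s] f.
have glue m s K : a <= m -> P m -> K.-lipschitz_`[m, s] f -> P s.
  move=> am [L L0 HL] HK; exists (Num.max L K); first by rewrite le_max L0.
  by apply: klipschitz_glue; [apply: klipschitz_weaken HL|apply: klipschitz_weaken HK];
    rewrite le_max lexx ?orbT.
have loc_segment t : a <= t <= b -> exists2 e, 0 < e & exists K, forall u v,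
    a <= u -> v <= b -> t - e <= u -> v <= t + e -> K.-lipschitz_`[u, v] f.
  move=> /loc[N /nbhs_ballP[e /= e0 eN] /lipschitzP[K _ HK]];
    exists (e / 2); first by rewrite divr_gt0.
  exists K => u v au vb tu vt; apply: klipschitz_subset HK => r /=;
    rewrite !in_itv/= => /andP[ur rv].
  split; last by rewrite (le_trans au ur) (le_trans rv vb).
  by apply: eN; rewrite -ball_normE /= ltr_norml; lra.
apply/lipschitzP; have [||PP|[s /andP[as_ sb] [nPs Pbefore]]] := @first_failure _ P a b.
- exists 0 => //; apply/klipschitz_segmentP => s t as_ st ta.
  have /andP[/eqP-> /eqP->] : (s == a) && (t == a) by rewrite !eq_le as_ ta
    (le_trans st ta) (le_trans as_ st).
  by rewrite !subrr normr0 mulr0.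
- move=> s /andP[as_ sb] Ps; have [|e e0 [K HK]] := loc_segment s; first by rewrite as_ ltW.
  exists (s + e); first by rewrite ltrDl.
  move=> r /andP[sr rse] rb; apply: (glue s r K) => //; first by apply: Ps; rewrite as_ lexx.
  by apply: HK => //; rewrite lerBlDr lerDl ltW.
- by apply: PP; rewrite ab lexx.
- have [|e e0 [K HK]] := loc_segment s; first by rewrite ltW.
  case: nPs; apply: (glue (Num.max a (s - e)) s K); first by rewrite le_max lexx.
    by apply: Pbefore; rewrite le_max lexx gt_max as_ ltrBlDr ltrDl.
  by apply: HK; rewrite ?le_max ?lexx ?orbT// lerDl ltW.
Qed.

Lemma segment_bounded (V : normedModType R) (a b : R) (f : R -> V) :
  {in `[a, b], continuous f} ->
  exists2 C, 0 <= C & forall t, a <= t <= b -> `|f t| <= C.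
Proof.
move=> cf; have [ab|ba] := leP a b; last first.
  by exists 0 => // t /andP[at_ /(le_trans at_)]; rewrite leNgt ba.
have [|m _ Hm] := @EVT_max R (fun t => `|f t|) a b ab.
  apply: continuous_in_subspaceT => t /[!inE] tab.
  by apply: (@cvg_norm _ _ _ _ _ f); exact: cf.
by exists `|f m| => // t tab; apply: Hm; rewrite in_itv.
Qed.

Lemma klipschitz_derive (a b L : R) (f df : R -> R) :
  (forall t, a <= t <= b -> is_derive t 1 f (df t)) ->
  (forall t, a <= t <= b -> `|df t| <= L) -> L.-lipschitz_`[a, b] f.
Proof.
move=> Df bound; apply/klipschitz_segmentP => s t as_ st tb.
have in_ab x : x \in `[s, t] -> a <= x <= b.
  by rewrite in_itv/= => /andP[sx xt]; rewrite (le_trans as_ sx) (le_trans xt tb).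
have [||c cst ->] := @MVT_segment _ f df s t st.
- by move=> x xst; apply/Df/in_ab; exact: subset_itv_oo_cc.
- by apply: derivable_within_continuous => x /in_ab/Df[].
by rewrite normrM (ger0_norm (_ : 0 <= t - s)) ?subr_ge0// ler_wpM2r ?subr_ge0// bound// in_ab.
Qed.

Lemma klipschitz_derive_mx (m n : nat) (a b L : R) (f df : R -> 'M[R]_(m, n)) :
  (forall t, a <= t <= b -> is_derive t 1 f (df t)) ->
  (forall t, a <= t <= b -> `|df t| <= L) -> L.-lipschitz_`[a, b] f.
Proof.
move=> Df bound; apply/klipschitz_segmentP => s t as_ st tb.
have L0 : 0 <= L by apply: le_trans (bound s _); rewrite ?as_ ?(le_trans st).
apply: mx_norm_le => [|i j]; first by rewrite mulr_ge0// subr_ge0.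
suff /klipschitz_segmentP/(_ s t as_ st tb) : L.-lipschitz_`[a, b]
  (fun x => f x i j) by rewrite !mxE.
apply: (@klipschitz_derive _ _ _ _ (fun x => df x i j)) => x xab;
  first by have /is_derive_mxP := Df x xab.
exact: le_trans (ler_norm_mx _ _ _) (bound x xab).
Qed.

Lemma derive0_constant (a b : R) (f : R -> R) (t : R) :
  (forall r : R, a <= r <= b -> is_derive r 1 f 0) -> a <= t <= b -> f t = f a.
Proof.
move=> df /andP[at_ tb]; have f'_le (r : R) : a <= r <= b -> `|0 : R| <= 0 by rewrite normr0.
have /klipschitz_segmentP/(_ a t (lexx _) at_ tb) := klipschitz_derive df f'_le.
by rewrite mul0r normr_le0 subr_eq0 => /eqP.
Qed.

Lemma derive0_constant_mx m n (a b : R) (F : R -> 'M[R]_(m, n)) (t : R) :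
  (forall r : R, a <= r <= b -> is_derive r 1 F 0) -> a <= t <= b -> F t = F a.
Proof.
move=> dF tab; apply/matrixP => i j.
apply: (@derive0_constant a b (fun r => F r i j)) => // r /dF/is_derive_mxP/(_ i j).
by rewrite mxE.
Qed.

Lemma lipschitz_subset (V W : normedModType R) (A B : set V) (f : V -> W) :
  A `<=` B -> [lipschitz f x | x in B] -> [lipschitz f x | x in A].
Proof.
by move=> AB /lipschitzP[K K0 f_lip]; apply/lipschitzP; exists K => //;
  exact: klipschitz_subset f_lip.
Qed.

Lemma lipschitz_cst (V W : normedModType R) (A : set V) (c : W) : [lipschitz c | x in A].
Proof.
by apply/lipschitzP; exists 0 => //; apply/klipschitzP => x y _ _; rewrite subrr normr0 mul0r.
Qed.

Lemma lipschitz_in_id (V : normedModType R) (A : set V) : [lipschitz x | x in A].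
Proof.
by apply/lipschitzP; exists 1 => //; apply/klipschitzP => x y _ _; rewrite mul1r.
Qed.

Lemma lipschitzD (V W : normedModType R) (A : set V) (f g : V -> W) :
  [lipschitz f x | x in A] -> [lipschitz g x | x in A] -> [lipschitz f x + g x | x in A].
Proof.
move=> /lipschitzP[K K0 /klipschitzP Hf] /lipschitzP[L L0 /klipschitzP Hg].
apply/lipschitzP; exists (K + L); first exact: addr_ge0.
apply/klipschitzP => x y Ax Ay; rewrite opprD addrACA mulrDl.
by rewrite (le_trans (ler_normD _ _))// lerD ?Hf ?Hg.
Qed.

Lemma lipschitzB (V W : normedModType R) (A : set V) (f g : V -> W) :
  [lipschitz f x | x in A] -> [lipschitz g x | x in A] -> [lipschitz f x - g x | x in A].
Proof.
move=> Hf /lipschitzP[L L0 /klipschitzP Hg]; apply: lipschitzD => //.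
apply/lipschitzP; exists L => //; apply/klipschitzP => x y Ax Ay.
by rewrite -opprD normrN Hg.
Qed.

Lemma lipschitz_segment_bounded (V : normedModType R) (a b : R) (f : R -> V) :
  [lipschitz f t | t in `[a, b]] ->
  exists2 C, 0 <= C & forall t, a <= t <= b -> `|f t| <= C.
Proof.
move=> /lipschitzP[K K0 /klipschitz_segmentP f_lip].
exists (`|f a| + K * `|b - a|); first by rewrite addr_ge0// mulr_ge0.
move=> t /andP[at_ tb]; rewrite -[X in `|X|](subrK (f a)) (le_trans (ler_normD _ _))//.
rewrite addrC lerD2l (le_trans (f_lip _ _ _ _ _))// ler_wpM2l//.
by rewrite ger0_norm ?subr_ge0 ?(le_trans at_)// lerD2r.
Qed.

Lemma lipschitz_bilinear (U V W : normedModType R) (op : {bilinear U -> V -> W}) (k a b : R)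
    (f : R -> U) (g : R -> V) :
  0 <= k -> (forall u v, `|op u v| <= k * (`|u| * `|v|)) ->
  [lipschitz f t | t in `[a, b]] -> [lipschitz g t | t in `[a, b]] ->
  [lipschitz op (f t) (g t) | t in `[a, b]].
Proof.
move=> k0 opk lf lg; have [A A0 HA] := lipschitz_segment_bounded lf.
have [B B0 HB] := lipschitz_segment_bounded lg.
have [K K0 /klipschitzP HK] := (lipschitzP _ _).1 lf.
have [L L0 /klipschitzP HL] := (lipschitzP _ _).1 lg.
apply/lipschitzP; exists (k * (K * B + A * L)).
  by rewrite mulr_ge0// addr_ge0// mulr_ge0.
apply/klipschitzP => s t sab tab.
have ft : `|f t| <= A by apply: HA; move: tab; rewrite /= in_itv.
have gs : `|g s| <= B by apply: HB; move: sab; rewrite /= in_itv.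
rewrite bilinear_subE.
rewrite (le_trans (ler_normD _ _))// mulrDr mulrDl lerD// (le_trans (opk _ _))// -mulrA ler_wpM2l//.
  by rewrite mulrAC ler_pM// HK.
by rewrite -mulrA ler_pM// HL.
Qed.

End lipschitz.

Section primitive.
Context {R : realType}.
Local Notation mu := (@lebesgue_measure R).
Implicit Types f g F : R -> R.

Lemma continuous_itv_integrable (a b : R) f : continuous f ->
  mu.-integrable `[a, b] (EFin \o f).
Proof.
move=> cf; apply: continuous_compact_integrable; first exact: segment_compact.
exact: continuous_subspaceT.
Qed.

Lemma is_derive_integral (a x : R) f : continuous f -> a < x ->
  is_derive x 1 (fun x => \int[mu]_(t in `[a, x]) f t) (f x).
Proof.
move=> cf ax; have xx1 : x < x + 1 by rewrite ltrDl.
have [df ef] := continuous_FTC1_closed xx1 (@continuous_itv_integrable a (x + 1) f cf) ax (cf x).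
by apply: (DeriveDef df); rewrite -derive1E; exact: ef.
Qed.

(* The integrand is extended by constants outside [0, 1], so that the primitive is
   differentiable also at the endpoints. *)
Definition primitive f (t : R) : R :=
  \int[mu]_(r in `[-1, t]) f (clamp 0 1 r) - \int[mu]_(r in `[-1, 0]) f (clamp 0 1 r).

Lemma primitive0 f : primitive f 0 = 0.
Proof. exact: subrr. Qed.

Lemma is_derive_primitive f (t : R) : {in `[0, 1], continuous f} -> 0 <= t <= 1 ->
  is_derive t 1 (primitive f) (f t).
Proof.
move=> cf t01; have cf' := continuous_clamp (ler01 : 0 <= 1 :> R) cf.
have t1 : -1 < t by case/andP: t01 => t0 _; rewrite (lt_le_trans _ t0)// ltrN10.
rewrite -[X in is_derive _ _ _ X](subr0 (f t)) -{2}(clamp_id t01).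
by apply: is_deriveB; exact: is_derive_integral.
Qed.

Lemma continuous_primitive f : {in `[0, 1], continuous f} ->
  {in `[0, 1], continuous (primitive f)}.
Proof. by move=> cf t t01; apply: is_derive_continuous; exact: is_derive_primitive. Qed.

Lemma norm_primitiveB f g (delta t : R) :
  {in `[0, 1], continuous f} -> {in `[0, 1], continuous g} ->
  (forall t, 0 <= t <= 1 -> `|f t - g t| <= delta) -> 0 <= t <= 1 ->
  `|primitive f t - primitive g t| <= delta.
Proof.
move=> cf cg fg t01; have [t0 t1] := andP t01.
have d0 : 0 <= delta by apply: le_trans (fg t t01).
have D (s : R) : 0 <= s <= 1 -> is_derive s 1 (fun s => primitive f s - primitive g s) (f s - g s).
  by move=> s01; apply: is_deriveB; exact: is_derive_primitive.
have /klipschitz_segmentP/(_ 0 t (lexx _) t0 t1) := klipschitz_derive D fg.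
by rewrite !primitive0 subrr !subr0 => /le_trans; apply; rewrite ler_piMr.
Qed.

Lemma norm_primitive_le f (C t : R) : {in `[0, 1], continuous f} ->
  (forall t, 0 <= t <= 1 -> `|f t| <= C) -> 0 <= t <= 1 -> `|primitive f t| <= C.
Proof.
move=> cf fC t01; have [t0 t1] := andP t01; have C0 : 0 <= C by apply: le_trans (fC t t01).
have /klipschitz_segmentP/(_ 0 t (lexx _) t0 t1) :=
  klipschitz_derive (fun s => is_derive_primitive cf) fC.
by rewrite primitive0 !subr0 => /le_trans; apply; rewrite ler_piMr.
Qed.

Lemma primitiveE f F (t : R) : (forall t : R, 0 <= t <= 1 -> is_derive t 1 F (f t)) ->
  {in `[0, 1], continuous f} -> 0 <= t <= 1 -> primitive f t = F t - F 0.
Proof.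
move=> dF cf t01; rewrite -[LHS](subrK (F t)) addrC; congr (_ + _).
have := @derive0_constant _ 0 1 (fun s => primitive f s - F s) t;
  rewrite primitive0 sub0r; apply => // r r01.
by apply: is_derive_eq (is_deriveB (is_derive_primitive cf r01) (dF r r01)) _; rewrite subrr.
Qed.

End primitive.

Section lipschitz_ftc.
Context {R : realType}.
Local Notation mu := (@lebesgue_measure R).
Implicit Types (F : R -> R) (n : nat).

Definition diff_quotient F n (t : R) : R := n.+1%:R * (F (t + n.+1%:R^-1) - F t).

Lemma cvg_diff_quotient F (t l : R) : is_derive t 1 F l ->
  diff_quotient F n t @[n --> \oo] --> l.
Proof.
move=> [/cvg_ex[/= l' dF] <-]; have -> : 'D_1 F t = l' by apply/cvg_lim.
apply/cvgrPdist_lt => e e0; move/cvgrPdist_lt: dF => /(_ e e0)[d /= d0 dF].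
near=> n; have := dF n.+1%:R^-1; rewrite /= sub0r normrN ger0_norm ?invr_ge0//.
rewrite invrK [_%:A]mulr1 [_ + t]addrC; apply; last by rewrite invr_neq0.
by near: n; exact: near_infty_natSinv_lt (PosNum d0).
Unshelve. all: by end_near. Qed.

Lemma norm_diff_quotient_le (K : R) F n t : K.-lipschitz F -> `|diff_quotient F n t| <= K.
Proof.
move=> /klipschitzP f_lip; rewrite normrM ger0_norm// mulrC -ler_pdivlMr//.
by rewrite (le_trans (f_lip _ _ I I))// addrAC subrr add0r ger0_norm// invr_ge0.
Qed.

Lemma continuous_diff_quotient F n : continuous F -> continuous (diff_quotient F n).
Proof.
move=> cF t; apply: cvgM; first exact: cvg_cst.
apply: cvgB; last exact: cF.
apply: continuous_comp; last exact: cF.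
by apply: cvgD; [exact: cvg_id|exact: cvg_cst].
Qed.

Lemma integral_diff_quotient_cvg F (a b : R) : a < b -> continuous F ->
  (\int[mu]_(t in `[a, b]) (diff_quotient F n t)%:E)%E @[n --> \oo] --> (F b - F a)%:E.
Proof.
move=> ab cF; pose G x := \int[mu]_(t in `[a - 1, x]) F t.
have a1 : a - 1 < a by rewrite gtrBl.
have dG t : a - 1 < t -> is_derive t 1 G (F t) by move=> at_; exact: is_derive_integral.
have dQ n t : a - 1 < t -> is_derive t 1 (diff_quotient G n) (diff_quotient F n t).
  move=> at_; apply: (is_deriveZ n.+1%:R); apply: is_deriveB; last exact: dG.
  have at_n : a - 1 < t + n.+1%:R^-1 by rewrite ltr_wpDr ?invr_ge0.
  have := @is_derive1_comp _ G (+%R^~ n.+1%:R^-1) t _ 1 (dG _ at_n) _.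
  by rewrite mulr1; apply; exact: is_derive_shift.
have FTC n : (\int[mu]_(t in `[a, b]) (diff_quotient F n t)%:E =
    (diff_quotient G n b - diff_quotient G n a)%:E)%E.
  rewrite (@continuous_FTC2 _ (diff_quotient F n) (diff_quotient G n))//.
  - by apply: continuous_subspaceT => x; exact: continuous_diff_quotient.
  - split=> [x /[!in_itv]/= /andP[ax _]||].
    + by have [] := dQ n x (lt_trans a1 ax).
    + by apply: cvg_at_right_filter; exact: is_derive_continuous (dQ n a a1).
    + by apply: cvg_at_left_filter; exact: is_derive_continuous (dQ n b (lt_trans a1 ab)).
  - move=> x /[!in_itv]/= /andP[ax _]; rewrite derive1E.
    by have [] := dQ n x (lt_trans a1 ax).
under eq_fun do rewrite FTC.
apply: cvg_EFin; first exact: nearW.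
by apply: cvgB; apply: cvg_diff_quotient; apply: dG => //; exact: lt_trans ab.
Qed.

(* Difference quotients of a Lipschitz function are bounded, hence dominated convergence
   applies; no absolute continuity theory is needed. *)
Lemma lipschitz_integral_derive (K a b : R) F (N : set R) : a < b -> K.-lipschitz F ->
  measurable N -> mu N = 0%E -> (forall t : R, (`[a, b] `\` N) t -> derivable F t 1) ->
  measurable_fun (`[a, b] `\` N) (derive1 F) /\
  (\int[mu]_(t in `[a, b] `\` N) (derive1 F t)%:E = (F b - F a)%:E)%E.
Proof.
move=> ab FK mN N0 dF; have cF := klipschitz_continuous FK.
pose D : set R := `[a, b] `\` N; have mD : measurable D by exact: measurableD.
have cvgF' t : D t -> (diff_quotient F n t)%:E @[n --> \oo] --> (derive1 F t)%:E.
  move=> /dF dFt; apply: cvg_EFin; first exact: nearW.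
  by apply: cvg_diff_quotient; rewrite derive1E; exact: derivableP.
have mQ n : measurable_fun D (EFin \o diff_quotient F n).
  apply/measurable_EFinP; apply: measurable_funTS.
  by apply: continuous_measurable_fun => x; exact: continuous_diff_quotient.
have mF' : measurable_fun D (EFin \o derive1 F) by exact: emeasurable_fun_cvg mQ _.
split; first exact/measurable_EFinP.
have [|||_ _ cvgI] := @dominated_convergence _ _ _ mu D mD _ _ (EFin \o cst K) mQ mF'.
- exact: aeW.
- apply: (@integrableS _ _ _ mu `[a, b]%classic D) => //; first exact: subDsetl.
  by apply: continuous_itv_integrable => x; exact: cst_continuous.
- by apply: aeW => x n _ /=; rewrite lee_fin norm_diff_quotient_le.
apply: cvg_unique cvgI _ => //; apply: cvg_trans (integral_diff_quotient_cvg ab cF).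
apply: near_eq_cvg; near=> n => /=.
apply: negligible_integral => //.
by apply: continuous_itv_integrable => x; exact: continuous_diff_quotient.
Unshelve. all: by end_near. Qed.

(* Unlike in [ge0_le_integral], the larger function need not be measurable. *)
Lemma ge0_le_integral_patch (D D' : set R) (h g : R -> \bar R) :
  (forall t, 0 <= (h \_ D) t)%E -> (forall t, (h \_ D) t <= (g \_ D') t)%E ->
  (\int[mu]_(t in D) h t <= \int[mu]_(t in D') g t)%E.
Proof.
move=> h0 hg; rewrite [leLHS]integral_mkcond [leRHS]integral_mkcond !ge0_integralTE//; last first.
  by move=> t; exact: le_trans (h0 t) (hg t).
by apply: ereal_sup_le => _ [s sh <-]; exists s => // t; exact: le_trans (sh t) (hg t).
Qed.

Lemma negligible_integral0 (D N : set R) (f : R -> \bar R) : measurable N -> mu N = 0%E ->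
  (forall t, D t -> 0 <= f t)%E -> (forall t, (D `\` N) t -> f t = 0)%E ->
  (\int[mu]_(t in D) f t = 0)%E.
Proof.
move=> mN N0 f0 fN; apply/eqP; rewrite eq_le integral_ge0// andbT.
have <- : (\int[mu]_(t in N) cst +oo t = 0)%E.
  rewrite (@ge0_negligible_integral _ _ _ mu N N)//; last by move=> t _; exact: leey.
  by rewrite setDv integral_set0.
apply: ge0_le_integral_patch => t; first exact: erestrict_ge0.
rewrite /patch; case: ifPn => [/[!inE] Dt|_]; last by case: ifP => _; rewrite ?leey.
by case: ifPn => [_|]; [exact: leey|rewrite notin_setE => Nt; rewrite fN].
Qed.

Lemma ae_le_integral_nonmeasurable (D D' : set R) (h g : R -> \bar R) :
  measurable D -> D `<=` D' -> (forall t, D t -> 0 <= h t)%E -> measurable_fun D h ->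
  {ae mu, forall t, D t -> (h t <= g t)%E} -> {ae mu, forall t, D' t -> (0 <= g t)%E} ->
  (\int[mu]_(t in D) h t <= \int[mu]_(t in D') g t)%E.
Proof.
move=> mD DD' h0 mh hg g0.
have [N [mN N0 sN]] : mu.-negligible (~` [set t | (D t -> h t <= g t)%E /\ (D' t -> 0 <= g t)%E]).
  exact: (@filterI _ (almost_everywhere mu) _ _ _ hg g0).
have good t : ~ N t -> (D t -> h t <= g t)%E /\ (D' t -> 0 <= g t)%E.
  by move=> Nt; apply: contrapT => bad; apply: Nt; exact: sN.
rewrite (ge0_negligible_integral mN mD mh h0 N0) [leRHS]integralE.
rewrite [X in (_ - X)%E](negligible_integral0 mN N0) ?sube0//; last first.
  by move=> t [D't /good[_ /(_ D't) g0t]]; rewrite funenegE (max_idPr _)// leeNl oppe0.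
apply: ge0_le_integral_patch => t; first by apply: erestrict_ge0 => r [Dr _]; exact: h0.
rewrite /patch; case: ifPn => [|_]; last by case: ifP => // _; exact: funepos_ge0.
rewrite inE => -[Dt /good[/(_ Dt) hgt _]].
by rewrite mem_set; [rewrite funeposE le_max hgt|exact: DD'].
Qed.

Lemma ae_open_segment (a c : R) (P : R -> Prop) :
  {ae mu, forall t, a < t < c -> P t} ->
  exists N, [/\ measurable N, mu N = 0%E & forall t, (`[a, c] `\` N) t -> a < t < c /\ P t].
Proof.
move=> [N [mN N0 bad]]; exists (N `|` [set a] `|` [set c]); split.
- by apply: measurableU => //; exact: measurableU.
- have null1 x : mu.-negligible [set x].
    by apply/negligibleP => //; exact: lebesgue_measure_set1.
  apply/negligibleP; first by apply: measurableU => //; exact: measurableU.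
  by do 2 apply: negligibleU => //; exact/negligibleP.
move=> t [/=]; rewrite in_itv/= => /andP[at_ tc] /not_orP[/not_orP[Nt ta] tc'].
have act : a < t < c.
  by rewrite !lt_neqAle at_ tc !andbT; apply/andP; split; apply/eqP; [move/esym|].
by split => //; apply: contrapT => nPt; apply: Nt; apply: bad => /(_ act).
Qed.

Lemma klipschitz_ftc_le (K a c b : R) (f g : R -> R) : a < c -> c <= b ->
  K.-lipschitz_`[a, c] f ->
  {ae mu, forall t, a < t < c -> derivable f t 1 /\ derive1 f t <= g t} ->
  {ae mu, forall t, a <= t <= b -> 0 <= g t} ->
  ((f c - f a)%:E <= \int[mu]_(t in `[a, b]) (g t)%:E)%E.
Proof.
move=> ac cb fK dfg g0; have ac' := ltW ac.
have K0 : 0 <= K.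
  move: fK => /klipschitz_segmentP/(_ a c (lexx _) ac' (lexx _))/(le_trans (normr_ge0 _)).
  by rewrite pmulr_lge0// subr_gt0.
have [N [mN N_null DP]] := ae_open_segment dfg.
pose F := f \o clamp a c.
have dF (t : R) : (`[a, c] `\` N) t -> is_derive t 1 F (derive1 f t).
  move=> /DP[act [df _]]; apply: (@near_eq_is_derive _ _ _ f).
    have : \forall s \near t, s \in `]a, c[ by apply: near_in_itvoo; rewrite in_itv.
    by apply: filterS => s /[!in_itv]/= /andP[as_ sc]; rewrite /F/= clamp_id// !ltW.
  by rewrite derive1E; exact: derivableP.
have [|mF' intF] := lipschitz_integral_derive ac (klipschitz_clamp ac' K0 fK) mN N_null.
  by move=> t /dF[].
have -> : f c - f a = F c - F a by rewrite /F/= !clamp_id ?lexx ?ac'.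
have mD : measurable (`[a, c] `\` N) by exact: measurableD.
rewrite -intF integralE (le_trans (geeDl _ _))// ?oppe_le0 ?integral_ge0//.
apply: ae_le_integral_nonmeasurable => //.
- by move=> t [/= /[!in_itv]/= /andP[-> /le_trans->]].
- by apply: measurable_funepos; exact/measurable_EFinP.
- apply: (@filterS _ _ (ae_filter_ringOfSetsType mu) _ _ _ g0) => t g0t Dt.
  have [/andP[at_ tc] [_ f'g]] := DP _ Dt.
  rewrite funeposE ge_max !lee_fin derive1E (derive_val (is_derive := dF t Dt)) f'g/=.
  by rewrite g0t// ltW//= (le_trans (ltW tc)).
Qed.

End lipschitz_ftc.


(** * Smooth functions and Taylor estimates *)

Section class_C_theory.
Context {R : realType} {d : nat}.
Implicit Types (U V : set 'rV[R]_d) (f g : 'rV[R]_d -> R).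

Lemma class_C_continuous k U f x : class_C k U f -> U x -> {for x, continuous f}.
Proof. by case: k => [|k] [cf _]; exact: cf. Qed.

Lemma class_C_subset k U V f : V `<=` U -> class_C k U f -> class_C k V f.
Proof.
move=> VU; elim: k f => [|k IH] f [cf Df]; split => //; try by move=> x /VU; exact: cf.
move=> i; have [df Cdf] := Df i; split; last exact: IH.
by move=> x /VU; exact: df.
Qed.

Lemma class_C_pred k U f : class_C k.+1 U f -> class_C k U f.
Proof.
elim: k f => [|k IH] f [cf Df]; split => //.
by move=> i; have [df Cdf] := Df i; split => //; exact: IH.
Qed.

Lemma near_eq_continuous {T : topologicalType} {W : normedModType R} (f g : T -> W) x :
  {near x, f =1 g} -> {for x, continuous f} -> {for x, continuous g}.
Proof.
move=> fg; rewrite /prop_for /continuous_at (nbhs_singleton fg).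
exact: cvg_trans (near_eq_cvg fg).
Qed.

Lemma eq_class_C k U f g : open U -> (forall x, U x -> f x = g x) ->
  class_C k U f -> class_C k U g.
Proof.
move=> oU; elim: k f g => [|k IH] f g fg [cf Df].
  split=> // x Ux; apply: near_eq_continuous (cf x Ux).
  by have := open_nbhs_nbhs (conj oU Ux); apply: filterS => y; exact: fg.
have near_fg x : U x -> {near x, f =1 g}.
  by move=> Ux; have := open_nbhs_nbhs (conj oU Ux); apply: filterS => y; exact: fg.
split=> [x Ux|i]; first exact: near_eq_continuous (near_fg x Ux) (cf x Ux).
have [df Cdf] := Df i; split=> [x Ux|].
  exact: near_eq_derivable (near_fg x Ux) (df x Ux).
by apply: IH Cdf => x Ux; apply: near_eq_derive; exact: near_fg.
Qed.

Lemma class_C_cst k U (c : R) : class_C k U (fun=> c).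
Proof.
elim: k c => [|k IH] c; split => //; try by move=> x _; exact: cst_continuous.
move=> i; split; first by move=> x _; exact: derivable_cst.
rewrite (_ : 'D__ _ = fun=> 0); first exact: IH.
by apply: funext => x; exact: (@derive_cst _ _ _ c).
Qed.

Lemma class_CD k U f g : open U -> class_C k U f -> class_C k U g -> class_C k U (f \+ g).
Proof.
move=> oU; elim: k f g => [|k IH] f g [cf Df] [cg Dg]; split => //;
  try by move=> x Ux; exact: continuousD (cf x Ux) (cg x Ux).
move=> i; have [df Cdf] := Df i; have [dg Cdg] := Dg i; split.
  by move=> x Ux; apply: derivableD; [exact: df|exact: dg].
apply: eq_class_C (IH _ _ Cdf Cdg) => // x Ux.
exact/esym/(deriveD (df x Ux) (dg x Ux)).
Qed.

Lemma class_CM k U f g : open U -> class_C k U f -> class_C k U g -> class_C k U (f \* g).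
Proof.
move=> oU; elim: k f g => [|k IH] f g Cf Cg; have [cf Df] := Cf; have [cg Dg] := Cg;
  split => //; try by move=> x Ux; exact: continuousM (cf x Ux) (cg x Ux).
move=> i; have [df Cdf] := Df i; have [dg Cdg] := Dg i; split.
  by move=> x Ux; apply: derivableM; [exact: df|exact: dg].
have := class_CD oU (IH _ _ (class_C_pred Cf) Cdg) (IH _ _ (class_C_pred Cg) Cdf).
apply: eq_class_C => // x Ux.
exact/esym/(deriveM (df x Ux) (dg x Ux)).
Qed.

Lemma class_CV k U f : open U -> (forall x, U x -> f x != 0) -> class_C k U f ->
  class_C k U (fun x => (f x)^-1).
Proof.
move=> oU f0; elim: k => [|k IH] Cf; have [cf Df] := Cf; split => //;
  try by move=> x Ux; exact: continuousV (f0 x Ux) (cf x Ux).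
move=> i; have [df Cdf] := Df i; split.
  by move=> x Ux; apply: derivableV; [exact: f0|exact: df].
have CV := IH (class_C_pred Cf).
have := class_CM oU (class_CM oU (class_C_cst k U (-1)) (class_CM oU CV CV)) Cdf.
apply: eq_class_C => // x Ux.
have /= -> := deriveV (f0 x Ux) (df x Ux).
by rewrite mulN1r -expr2 exprVn.
Qed.

Lemma eq_smooth_on U f g : open U -> (forall x, U x -> f x = g x) ->
  smooth_on U f -> smooth_on U g.
Proof. by move=> oU fg f_smooth k; exact: eq_class_C (f_smooth k). Qed.

Lemma smooth_on_cst U c : smooth_on U (fun=> c).
Proof. by move=> k; exact: class_C_cst. Qed.

Lemma smooth_onD U f g : open U -> smooth_on U f -> smooth_on U g -> smooth_on U (f \+ g).
Proof. by move=> oU Hf Hg k; exact: class_CD. Qed.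

Lemma smooth_onM U f g : open U -> smooth_on U f -> smooth_on U g -> smooth_on U (f \* g).
Proof. by move=> oU Hf Hg k; exact: class_CM. Qed.

Lemma smooth_onV U f : open U -> (forall x, U x -> f x != 0) -> smooth_on U f ->
  smooth_on U (fun x => (f x)^-1).
Proof. by move=> oU f0 Hf k; exact: class_CV. Qed.

Lemma smooth_on_sum U (I : Type) (r : seq I) (P : pred I) (F : I -> 'rV[R]_d -> R) : open U ->
  (forall i, P i -> smooth_on U (F i)) -> smooth_on U (fun x => \sum_(i <- r | P i) F i x).
Proof.
move=> oU HF; rewrite (_ : (fun x => _) = \sum_(i <- r | P i) F i).
  by elim/big_ind: _ => [|f g|]; [exact: smooth_on_cst|exact: smooth_onD|].
by apply: funext => x; rewrite fct_sumE.
Qed.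

Lemma smooth_on_prod U (I : Type) (r : seq I) (P : pred I) (F : I -> 'rV[R]_d -> R) : open U ->
  (forall i, P i -> smooth_on U (F i)) -> smooth_on U (fun x => \prod_(i <- r | P i) F i x).
Proof.
move=> oU HF; rewrite (_ : (fun x => _) = \prod_(i <- r | P i) F i).
  by elim/big_ind: _ => [|f g|]; [exact: smooth_on_cst|exact: smooth_onM|].
by apply: funext => x; rewrite fct_prodE.
Qed.

Lemma smooth_on_det U n (A : 'rV[R]_d -> 'M[R]_n) : open U ->
  (forall i j, smooth_on U (fun x => A x i j)) -> smooth_on U (fun x => \det (A x)).
Proof.
move=> oU HA; apply: smooth_on_sum => // s _; apply: smooth_onM => //; first exact: smooth_on_cst.
by apply: smooth_on_prod => // i _; exact: HA.
Qed.

Lemma smooth_on_invmx U n (A : 'rV[R]_d -> 'M[R]_n) : open U ->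
  (forall x, U x -> A x \in unitmx) -> (forall i j, smooth_on U (fun x => A x i j)) ->
  forall i j, smooth_on U (fun x => invmx (A x) i j).
Proof.
move=> oU uA HA i j.
apply: (@eq_smooth_on _ (fun x => (\det (A x))^-1 *
    ((-1) ^+ (j + i) * \det (row' j (col' i (A x)))))) => //.
  by move=> x Ux; rewrite /invmx uA// !mxE.
apply: smooth_onM => //.
  by apply: smooth_onV => //; [move=> x /uA; rewrite unitmxE unitfE|exact: smooth_on_det].
apply: smooth_onM => //; first exact: smooth_on_cst.
apply: smooth_on_det => // k l.
by apply: eq_smooth_on (HA (lift j k) (lift i l)) => // x _; rewrite !mxE.
Qed.

End class_C_theory.

Section coordinate_increments.
Context {R : realType} {d : nat}.
Implicit Types (f : 'rV[R]_d -> R) (x h : 'rV[R]_d).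

Lemma row_partial_sum h m :
  \sum_(j < d | (j < m)%N) h 0 j *: 'e_j = \row_i (if (i < m)%N then h 0 i else 0).
Proof.
rewrite [RHS]row_sum_delta [in RHS](bigID (fun j : 'I_d => (j < m)%N))/=.
rewrite [X in _ + X]big1 ?addr0; last by move=> j /negPf jm; rewrite mxE jm scale0r.
by apply: eq_bigr => j jm; rewrite mxE jm.
Qed.

Lemma coordinate_increments f x h :
  (forall z k, `|z - x| <= `|h| -> derivable f z (delta_mx 0 k)) ->
  exists z : 'I_d -> 'rV[R]_d, (forall k, `|z k - x| <= `|h|) /\
    f (x + h) - f x = \sum_k h 0 k * 'D_(delta_mx 0 k) f (z k).
Proof.
move=> df; pose w (m : nat) : 'rV[R]_d := \sum_(j < d | (j < m)%N) h 0 j *: delta_mx 0 j.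
have wS (k : 'I_d) : w k.+1 = w k + h 0 k *: delta_mx 0 k.
  rewrite /w (bigD1 k)//= addrC; congr (_ + _); apply: eq_bigl => j.
  by rewrite ltnS [RHS]ltn_neqAle andbC -val_eqE.
have near_x (k : 'I_d) (s : R) : 0 <= s <= 1 ->
  `|x + w k + (s * h 0 k) *: delta_mx 0 k - x| <= `|h|.
  move=> /andP[s0 s1]; rewrite addrAC [x + _]addrC addrK; apply: mx_norm_le => // i j;
    rewrite /w row_partial_sum ord1 !mxE eqxx/=.
  apply: le_trans (ler_norm_mx h 0 j); have [->|jk] := eqVneq j k.
    by rewrite ltnn add0r mulr1 normrM ger0_norm// ler_piMl.
  by rewrite !mulr0 addr0; case: ifP => // _; rewrite normr0.
have slice (k : 'I_d) (s : R) : 0 <= s <= 1 -> is_derive s 1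
    (fun s => f (x + w k + (s * h 0 k) *: delta_mx 0 k))
    ('D_(delta_mx 0 k) f (x + w k + (s * h 0 k) *: delta_mx 0 k) * h 0 k).
  move=> s01; have dh : is_derive s 1 ( *%R^~ (h 0 k)) (h 0 k).
    apply: is_derive_eq (is_derive_mul (is_derive_id s 1) (is_derive_cst (h 0 k) s 1)) _.
    by rewrite mul1r mulr0 addr0.
  have line : is_derive (s * h 0 k) 1 (fun r => f (x + w k + r *: delta_mx 0 k))
      ('D_(delta_mx 0 k) f (x + w k + (s * h 0 k) *: delta_mx 0 k)).
    by apply/is_derive_line/derivableP/df; exact: near_x.
  exact: (@is_derive1_comp _ (fun r : R => f (x + w k + r *: delta_mx 0 k)) _ s _ _ line dh).
have mvt (k : 'I_d) : exists z, `|z - x| <= `|h| /\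
    f (x + w k.+1) - f (x + w k) = h 0 k * 'D_(delta_mx 0 k) f z.
  have [||s] := MVT_segment (@ler01 R) (f := fun s => f (x + w k + (s * h 0 k) *: delta_mx 0 k))
    (df := fun s => 'D_(delta_mx 0 k) f (x + w k + (s * h 0 k) *: delta_mx 0 k) * h 0 k).
  - by move=> s s01; apply: slice; exact: subset_itv_oo_cc s01.
  - by apply: derivable_within_continuous => s /[!in_itv]/(slice k)[].
  rewrite in_itv/= mul1r mul0r scale0r addr0 subr0 mulr1 -addrA -wS => s01 E.
  exists (x + w k + (s * h 0 k) *: delta_mx 0 k); split; [exact: near_x|by rewrite E mulrC].
have [z Hz] := choice mvt; exists z; split=> [k|]; first exact: (Hz k).1.
under eq_bigr => k _ do rewrite -(Hz k).2.
rewrite -(big_mkord xpredT (fun k => f (x + w k.+1) - f (x + w k))) telescope_sumr//.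
by rewrite /w !row_partial_sum; congr (f _ - f _); apply/rowP => i;
  rewrite !mxE ?ltn_ord ?ltn0 ?addr0.
Qed.

Lemma differentiable_approx {V W : normedModType R} (F : V -> W) (L : {linear V -> W}) (x : V) :
  continuous L ->
  (forall e : R, 0 < e -> \forall v \near 0, `|F (x + v) - F x - L v| <= e * `|v|) ->
  differentiable F x.
Proof.
move=> cL FL; have expansion : F \o shift x = cst (F x) + L +o_ 0 id.
  apply/eqaddoP => _/posnumP[e]; apply: filterS (FL e%:num _) => // v.
  by rewrite !fctE /= opprD addrA [v + x]addrC.
by apply/diff_locallyP; rewrite (diff_unique cL expansion).
Qed.

Lemma dot_continuous (u : 'rV[R]_d) : continuous (dot u).
Proof.
apply: (@klipschitz_continuous _ _ _ (d%:R * `|u|)); apply/klipschitzP => v w _ _.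
by rewrite -dotBr -mulrA norm_dot_le.
Qed.

Lemma class_C1_differentiable (U : set 'rV[R]_d) f x :
  open U -> class_C 1 U f -> U x -> differentiable f x.
Proof.
move=> oU [_ Cf] Ux; apply: (@differentiable_approx _ _ _ (dot (grad f x))) => [|e e0].
  exact: dot_continuous.
have [r /= r0 rU] : exists2 r : R, 0 < r & ball x r `<=` U.
  exact/nbhs_ballP/open_nbhs_nbhs.
have d10 : 0 < (d.+1%:R : R) by [].
have near_partials : \forall y \near x,
    forall k, `|'D_(delta_mx 0 k) f x - 'D_(delta_mx 0 k) f y| <= e / d.+1%:R.
  apply: (@filter_forall _ _ (fun k y => `|_ - 'D_(delta_mx 0 k) f y| <= _) (nbhs x)) => k.
  have [_ [cDf _]] := Cf k.
  by have := @cvgr_dist_le _ _ _ (nbhs x) _ _ _ (cDf x Ux) (e / d.+1%:R); apply; rewrite divr_gt0.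
have [r' /= r'0 Hr'] := (nbhs_ballP _ _).1 near_partials.
have rr0 : 0 < Num.min r r' by rewrite lt_min r0.
apply/nbhs_ballP; exists (Num.min r r') => // h;
  rewrite -ball_normE/= sub0r normrN lt_min => /andP[hr hr'].
have in_ball z s : `|z - x| <= `|h| -> `|h| < s -> ball x s z.
  by move=> zh hs; rewrite -ball_normE/= distrC (le_lt_trans zh).
have [|z [zh ->]] := @coordinate_increments f x h.
  by move=> z k zh; have [df _] := Cf k; apply/df/rU; exact: in_ball zh hr.
rewrite dot_sum -sumrB (le_trans (ler_norm_sum _ _ _))//.
apply: (@le_trans _ _ (\sum_(k < d) (e / d.+1%:R * `|h|))).
  apply: ler_sum => k _; rewrite mxE [_ * h 0 k]mulrC -mulrBr normrM mulrC distrC.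
  by rewrite ler_pM ?ler_norm_mx//; apply: Hr'; exact: in_ball (zh k) hr'.
rewrite sumr_const card_ord -[leLHS]mulr_natl mulrA ler_wpM2r// mulrCA ler_piMr ?ltW//.
by rewrite ltr_pdivrMr// mul1r ltr_nat.
Qed.

End coordinate_increments.

Section C11.
Context {R : realType}.
Implicit Types (E V W : normedModType R).

(* [F] has a Lipschitz derivative on [A], with quantitative constants; the last field is
   Taylor's formula, which holds between any two points of [A] even if [A] is not convex. *)
Record C11_on E V (A : set E) (C : R) (F : E -> V) : Prop := MkC11 {
  C11_differentiable : forall x, A x -> differentiable F x;
  C11_bounded : forall x, A x -> `|F x| <= C;
  C11_diff_bounded : forall x v, A x -> `|'d F x v| <= C * `|v|;
  C11_lipschitz : forall x y, A x -> A y -> `|F y - F x| <= C * `|y - x|;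
  C11_diff_lipschitz : forall x y v, A x -> A y ->
    `|'d F y v - 'd F x v| <= C * (`|y - x| * `|v|);
  C11_taylor : forall x y, A x -> A y ->
    `|F y - F x - 'd F x (y - x)| <= C * `|y - x| ^+ 2
}.

Definition C11 E V (A : set E) (F : E -> V) := exists2 C, 0 <= C & C11_on A C F.

Lemma C11_on_weaken E V (A : set E) (C D : R) (F : E -> V) :
  C <= D -> C11_on A C F -> C11_on A D F.
Proof.
by move=> CD [dF bF b'F lF l'F tF]; split=> // *; first [apply: le_trans CD; exact: bF|
  apply: le_trans (ler_wpM2r _ CD); rewrite ?exprn_ge0 ?mulr_ge0//;
    solve [exact: b'F|exact: lF|exact: l'F|exact: tF]].
Qed.

Lemma C11_cst E V (A : set E) (v : V) : C11 A (fun=> v).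
Proof.
exists `|v| => //; split=> *.
- exact: differentiable_cst.
- by [].
- by rewrite diff_cst normr0 mulr_ge0.
- by rewrite subrr normr0 mulr_ge0.
- by rewrite !diff_cst subrr normr0 !mulr_ge0.
- by rewrite diff_cst !subrr normr0 mulr_ge0// exprn_ge0.
Qed.

Lemma C11_bounded_linear E E' V (L : {linear E' -> E}) (A : set E) (A' : set E') (F : E -> V) :
  continuous L -> (forall x, `|L x| <= `|x|) -> (forall x, A' x -> A (L x)) ->
  C11 A F -> C11 A' (F \o L).
Proof.
move=> cL L1 LA [C C0 [dF bF b'F lF l'F tF]].
have dL x : differentiable L x by exact: linear_differentiable.
have dFL x v : A' x -> 'd (F \o L) x v = 'd F (L x) (L v).
  by move=> /LA/dF dFx; rewrite diff_comp//= (diff_lin _ cL).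
exists C => //; split=> /=.
- by move=> x /LA/dF dFx; exact: differentiable_comp.
- by move=> x /LA/bF.
- by move=> x v Ax; rewrite dFL// (le_trans (b'F _ _ (LA _ Ax)))// ler_wpM2l.
- by move=> x y /LA Ax /LA Ay; rewrite (le_trans (lF _ _ Ax Ay))// -linearB ler_wpM2l.
- move=> x y v Ax Ay; rewrite !dFL// (le_trans (l'F _ _ _ (LA _ Ax) (LA _ Ay)))//.
  by rewrite -linearB ler_wpM2l// ler_pM.
- move=> x y Ax Ay; rewrite dFL// linearB (le_trans (tF _ _ (LA _ Ax) (LA _ Ay)))//.
  by rewrite -linearB ler_wpM2l// ler_sqr ?nnegrE.
Qed.

Lemma C11_id E (A : set E) (r : R) : (forall x, A x -> `|x| <= r) -> C11 A (@idfun E).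
Proof.
move=> Ar; exists (Num.max r 1); first by rewrite le_max ler01 orbT.
have C1 : 1 <= Num.max r 1 by rewrite le_max lexx orbT.
have did (x : E) v : 'd idfun x v = v by have [_ ->] := is_diff_id x.
split=> *; rewrite ?did ?subrr ?normr0 ?mulr_ge0 ?exprn_ge0 ?(le_trans ler01 C1)// ?ler_peMl//.
by rewrite (le_trans (Ar _ _))// le_max lexx.
Qed.

Lemma C11D E V (A : set E) (F G : E -> V) : C11 A F -> C11 A G -> C11 A (F \+ G).
Proof.
move=> [C C0 HF] [D D0 HG]; exists (C + D); first exact: addr_ge0.
have dFG x v : A x -> 'd (F \+ G) x v = 'd F x v + 'd G x v.
  by move=> Ax; rewrite diffD//; [exact: C11_differentiable HF _
    Ax|exact: C11_differentiable HG _ Ax].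
split=> [x Ax|x Ax|x v Ax|x y Ax Ay|x y v Ax Ay|x y Ax Ay]; rewrite /= ?dFG//.
- by apply: differentiableD; [exact: C11_differentiable HF _ Ax|exact: C11_differentiable HG _ Ax].
- by rewrite (le_trans (ler_normD _ _))// lerD ?(C11_bounded HF) ?(C11_bounded HG).
- by rewrite (le_trans (ler_normD _ _))// mulrDl lerD ?(C11_diff_bounded HF) ?(C11_diff_bounded HG).
- by rewrite opprD addrACA (le_trans (ler_normD _ _))//
    mulrDl lerD ?(C11_lipschitz HF) ?(C11_lipschitz HG).
- rewrite opprD addrACA (le_trans (ler_normD _ _))// mulrDl.
  by rewrite lerD ?(C11_diff_lipschitz HF) ?(C11_diff_lipschitz HG).
- rewrite !opprD (addrACA (F y)) [X in `|X|]addrACA (le_trans (ler_normD _ _))// mulrDl.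
  by rewrite lerD ?(C11_taylor HF) ?(C11_taylor HG).
Qed.

End C11.

Section C11_bilinear.
Context {R : realType} {E U V W : normedModType R}.
Variables (op : {bilinear U -> V -> W}) (k : R).
Hypotheses (k_ge0 : 0 <= k) (op_bounded : forall u v, `|op u v| <= k * (`|u| * `|v|)).

Let op_le u v (a b : R) : `|u| <= a -> `|v| <= b -> `|op u v| <= k * (a * b).
Proof. by move=> ua vb; rewrite (le_trans (op_bounded u v))// ler_wpM2l// ler_pM. Qed.

Lemma C11_op (A : set E) (F : E -> U) (G : E -> V) :
  C11 A F -> C11 A G -> C11 A (fun x => op (F x) (G x)).
Proof.
move=> [C C0 HF] [D D0 HG].
have dFG x v : A x -> 'd (fun x => op (F x) (G x)) x v = op ('d F x v) (G x) + op (F x) ('d G x v).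
  move=> Ax; have := is_diff_bounded_bilinear op_bounded
    (differentiableP (C11_differentiable HF Ax)) (differentiableP (C11_differentiable HG Ax)).
  by move=> [_ ->].
have CD0 : 0 <= k * (C * D) by rewrite !mulr_ge0.
exists (k * (C * D) *+ 4); first by rewrite mulrn_wge0.
split=> [x Ax|x Ax|x v Ax|x y Ax Ay|x y v Ax Ay|x y Ax Ay]; rewrite ?dFG//.
- have := is_diff_bounded_bilinear op_bounded
    (differentiableP (C11_differentiable HF Ax)) (differentiableP (C11_differentiable HG Ax)).
  by move=> [].
- apply: (le_trans (op_le (C11_bounded HF Ax) (C11_bounded HG Ax))).
  rewrite -subr_ge0 (_ : _ - _ = k * (C * D) *+ 3); last by ring.
  by rewrite mulrn_wge0.
- apply: (le_trans (ler_normD _ _)).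
  apply: (le_trans (lerD (op_le (C11_diff_bounded HF v Ax) (C11_bounded HG Ax))
    (op_le (C11_bounded HF Ax) (C11_diff_bounded HG v Ax)))).
  rewrite -subr_ge0 (_ : _ - _ = k * (C * D) * `|v| *+ 2); last by ring.
  by rewrite mulrn_wge0// mulr_ge0.
- rewrite bilinear_subE; apply: (le_trans (ler_normD _ _)).
  apply: (le_trans (lerD (op_le (C11_lipschitz HF Ax Ay) (C11_bounded HG Ay))
    (op_le (C11_bounded HF Ax) (C11_lipschitz HG Ax Ay)))).
  rewrite -subr_ge0 (_ : _ - _ = k * (C * D) * `|y - x| *+ 2); last by ring.
  by rewrite mulrn_wge0// mulr_ge0.
- rewrite opprD addrACA !bilinear_subE.
  apply: (le_trans (ler_normD _ _)); apply: (le_trans (lerD (ler_normD _ _) (ler_normD _ _))).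
  apply: (le_trans (lerD
    (lerD (op_le (C11_diff_lipschitz HF v Ax Ay) (C11_bounded HG Ay))
          (op_le (C11_diff_bounded HF v Ax) (C11_lipschitz HG Ax Ay)))
    (lerD (op_le (C11_lipschitz HF Ax Ay) (C11_diff_bounded HG v Ay))
          (op_le (C11_bounded HF Ax) (C11_diff_lipschitz HG v Ax Ay))))).
  by rewrite le_eqVlt; apply/orP; left; apply/eqP; ring.
- rewrite bilinear_remainderE.
  apply: (le_trans (ler_normD _ _)); apply: (le_trans (lerD (ler_normD _ _) (lexx _))).
  apply: (le_trans (lerD
    (lerD (op_le (C11_taylor HF Ax Ay) (C11_bounded HG Ay))
          (op_le (C11_diff_bounded HF (y - x) Ax) (C11_lipschitz HG Ax Ay)))
    (op_le (C11_bounded HF Ax) (C11_taylor HG Ax Ay)))).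
  rewrite -subr_ge0 (_ : _ - _ = k * (C * D) * `|y - x| ^+ 2); last by ring.
  by rewrite mulr_ge0// exprn_ge0.
Qed.

End C11_bilinear.

Section C11_mx.
Context {R : realType} {E : normedModType R} {m n : nat}.
Implicit Types (A : set E) (F : E -> 'M[R]_(m, n)).

Lemma differentiable_mx F x :
  (forall i j, differentiable (fun y => F y i j) x) -> differentiable F x.
Proof.
move=> dF; rewrite (_ : F = fun y => \sum_i \sum_j F y i j *: delta_mx i j).
  rewrite (_ : (fun y => _) = \sum_i \sum_j (fun y => F y i j *: delta_mx i j)).
    by apply: differentiable_sum => i; apply: differentiable_sum => j; exact: differentiableZl.
  by apply: funext => y; rewrite fct_sumE; apply: eq_bigr => i _; rewrite fct_sumE.
by apply: funext => y; exact: matrix_sum_delta.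
Qed.

Lemma diff_mxE F x v i j : differentiable F x ->
  'd F x v i j = 'd (fun y => F y i j) x v.
Proof.
move=> dF; have dFij : differentiable (fun y => F y i j) x.
  exact: (differentiable_comp dF (differentiable_coord _ i j)).
by rewrite -!deriveE// derive_mx ?mxE//; exact: diff_derivable.
Qed.

Lemma C11_matrix A F : (forall i j, C11 A (fun x => F x i j)) -> C11 A F.
Proof.
move=> HF; have [D D0 HD'] := @uniform_bound _ ('I_m * 'I_n)%type
  (fun ij C => C11_on A C (fun x => F x ij.1 ij.2)) (fun ij C D => @C11_on_weaken _ _ _ _ C D _)
  (fun ij => HF ij.1 ij.2).
have HD i j : C11_on A D (fun x => F x i j) by exact: HD' (i, j).
have dF x : A x -> differentiable F x.
  by move=> Ax; apply: differentiable_mx => i j; exact: C11_differentiable (HD i j) x Ax.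
exists D => //; split=> //.
- by move=> x Ax; apply: mx_norm_le => // i j; exact: C11_bounded (HD i j) x Ax.
- move=> x v Ax; apply: mx_norm_le => [|i j]; first by rewrite mulr_ge0.
  by rewrite diff_mxE ?(C11_diff_bounded (HD i j))//; exact: dF.
- move=> x y Ax Ay; apply: mx_norm_le => [|i j]; first by rewrite mulr_ge0.
  by rewrite !mxE (C11_lipschitz (HD i j)).
- move=> x y v Ax Ay; apply: mx_norm_le => [|i j]; first by rewrite !mulr_ge0.
  by rewrite !mxE !diff_mxE ?(C11_diff_lipschitz (HD i j))//; exact: dF.
- move=> x y Ax Ay; apply: mx_norm_le => [|i j]; first by rewrite mulr_ge0// exprn_ge0.
  by rewrite !mxE !diff_mxE ?(C11_taylor (HD i j))//; exact: dF.
Qed.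

End C11_mx.

Section C11_convex.
Context {R : realType} {E : normedModType R}.
Implicit Types (A : set E) (f : E -> R).

Definition segment_closed A :=
  forall x y (t : R), A x -> A y -> 0 <= t <= 1 -> A (x + t *: (y - x)).

Lemma diff_segment_le A f (L : {linear E -> R}) (C : R) x y : segment_closed A ->
  (forall z, A z -> differentiable f z) -> A x -> A y ->
  (forall t : R, 0 <= t <= 1 ->
    `|'d f (x + t *: (y - x)) (y - x) - L (y - x)| <= C) ->
  `|f y - f x - L (y - x)| <= C.
Proof.
move=> cA df Ax Ay bound; set v := y - x in bound *.
have dline (t : R) : 0 <= t <= 1 ->
    is_derive t 1 (fun t => f (x + t *: v) - t * L v) ('d f (x + t *: v) v - L v).
  move=> t01; apply: is_deriveB.
    have dfz := df _ (cA _ _ _ Ax Ay t01).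
    by apply: is_derive_line; apply: DeriveDef; [exact: diff_derivable|rewrite deriveE].
  apply: is_derive_eq (is_derive_mul (is_derive_id t 1) (is_derive_cst (L v) t 1)) _.
  by rewrite mul1r mulr0 addr0.
have /klipschitz_segmentP/(_ 0 1 (lexx _) ler01 (lexx _)) := klipschitz_derive dline bound.
rewrite scale1r mul1r scale0r mul0r !subr0 addr0 mulr1 /v [x + _]addrC subrK.
by rewrite addrAC.
Qed.

Lemma C11_segment_closed A f (C : R) : segment_closed A -> 0 <= C ->
  (forall x, A x -> differentiable f x) -> (forall x, A x -> `|f x| <= C) ->
  (forall x v, A x -> `|'d f x v| <= C * `|v|) ->
  (forall x y v, A x -> A y -> `|'d f y v - 'd f x v| <= C * (`|y - x| * `|v|)) ->
  C11_on A C f.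
Proof.
move=> cA C0 df bf bdf ldf; split=> // x y Ax Ay.
  have := @diff_segment_le A f \0 (C * `|y - x|) x y cA df Ax Ay; rewrite /= subr0; apply.
  by move=> t t01; rewrite subr0 bdf//; exact: cA.
apply: (diff_segment_le (L := 'd f x) cA df Ax Ay) => t /[dup] t01 /andP[t0 t1].
rewrite (le_trans (ldf _ _ _ Ax (cA _ _ _ Ax Ay t01)))// addrAC subrr add0r normrZ ger0_norm//.
by rewrite ler_wpM2l// expr2 -mulrA ler_piMl// mulr_ge0.
Qed.

End C11_convex.

Section C11_cube.
Context {R : realType} {d : nat}.
Implicit Types (U : set 'rV[R]_d) (f : 'rV[R]_d -> R).

Definition cube (y0 : 'rV[R]_d) (r : R) : set 'rV[R]_d := [set z | `|z - y0| <= r].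

Lemma open_cube U y0 : open U -> U y0 -> exists2 r : R, 0 < r & cube y0 r `<=` U.
Proof.
move=> oU Uy0; have /nbhs_ballP[r /= r0 rU] := open_nbhs_nbhs (conj oU Uy0).
exists (r / 2); first by rewrite divr_gt0.
by move=> z zr; apply: rU; rewrite -ball_normE /= distrC (le_lt_trans zr)//
  gtr_pMr// invf_lt1// ltr1n.
Qed.

Lemma nbhs_cube y0 (r : R) : 0 < r -> nbhs y0 (cube y0 r).
Proof.
move=> r0; apply/nbhs_ballP; exists r => // z.
by rewrite -ball_normE/= distrC => /ltW.
Qed.

Lemma cube_compact y0 r : compact (cube y0 r).
Proof.
apply: bounded_closed_compact.
  exists (`|y0| + r); split; first exact: num_real.
  move=> M ltM z /= zr; rewrite (le_trans _ (ltW ltM))//.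
  by rewrite -[z](subrK y0) (le_trans (ler_normD _ _))// addrC lerD2l.
rewrite (_ : cube y0 r = (fun z => `|z - y0|) @^-1` [set s | s <= r])//.
apply: preimage_closed; last exact: closed_le.
move=> z _; apply: (@cvg_norm _ _ _ (nbhs z)).
by apply: (@cvgB _ _ _ (nbhs z)); [exact: cvg_id|exact: cvg_cst].
Qed.

Lemma cube_segment_closed y0 r : segment_closed (cube y0 r).
Proof.
move=> x y t xr yr /andP[t0 t1]; rewrite /cube/=.
rewrite (_ : _ - _ = (1 - t) *: (x - y0) + t *: (y - y0)); last first.
  by rewrite addrAC scalerBl scale1r -[RHS]addrA [- _ + _]addrC -scalerBr opprB subrKA.
rewrite (le_trans (ler_normD _ _))// !normrZ !ger0_norm ?subr_ge0//.
apply: (@le_trans _ _ ((1 - t) * r + t * r)); last by lra.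
by rewrite lerD// ler_wpM2l ?subr_ge0.
Qed.

Lemma continuous_cube_bounded f y0 (r : R) :
  (forall z, cube y0 r z -> {for z, continuous f}) ->
  exists2 C : R, 0 <= C & forall z, cube y0 r z -> `|f z| <= C.
Proof.
move=> cf; have [M [_ HM]] : bounded_set (f @` cube y0 r).
  apply: compact_bounded; apply: continuous_compact; last exact: cube_compact.
  by apply: continuous_in_subspaceT => z /[!inE]; exact: cf.
exists (`|M| + 1); first by rewrite addr_ge0.
move=> z zr; apply: HM; last by exists z.
by rewrite (le_lt_trans (ler_norm _))// ltrDl.
Qed.

Lemma class_C1_grad_bounded U f y0 (r : R) : cube y0 r `<=` U -> class_C 1 U f ->
  exists2 C : R, 0 <= C & forall x, cube y0 r x -> `|grad f x| <= C.
Proof.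
move=> rU [_ Cf]; have [C C0 HC] := @uniform_bound _ 'I_d
  (fun k C => forall x, cube y0 r x -> `|'D_(delta_mx 0 k) f x| <= C)
  (fun k C D CD HC x xr => le_trans (HC x xr) CD)
  (fun k => continuous_cube_bounded (fun z zr => (Cf k).2.1 z (rU z zr))).
by exists C => // x xr; apply: mx_norm_le => // i j; rewrite mxE; exact: HC.
Qed.

Lemma class_C1_lipschitz_cube U f y0 (r : R) : open U -> cube y0 r `<=` U -> class_C 1 U f ->
  exists2 C : R, 0 <= C & forall x y, cube y0 r x -> cube y0 r y -> `|f y - f x| <= C * `|y - x|.
Proof.
move=> oU rU Cf; have [C C0 HC] := class_C1_grad_bounded rU Cf.
exists (d%:R * C) => [|x y xr yr]; first exact: mulr_ge0.
have df z : cube y0 r z -> differentiable f z by move=> /rU; exact: class_C1_differentiable.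
have := @diff_segment_le _ _ _ f \0 (d%:R * C * `|y - x|) x y (@cube_segment_closed y0 r) df xr yr.
rewrite /= subr0; apply => t t01; have ztr := cube_segment_closed xr yr t01.
by rewrite subr0 diff_grad ?(le_trans (norm_dot_le _ _))//
  -?mulrA ?ler_wpM2l ?ler_wpM2r ?HC//; exact: df.
Qed.

Lemma class_C2_C11 U f y0 (r : R) : open U -> cube y0 r `<=` U -> class_C 2 U f ->
  C11 (cube y0 r) f.
Proof.
move=> oU rU Cf; have C1f := class_C_pred Cf.
have [A A0 HA] : exists2 A : R, 0 <= A & forall x, cube y0 r x -> `|f x| <= A.
  by apply: continuous_cube_bounded => z /rU; exact: class_C_continuous Cf.
have [B B0 HB] := class_C1_grad_bounded rU C1f.
have [C C0 HC] := @uniform_bound _ 'I_d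
  (fun k C => forall x y, cube y0 r x -> cube y0 r y ->
    `|'D_(delta_mx 0 k) f y - 'D_(delta_mx 0 k) f x| <= C * `|y - x|)
  (fun k C D CD HC x y xr yr => le_trans (HC x y xr yr) (ler_wpM2r (normr_ge0 _) CD))
  (fun k => class_C1_lipschitz_cube oU rU (Cf.2 k).2).
have df z : cube y0 r z -> differentiable f z by move=> /rU; exact: class_C1_differentiable.
have D0 : 0 <= A + d%:R * B + d%:R * C by rewrite !addr_ge0 ?mulr_ge0.
exists (A + d%:R * B + d%:R * C) => //; apply: C11_segment_closed => //.
- exact: cube_segment_closed.
- by move=> x xr; rewrite (le_trans (HA x xr))// -addrA lerDl addr_ge0 ?mulr_ge0.
- move=> x v xr; have dfx := df x xr.
  rewrite diff_grad// (le_trans (norm_dot_le _ _))// mulrA ler_wpM2r//.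
  by rewrite (le_trans (ler_wpM2l _ (HB x xr)))// addrAC lerDr addr_ge0 ?mulr_ge0.
- move=> x y v xr yr.
  have -> : 'd f y v - 'd f x v = dot (grad f y - grad f x) v.
    by rewrite dotBl -(diff_grad _ (df y yr)) -(diff_grad _ (df x xr)).
  apply: (le_trans (norm_dot_le _ _)); rewrite mulrA [leRHS]mulrA ler_wpM2r//.
  apply: (@le_trans _ _ (d%:R * (C * `|y - x|))).
    rewrite ler_wpM2l//; apply: mx_norm_le => [|i j]; first by rewrite mulr_ge0.
    by rewrite !mxE HC.
  by rewrite mulrA ler_wpM2r// lerDr addr_ge0 ?mulr_ge0.
Qed.

End C11_cube.

Section chart_theory.
Context {R : realType} {d : nat} (M : contact_subriemannian_manifold R d).
Implicit Types (c : chart R d M) (h : R -> M).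

Lemma cimgP c x : cimg c x -> cdom c (cinv c x) /\ cmap c (cinv c x) = x.
Proof. by move=> [p cp <-]; rewrite (cmapK cp). Qed.

Lemma cinv_nbhs c (p : M) (B : set M) : cdom c p -> nbhs p B -> nbhs (cmap c p) (cinv c @^-1` B).
Proof.
move=> cp nB; have /= := @cinv_continuous _ _ _ c (cmap c p); apply; first by exists p.
by rewrite (cmapK cp).
Qed.

Lemma chart_overlap_open c c' : open (cmap c @` (cdom c `&` cdom c')).
Proof.
rewrite openE => _ [p [cp c'p] <-]; have c'near := open_nbhs_nbhs (conj (cdom_open c') c'p).
have cnear : nbhs (cmap c p) (cimg c).
  by apply: open_nbhs_nbhs; split; [exact: cimg_open|exists p].
apply: (filterS _ (filterI cnear (cinv_nbhs cp c'near))) => z [[p' cp' <-]] /=.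
by rewrite (cmapK cp'); exists p'.
Qed.

Lemma transition_differentiable c c' (p : M) : atlas c -> atlas c' -> cdom c p -> cdom c' p ->
  differentiable (transition c c') (cmap c p).
Proof.
move=> ac ac' cp c'p; have [smooth _] := atlas_compatible ac ac'.
apply: differentiable_mx => i j; rewrite ord1.
by apply: (class_C1_differentiable (@chart_overlap_open c c') (smooth j 1%N)); exists p.
Qed.

Lemma transition_lipschitz c c' (p : M) : atlas c -> atlas c' -> cdom c p -> cdom c' p ->
  exists2 r : R, 0 < r & C11 (cube (cmap c p) r) (transition c c').
Proof.
move=> ac ac' cp c'p; have [smooth _] := atlas_compatible ac ac'.
have oU := @chart_overlap_open c c'.
have [|r r0 rU] := open_cube oU (_ : _ (cmap c p)); first by exists p.
exists r => //; apply: C11_matrix => i j; rewrite ord1.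
exact: class_C2_C11 oU rU (smooth j 2).
Qed.

Lemma chart_velocity c c' h (t : R) v : atlas c -> atlas c' ->
  (\forall s \near t, cdom c (h s)) -> cdom c' (h t) ->
  is_derive t 1 (cmap c \o h) v ->
  is_derive t 1 (cmap c' \o h) (change_coord c c' (h t) v).
Proof.
move=> ac ac' near_c c'h dx; have ch : cdom c (h t) := nbhs_singleton near_c.
have dF := transition_differentiable ac ac' ch c'h.
rewrite /change_coord deriveE//.
apply: (@near_eq_is_derive _ _ _ (transition c c' \o (cmap c \o h))).
  by apply: filterS near_c => s cs /=; rewrite /transition /= (cmapK cs).
exact: is_derive_comp_diff.
Qed.

Lemma sq_speedE c h (t : R) v : atlas c ->
  (\forall s \near t, cdom c (h s)) -> is_derive t 1 (cmap c \o h) v ->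
  distr c (h t) v -> sq_speed h t = metric c (h t) v v.
Proof.
move=> ac near_c dx dv; have ch : cdom c (h t) := nbhs_singleton near_c.
rewrite /sq_speed; set A := [set e | _].
have AE e : A e -> e = metric c (h t) v v.
  move=> [c' [ac' c'h ->]].
  have [_ velE] := chart_velocity ac ac' near_c c'h dx.
  by rewrite /velocity derive1E velE; exact: metric_change_coord.
apply: AE; apply: xgetPex; exists (metric c (h t) v v), c; split => //.
by have [_ vE] := dx; rewrite /velocity derive1E vE.
Qed.

Lemma distr0 c (p : M) : atlas c -> cdom c p -> distr c p 0.
Proof.
move=> ac cp; have cx : cimg c (cmap c p) by exists p.
have [W [al [[_ Wx] WC _ contact]]] := distr_contact ac cx.
have [_ + _] := contact _ Wx; rewrite (cmapK cp) => ->.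
by rewrite /form_app big1// => i _; rewrite mxE mulr0.
Qed.

Lemma metric0l c (p : M) w : atlas c -> cdom c p -> distr c p w -> metric c p 0 w = 0.
Proof.
move=> ac cp dw; have d0 := distr0 ac cp.
have := metric_linear (-1) ac cp d0 d0 dw.
by rewrite scaler0 addr0 mulN1r addNr.
Qed.

Lemma metric_ge0 c (p : M) v : atlas c -> cdom c p -> distr c p v -> 0 <= metric c p v v.
Proof.
move=> ac cp dv; have [->|v0] := eqVneq v 0; last by rewrite ltW// metric_pos.
by rewrite metric0l//; exact: distr0.
Qed.

Lemma lipschitz_curveP (a b : R) h c (t : R) : lipschitz_curve a b h -> atlas c ->
  a <= t <= b -> cdom c (h t) ->
  exists2 e : R, 0 < e & exists2 K : R, 0 <= K &
    (forall s, a <= s <= b -> `|s - t| < e -> cdom c (h s)) /\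
    (forall s s', a <= s <= b -> a <= s' <= b -> `|s - t| < e -> `|s' - t| < e ->
      `|cmap c (h s') - cmap c (h s)| <= K * `|s' - s|).
Proof.
move=> lh ac tab ct; have [V [/nbhs_ballP[e /= e0 He] Vc /lipschitzP[K K0 /klipschitzP HK]]] :=
  lh c t ac tab ct.
exists e => //; exists K => //.
have Vs s : `|s - t| < e -> V s by move=> st; apply: He; rewrite -ball_normE /= distrC.
split=> [s sab st|s s' sab s'ab st s't]; first by apply: Vc => //; exact: Vs.
by apply: HK; split; rewrite /= ?in_itv//; exact: Vs.
Qed.

Lemma curve_near (a b : R) h (t : R) (B : set M) : lipschitz_curve a b h ->
  a <= t <= b -> nbhs (h t) B ->
  exists2 e : R, 0 < e & forall s, a <= s <= b -> `|s - t| < e -> B (h s).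
Proof.
move=> lh tab nB; have [c ac ct] := atlas_cover (h t).
have [e e0 [K K0 [Hc HK]]] := lipschitz_curveP lh ac tab ct.
have /nbhs_ballP[r /= r0 Hr] := cinv_nbhs ct nB.
have K1 : 0 < K + 1 by rewrite ltr_wpDl.
exists (Num.min e (r / (K + 1))); first by rewrite lt_min e0 divr_gt0.
move=> s sab; rewrite lt_min => /andP[st]; rewrite ltr_pdivlMr // => str.
rewrite -(cmapK (Hc _ sab st)); apply: Hr; rewrite -ball_normE /= distrC.
rewrite (le_lt_trans (HK _ _ tab sab _ st))// ?subrr ?normr0//.
by rewrite (le_lt_trans _ str)// mulrC ler_wpM2l// lerDl.
Qed.

Lemma lipschitz_curve_closed (a b : R) h (r : R) (B : set M) : lipschitz_curve a b h ->
  closed B -> a < r <= b -> (forall s, a <= s < r -> B (h s)) -> B (h r).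
Proof.
move=> lh cB /andP[ar rb] before; apply: cB => N nN.
have [|e e0 He] := curve_near lh _ nN; first by rewrite ltW.
have sr : Num.max a (r - e / 2) < r by rewrite gt_max ar ltrBlDr ltrDl divr_gt0.
have as_ : a <= Num.max a (r - e / 2) by rewrite le_max lexx.
exists (h (Num.max a (r - e / 2))); split; first by apply: before; rewrite as_.
apply: He; first by rewrite as_ (le_trans (ltW sr)).
rewrite ltr0_norm ?subr_lt0// opprB ltrBlDl -ltrBlDr (@lt_le_trans _ _ (r - e / 2))//; first lra.
by rewrite le_max lexx orbT.
Qed.

Lemma ae_neq (u : R) : {ae lebesgue_measure, forall t : R, t != u}.
Proof.
exists [set u]; split => //; first exact: lebesgue_measure_set1.
by move=> t /= /negP; rewrite negbK => /eqP.
Qed.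

Lemma ae_sq_speed_ge0 (a b : R) h : lipschitz_curve a b h -> horizontal a b h ->
  {ae lebesgue_measure, forall t : R, a <= t <= b -> 0 <= sq_speed h t}.
Proof.
move=> lh hh; have F := ae_filter_ringOfSetsType (@lebesgue_measure R).
have := @filterI _ _ F _ _ hh (@filterI _ _ F _ _ (ae_neq a) (ae_neq b)).
apply: (@filterS _ _ F) => t [Ht [ta tb]] tab.
have [c ac ct] := atlas_cover (h t); have [dx dv] := Ht tab c ac ct.
have [e e0 [K K0 [Hc _]]] := lipschitz_curveP lh ac tab ct.
have near_c : \forall s \near t, cdom c (h s).
  have tab' : t \in `]a, b[ by rewrite in_itv/= !lt_neqAle eq_sym ta tb.
  have near_e : \forall s \near t, `|s - t| < e.
    by have := nbhsx_ballx t _ e0; apply: filterS => s; rewrite -ball_normE /= distrC.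
  apply: filterS2 (near_in_itvoo tab') near_e => s; rewrite in_itv/= => /andP[s1 s2]; apply: Hc.
  by rewrite !ltW.
have -> : sq_speed h t = metric c (h t) (velocity c h t) (velocity c h t).
  by apply: sq_speedE => //; rewrite /velocity derive1E; exact: derivableP.
exact: metric_ge0.
Qed.

End chart_theory.

(** * Normal extremals are geodesics *)

Section partial_derivatives.
Context {R : realType} {E E' V : normedModType R}.
Variables (F : E -> E' -> V) (x : E) (z : E').
Hypothesis dF : differentiable (fun q => F q.1 q.2) (x, z).

Lemma is_diff_partial_l : is_diff x (F^~ z) (fun v => 'd (fun q => F q.1 q.2) (x, z) (v, 0)).
Proof.
have dpair : is_diff x (fun x => (x, z)) (fun v => (v, 0 : E')) by exact: is_diff_pair.
have := is_diff_comp dpair (differentiableP dF); exact.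
Qed.

Lemma is_diff_partial_r : is_diff z (F x) (fun w => 'd (fun q => F q.1 q.2) (x, z) (0, w)).
Proof.
have dpair : is_diff z (fun z => (x, z)) (fun w => (0 : E, w)) by exact: is_diff_pair.
have := is_diff_comp dpair (differentiableP dF); exact.
Qed.

Lemma diff_partials v w :
  'd (fun q => F q.1 q.2) (x, z) (v, w) = 'd (F^~ z) x v + 'd (F x) z w.
Proof.
have [[_ ->] [_ ->]] := (is_diff_partial_l, is_diff_partial_r).
by rewrite -linearD; congr ('d _ _ _); congr pair; rewrite ?addr0 ?add0r.
Qed.

End partial_derivatives.

Section hamiltonian_curves.
Context {R : realType} {d : nat}.
Implicit Types (H : 'rV[R]_d -> 'rV[R]_d -> R) (y p : R -> 'rV[R]_d).

Lemma is_derive_pair (V W : normedModType R) (f : R -> V) (g : R -> W) (t : R) df dg :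
  is_derive t 1 f df -> is_derive t 1 g dg -> is_derive t 1 (fun s => (f s, g s)) (df, dg).
Proof.
move=> [/derivable1_diffP dft <-] [/derivable1_diffP dgt <-].
have [dfg efg] := is_diff_pair (differentiableP dft) (differentiableP dgt).
by split; [exact/derivable1_diffP|rewrite !deriveE// efg].
Qed.

Lemma norm_grad_le (f : 'rV[R]_d -> R) x (C : R) : differentiable f x ->
  0 <= C -> (forall v, `|'d f x v| <= C * `|v|) -> `|grad f x| <= C.
Proof.
move=> df C0 bound; apply: mx_norm_le => // i l; rewrite mxE deriveE//.
rewrite (le_trans (bound _))// ler_piMr//; apply: mx_norm_le => // j k.
by rewrite mxE; case: (_ && _); rewrite ?normr1 ?normr0.
Qed.

Lemma diff_uncurried H x q v w : differentiable (fun z => H z.1 z.2) (x, q) ->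
  'd (fun z => H z.1 z.2) (x, q) (v, w) = dot (grad (H^~ q) x) v + dot (grad (H x) q) w.
Proof.
move=> dH; rewrite diff_partials//.
by congr (_ + _); apply: diff_grad; [have [] :=
  is_diff_partial_l dH|have [] := is_diff_partial_r dH].
Qed.

Definition hamiltonian_curve H y p := forall t : R, 0 <= t <= 1 ->
  is_derive t 1 y (grad (H (y t)) (p t)) /\ is_derive t 1 p (- grad (H^~ (p t)) (y t)).

Lemma hamiltonian_conserved H y p : hamiltonian_curve H y p ->
  (forall t : R, 0 <= t <= 1 -> differentiable (fun z => H z.1 z.2) (y t, p t)) ->
  forall t : R, 0 <= t <= 1 -> H (y t) (p t) = H (y 0) (p 0).
Proof.
move=> sol dH t; apply: (derive0_constant (b := 1) (f := fun t => H (y t) (p t))) => r r01.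
have [[dy dp] dHr] := (sol r r01, dH r r01).
apply: is_derive_eq (is_derive_comp_diff dHr (is_derive_pair dy dp)) _.
by rewrite (diff_uncurried _ _ dHr) dotNr dotC addrN.
Qed.

End hamiltonian_curves.

Section sub_riemannian_hamiltonian.
Context {R : realType} {d : nat} {M : contact_subriemannian_manifold R d}.
Variables (c : chart R d M).
Implicit Types (H : 'rV[R]_d -> 'rV[R]_d -> R) (A : set 'rV[R]_d).

Record sr_hamiltonian H A : Prop := MkSrHamiltonian {
  srH_img : A `<=` cimg c;
  srH_C11 : forall r : R, C11 (A `*` [set p | `|p| <= r]) (fun z => H z.1 z.2);
  srH_distr : forall y p, A y -> distr c (cinv c y) (grad (H y) p);
  srH_metric : forall y p, A y ->
    metric c (cinv c y) (grad (H y) p) (grad (H y) p) = 2 * H y p;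
  srH_dot : forall y p, A y -> dot p (grad (H y) p) = 2 * H y p;
  srH_fenchel : forall y v p, A y -> distr c (cinv c y) v ->
    dot p v <= 2^-1 * metric c (cinv c y) v v + H y p
}.

(* Fenchel's inequality at [x] for the covector [p + 2 psi (x - y)], with the Hamiltonian
   expanded at [(y, p)]. *)
Lemma fenchel_taylor H A (m r : R) : 0 <= m -> 0 <= r -> sr_hamiltonian H A ->
  (forall x y, A x -> A y -> `|x - y| <= r) ->
  forall P : R, 0 <= P -> exists2 C, 0 <= C & forall y x p v psi, A y -> A x -> `|p| <= P ->
    0 <= psi <= m -> distr c (cinv c x) v ->
    dot p v + 2 * psi * dot (x - y) v <=
      2^-1 * metric c (cinv c x) v v + H y p + dot (grad (H^~ p) y) (x - y) +
      2 * psi * dot (x - y) (grad (H y) p) + C * dot (x - y) (x - y).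
Proof.
move=> m0 r0 srH Ar P P0; pose Q := P + 2 * m * r.
have Q0 : 0 <= Q by rewrite !(addr_ge0, mulr_ge0).
have [C C0 HC] := srH_C11 srH Q.
have m1 : 0 <= 1 + 2 * m by rewrite addr_ge0// mulr_ge0.
exists (C * (1 + 2 * m) ^+ 2) => [|y x p v psi Ay Ax pP /andP[psi0 psim] dv].
  by rewrite mulr_ge0// exprn_ge0.
set w := x - y; pose q := p + (2 * psi) *: w.
have wq : `|(2 * psi) *: w| <= 2 * m * `|w|.
  by rewrite normrZ ger0_norm ?mulr_ge0// ler_wpM2r// ler_wpM2l.
have inA : (A `*` [set p | `|p| <= Q]) (y, p) by split=> //=;
  rewrite (le_trans pP)// lerDl !mulr_ge0.
have inA' : (A `*` [set p | `|p| <= Q]) (x, q).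
  split=> //=; rewrite (le_trans (ler_normD _ _))// lerD// (le_trans wq)// ler_wpM2l ?mulr_ge0//.
  exact: Ar.
have dH := C11_differentiable HC inA.
have step : (x, q) - (y, p) = (w, (2 * psi) *: w) by congr pair; rewrite /q addrAC subrr add0r.
have := C11_taylor HC inA inA'; rewrite step (diff_uncurried _ _ dH).
move=> /(le_trans (ler_norm _)) taylor.
have quad : C * `|(w, (2 * psi) *: w)| ^+ 2 <= C * (1 + 2 * m) ^+ 2 * dot w w.
  rewrite -mulrA ler_wpM2l// (@le_trans _ _ ((1 + 2 * m) ^+ 2 * `|w| ^+ 2))//.
    rewrite -exprMn ler_sqr ?nnegrE ?mulr_ge0// prod_normE/= ge_max; apply/andP; split.
      by rewrite ler_peMl// lerDl mulr_ge0.
    by rewrite (le_trans wq)// ler_wpM2r// lerDr.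
  by rewrite ler_wpM2l ?exprn_ge0// sqr_norm_le_dot.
have := srH_fenchel srH q Ax dv; rewrite {1}/q dotDl dotZl.
move: taylor quad; rewrite dotZr (dotC (grad (H y) p) w); lra.
Qed.

End sub_riemannian_hamiltonian.

Section normal_extremals.
Context {R : realType} {d : nat} {M : contact_subriemannian_manifold R d}.
Variables (c : chart R d M) (c_atlas : atlas c) (H : 'rV[R]_d -> 'rV[R]_d -> R).
Variables (y0 : 'rV[R]_d) (rho : R) (rho_gt0 : 0 < rho).
Hypothesis srH : sr_hamiltonian c H (cube y0 rho).
Variables (y p : R -> 'rV[R]_d).
Hypothesis sol : hamiltonian_curve H y p.
Hypothesis y_near : forall t : R, 0 <= t <= 1 -> `|y t - y0| < rho / 2.

Local Notation vel t := (grad (H (y t)) (p t)).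
Local Notation g := (cinv c \o y).
Let H0 := H (y 0) (p 0).

Let half_rho : rho / 2 < rho.
Proof. by rewrite gtr_pMr // invf_lt1// ltr1n. Qed.

Lemma extremal_in_cube (t : R) : 0 <= t <= 1 -> cube y0 rho (y t).
Proof. by move=> /y_near yt; rewrite /cube/= ltW// (lt_trans yt). Qed.

Lemma extremal_dom (t : R) : 0 <= t <= 1 -> cdom c (g t) /\ cmap c (g t) = y t.
Proof. by move=> /extremal_in_cube/(srH_img srH)/cimgP. Qed.

Lemma extremal_near_cube (t : R) : 0 <= t <= 1 -> \forall s \near t, cube y0 rho (y s).
Proof.
move=> t01; have [dy _] := sol t01.
have e0 : 0 < rho - `|y t - y0| by rewrite subr_gt0 (lt_trans (y_near t01)).
move/cvgrPdist_lt: (is_derive_continuous dy) => /(_ _ e0); apply: filterS => s ys.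
rewrite /cube/= -[X in `|X|](subrKA (y t)) (le_trans (ler_normD _ _))// -lerBrDr.
by rewrite distrC ltW.
Qed.

Lemma extremal_near_dom (t : R) : 0 <= t <= 1 -> \forall s \near t, cdom c (g s).
Proof. by move=> /extremal_near_cube; apply: filterS => s /(srH_img srH)/cimgP[]. Qed.

Lemma extremal_is_derive (t : R) : 0 <= t <= 1 -> is_derive t 1 (cmap c \o g) (vel t).
Proof.
move=> t01; have [dy _] := sol t01; apply: (@near_eq_is_derive _ _ _ y) => //.
by apply: filterS (extremal_near_cube t01) => s /(srH_img srH)/cimgP[].
Qed.

Lemma extremal_distr (t : R) : 0 <= t <= 1 -> distr c (g t) (vel t).
Proof. by move=> t01; apply: (srH_distr srH); exact: extremal_in_cube. Qed.

Lemma extremal_bounded : exists2 P, 0 <= P & forall t : R, 0 <= t <= 1 -> `|p t| <= P.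
Proof.
apply: segment_bounded => t /[!in_itv]/= t01.
by have [_ dp] := sol t01; exact: is_derive_continuous dp.
Qed.

Lemma extremal_differentiable (t : R) : 0 <= t <= 1 ->
  differentiable (fun z => H z.1 z.2) (y t, p t).
Proof.
move=> t01; have [C C0 HC] := srH_C11 srH `|p t|.
by apply: (C11_differentiable HC); split=> /=; [exact: extremal_in_cube|].
Qed.

Lemma extremal_lipschitz : [lipschitz y t | t in `[0, 1]] /\ [lipschitz p t | t in `[0, 1]].
Proof.
have [P P0 HP] := extremal_bounded; have [C C0 HC] := srH_C11 srH P.
have in_dom (t : R) : 0 <= t <= 1 -> (cube y0 rho `*` [set p | `|p| <= P]) (y t, p t).
  by move=> t01; split; [exact: extremal_in_cube|exact: HP].
have bound_diff (t : R) v : 0 <= t <= 1 -> `|'d (fun z => H z.1 z.2) (y t, p t) v| <= C * `|v|.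
  by move=> t01; apply: C11_diff_bounded HC _ _ _; exact: in_dom.
split; apply/lipschitzP; exists C => //.
  apply: (@klipschitz_derive_mx _ _ _ _ _ _ _ (fun t => vel t)) => t t01;
    first by have [] := sol t01.
  have [dH dE] := is_diff_partial_r (extremal_differentiable t01).
  apply: norm_grad_le => // v; rewrite dE (le_trans (bound_diff _ _ t01))//.
  by rewrite prod_normE/= normr0 (max_idPr _).
apply: (@klipschitz_derive_mx _ _ _ _ _ _ _ (fun t => - grad (H^~ (p t)) (y t))) => t t01.
  by have [] := sol t01.
have [dH dE] := is_diff_partial_l (extremal_differentiable t01).
rewrite normrN; apply: norm_grad_le => // v; rewrite dE (le_trans (bound_diff _ _ t01))//.
by rewrite prod_normE/= normr0 (max_idPl _).
Qed.

Lemma extremal_energy_density (t : R) : 0 <= t <= 1 -> H (y t) (p t) = H0.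
Proof. by move=> t01; exact: hamiltonian_conserved extremal_differentiable _ t01. Qed.

Lemma extremal_sq_speed (t : R) : 0 <= t <= 1 -> sq_speed g t = 2 * H0.
Proof.
move=> t01; rewrite -(extremal_energy_density t01).
rewrite (sq_speedE c_atlas (extremal_near_dom t01) (extremal_is_derive t01) (extremal_distr t01)).
by rewrite (srH_metric srH)//; exact: extremal_in_cube.
Qed.

Lemma extremal_energy_ge0 : 0 <= H0.
Proof.
have t01 : 0 <= (0 : R) <= 1 by rewrite lexx ler01.
have := metric_ge0 c_atlas (extremal_dom t01).1 (extremal_distr t01).
by rewrite (srH_metric srH) ?pmulr_rge0//; exact: extremal_in_cube.
Qed.

Lemma extremal_lipschitz_curve : lipschitz_curve 0 1 g.
Proof.
move=> c' t ac' t01 c't; have [ct yt] := extremal_dom t01.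
have [r r0 [C C0 HC]] := transition_lipschitz c_atlas ac' ct c't; rewrite yt in HC.
have [/lipschitzP[L L0 /klipschitzP HL] _] := extremal_lipschitz.
have [dy _] := sol t01; have cy := is_derive_continuous dy.
have nbhs_yt : nbhs (y t) (cube (y t) r `&` cinv c @^-1` cdom c').
  apply: filterI; first exact: nbhs_cube.
  by rewrite -yt; apply: cinv_nbhs ct _; apply: open_nbhs_nbhs; split; first exact: cdom_open.
exists (y @^-1` (cube (y t) r `&` cinv c @^-1` cdom c')).
split; [exact: cy nbhs_yt|by move=> s []|].
apply/lipschitzP; exists (C * L); first exact: mulr_ge0.
apply/klipschitzP => s s' [[/= ys _] s01] [[/= ys' _] s'01].
by rewrite -mulrA (le_trans (C11_lipschitz HC ys' ys))// ler_wpM2l//; exact: HL.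
Qed.

Lemma extremal_horizontal : horizontal 0 1 g.
Proof.
apply: aeW => t t01 c' ac' c't.
have [dv velE] := chart_velocity c_atlas ac' (extremal_near_dom t01) c't (extremal_is_derive t01).
split => //; rewrite /velocity derive1E velE.
exact: (distr_change_coord _ c_atlas ac' (extremal_dom t01).1 c't).1 (extremal_distr t01).
Qed.

Lemma extremal_energy (s t : R) : 0 <= s -> s < t -> t <= 1 ->
  energy s t g = (H0 * (t - s))%:E.
Proof.
move=> s0 st t1; rewrite /energy (eq_integral (fun=> (2 * H0)%:E)); last first.
  move=> x; rewrite inE /= in_itv/= => /andP[x1 x2]; rewrite extremal_sq_speed//.
  by rewrite (le_trans s0 x1) (le_trans x2 t1).
rewrite (@integral_cst _ _ _ (@lebesgue_measure R) _ (measurable_itv `[s, t])).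
have length_st : lebesgue_measure `[s, t]%classic = (t - s)%:E :> \bar R.
  by rewrite lebesgue_measure_itv/= lte_fin st EFinB.
transitivity (2^-1%:E * ((2 * H0)%:E * (t - s)%:E))%E;
  first by congr (_ * (_ * _))%E; exact: length_st.
by rewrite -!EFinM; congr EFin; field.
Qed.

Section competitor.
Variables (s t : R) (h : R -> M).
Hypotheses (s_ge0 : 0 <= s) (st : s < t) (t_le1 : t <= 1).
Hypotheses (h_lip : lipschitz_curve s t h) (hs : h s = g s).
Local Notation w r := (cmap c (h r) - y r).

Let itv01 (r : R) : s <= r <= t -> 0 <= r <= 1.
Proof. by move=> /andP[sr rt]; rewrite (le_trans s_ge0 sr) (le_trans rt t_le1). Qed.

Lemma deviation_near (r : R) : s <= r <= t -> cdom c (h r) -> forall e, 0 < e ->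
  exists2 delta, 0 < delta & forall r', s <= r' <= t -> `|r' - r| < delta ->
    cdom c (h r') /\ `|w r' - w r| <= e.
Proof.
move=> rst cr e e0; have [d1 d10 [K K0 [Hc HK]]] := lipschitz_curveP h_lip c_atlas rst cr.
have [/lipschitzP[L L0 /klipschitzP HL] _] := extremal_lipschitz.
have KL0 : 0 < K + L + 1 by rewrite ltr_wpDl// addr_ge0.
exists (Num.min d1 (e / (K + L + 1))); first by rewrite lt_min d10 divr_gt0.
move=> r' r'st; rewrite lt_min => /andP[rr']; rewrite ltr_pdivlMr// => rr'e.
split; first exact: Hc.
rewrite opprB [y r - _]addrC addrACA [- _ + y r]addrC
  (le_trans (ler_normD _ _))// (le_trans _ (ltW rr'e))//.
rewrite mulrC !mulrDl mul1r; apply: ler_wpDr => //; apply: lerD.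
  by apply: HK => //; rewrite subrr normr0.
by rewrite distrC; apply: HL; apply: itv01.
Qed.

Lemma cinv_cube_closed : closed (cinv c @` cube y0 rho).
Proof.
apply: compact_closed; first exact: manifold_hausdorff.
apply: continuous_compact; last exact: cube_compact.
by apply: continuous_in_subspaceT => x /[!inE] /(srH_img srH); exact: cinv_continuous.
Qed.

Lemma tube_in_cube (r : R) : s <= r <= t -> `|w r| <= rho / 2 -> cube y0 rho (cmap c (h r)).
Proof.
move=> rst wr; rewrite /cube/= -(subrKA (y r)) (le_trans (ler_normD _ _))// (splitr rho) lerD//.
by rewrite ltW// y_near// itv01.
Qed.

Lemma exit_time : exists T, [/\ s < T <= t,
  forall r, s <= r <= T -> cdom c (h r) /\ `|w r| <= rho / 2 & T = t \/ `|w T| = rho / 2].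
Proof.
pose P r := cdom c (h r) /\ `|w r| < rho / 2.
have [||PP|[T /andP[sT Tt] [nPT before]]] := @first_failure _ P s t.
- have [ds ys] := extremal_dom (itv01 (introT andP (conj (lexx s) (ltW st)))).
  by rewrite /P hs ys subrr normr0 divr_gt0.
- move=> r /andP[sr rt] /(_ r); rewrite sr lexx => -[//|cr wr].
  have rst : s <= r <= t by rewrite sr ltW.
  have e0 : 0 < (rho / 2 - `|w r|) / 2 by rewrite divr_gt0// subr_gt0.
  have [delta d0 near_r] := deviation_near rst cr e0.
  exists (r + delta / 2) => [|r' /andP[rr' r'd] r't]; first by rewrite ltrDl divr_gt0.
  have [||cr' dev] := near_r r'; first by rewrite r't (le_trans sr (ltW rr')).
    by rewrite ger0_norm ?subr_ge0 ?(ltW rr')//; lra.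
  split => //; have := ler_normD (w r) (w r' - w r); rewrite addrC subrK; lra.
- exists t; split => [|r /PP[cr /ltW]|]; [by rewrite st lexx|by []|by left].
have inT : s <= T <= t by rewrite ltW.
have [x /(srH_img srH)/cimgP[cx _] xT] : (cinv c @` cube y0 rho) (h T).
  apply: (lipschitz_curve_closed h_lip cinv_cube_closed); first by rewrite sT.
  move=> r /[dup] /before[cr wr] /andP[sr rT]; exists (cmap c (h r)); last exact: cmapK.
  by apply: tube_in_cube (ltW wr); rewrite sr (le_trans (ltW rT)).
have cT : cdom c (h T) by rewrite -xT.
have wT : `|w T| <= rho / 2.
  apply/ler_addgt0Pr => e e0; have [delta d0 near_T] := deviation_near inT cT e0.
  pose r := Num.max s (T - delta / 2).
  have rT : r < T by rewrite gt_max sT ltrBlDr ltrDl divr_gt0.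
  have sr : s <= r by rewrite le_max lexx.
  have Tr : T - delta / 2 <= r by rewrite le_max lexx orbT.
  have [||_ dev] := near_T r; first by rewrite sr (le_trans (ltW rT)).
    by rewrite ltr0_norm ?subr_lt0//; lra.
  have [_ wr] := before r (introT andP (conj sr rT)).
  have := ler_normB (w r) (w r - w T); rewrite opprB addrC subrK; lra.
exists T; split; first by rewrite sT.
  move=> r /andP[sr]; rewrite le_eqVlt => /predU1P[->//|rT].
  by have [|cr /ltW] := before r; rewrite ?sr.
by right; apply/le_anti; rewrite wT leNgt; apply/negP => wT'; exact: nPT.
Qed.

Section verification.
Variable T : R.
Hypotheses (sT : s < T) (Tt : T <= t).
Hypothesis in_tube : forall r, s <= r <= T -> cdom c (h r) /\ `|w r| <= rho / 2.
Variables (m C : R).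
Hypotheses (m_ge1 : 1 <= m) (C_ge0 : 0 <= C) (C_small : C * (t - s) <= 1).

Local Notation psi r := (m - C * (r - s)).

(* A subsolution of the Hamilton-Jacobi equation along every competitor, as soon as [psi]
   decreases fast enough; taking [m] large, it also beats the competitors that leave the tube. *)
Definition verification (r : R) : R :=
  2 * (dot (p r) (w r) + psi r * dot (w r) (w r) + H0 * (r - s)).

Let itvT (r : R) : s <= r <= T -> s <= r <= t.
Proof. by move=> /andP[-> /le_trans->]. Qed.

Lemma penalty_itv (r : R) : s <= r <= T -> m - 1 <= psi r <= m.
Proof.
move=> /andP[sr rT]; rewrite lerD2l lerN2 gerBl mulr_ge0 ?subr_ge0// andbT.
by rewrite (le_trans _ C_small)// ler_wpM2l// lerD2r (le_trans rT).
Qed.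

Lemma verification_derive (r : R) :
  (forall x v a, cube y0 rho x -> 0 <= a <= m -> distr c (cinv c x) v ->
    dot (p r) v + 2 * a * dot (x - y r) v <=
      2^-1 * metric c (cinv c x) v v + H (y r) (p r) + dot (grad (H^~ (p r)) (y r)) (x - y r) +
      2 * a * dot (x - y r) (vel r) + C * dot (x - y r) (x - y r)) ->
  s < r < T -> derivable (cmap c \o h) r 1 -> distr c (h r) (velocity c h r) ->
  exists2 l, is_derive r 1 verification l & l <= sq_speed h r.
Proof.
move=> fenchel /andP[sr rT] dx dv; have rsT : s <= r <= T by rewrite !ltW.
have r01 := itv01 (itvT rsT); have [cr wr] := in_tube rsT.
have near_dom : \forall r' \near r, cdom c (h r').
  have r_in : r \in `]s, T[ by rewrite in_itv/= sr.
  apply: filterS (near_in_itvoo r_in) => r'; rewrite in_itv/= => /andP[sr' r'T].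
  by apply: (proj1 (in_tube _)); rewrite !ltW.
set v := velocity c h r in dv.
have dxv : is_derive r 1 (cmap c \o h) v by rewrite /v /velocity derive1E; exact: derivableP.
have [dy dp] := sol r01.
have dw : is_derive r 1 (fun r => w r) (v - vel r) by exact: is_deriveB.
have dlin (k : R) : is_derive r 1 (fun r => k * (r - s)) k.
  apply: is_derive_eq (is_derive_mul (is_derive_cst k r 1)
    (is_deriveB (is_derive_id r 1) (is_derive_cst s r 1))) _.
  by rewrite mul0r add0r subr0 mulr1.
have dpsi : is_derive r 1 (fun r => psi r) (- C).
  by apply: is_derive_eq (is_deriveB (is_derive_cst m r 1) (dlin C)) _; rewrite sub0r.
have dver := is_derive_mul (is_derive_cst (2 : R) r 1) (is_deriveD
  (is_deriveD (is_derive_dot dp dw) (is_derive_mul dpsi (is_derive_dot dw dw))) (dlin H0)).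
eexists; first exact: dver.
have hr : h r = cinv c (cmap c (h r)) by rewrite cmapK.
have /andP[psi1 psim] := penalty_itv rsT.
have psi0 : 0 <= psi r <= m by rewrite psim andbT (le_trans _ psi1)// subr_ge0.
have dv' : distr c (cinv c (cmap c (h r))) v by rewrite -hr.
have := fenchel _ _ _ (tube_in_cube (itvT rsT) wr) psi0 dv'.
have := srH_dot srH (p r) (extremal_in_cube r01).
rewrite -hr (extremal_energy_density r01) (sq_speedE c_atlas near_dom dxv dv).
rewrite (dotC (v - _)) dotNl !dotBr.
set a := psi r; lra.
Qed.

Lemma verification_lipschitz : [lipschitz verification r | r in `[s, T]].
Proof.
have [y_lip p_lip] := extremal_lipschitz.
have sub01 : `[s, T] `<=` `[0, 1].
  by move=> r; rewrite /= !in_itv/= => /itvT/itv01.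
have x_lip : [lipschitz cmap c (h r) | r in `[s, T]].
  apply: locally_lipschitz_segment => r rsT.
  have [V [nV _ V_lip]] := h_lip c_atlas (itvT rsT) (in_tube rsT).1.
  exists V => //; apply: lipschitz_subset V_lip; apply: setIS => r' /=.
  by rewrite !in_itv/= => /itvT.
have w_lip : [lipschitz w r | r in `[s, T]].
  by apply: lipschitzB x_lip _; exact: lipschitz_subset sub01 y_lip.
have dot_lip (u u' : R -> 'rV[R]_d) : [lipschitz u r | r in `[s, T]] ->
    [lipschitz u' r | r in `[s, T]] -> [lipschitz dot (u r) (u' r) | r in `[s, T]].
  by apply: (@lipschitz_bilinear _ _ _ _ dot d%:R) => // ? ?; exact: norm_dot_le.
have mul_lip (f f' : R -> R) : [lipschitz f r | r in `[s, T]] ->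
    [lipschitz f' r | r in `[s, T]] -> [lipschitz f r * f' r | r in `[s, T]].
  by apply: (lipschitz_bilinear (op := *%R) (k := 1)) => // a b; rewrite normrM mul1r.
have shift_lip : [lipschitz (r - s) | r in `[s, T]].
  by apply: lipschitzB; [exact: lipschitz_in_id|exact: lipschitz_cst].
apply: (mul_lip); first exact: lipschitz_cst.
apply: lipschitzD; last by apply: (mul_lip) => //; exact: lipschitz_cst.
apply: lipschitzD; first by apply: (dot_lip) => //; exact: lipschitz_subset sub01 p_lip.
apply: (mul_lip); last exact: dot_lip.
by apply: lipschitzB; [exact: lipschitz_cst|apply: (mul_lip) => //; exact: lipschitz_cst].
Qed.

Lemma verification_start : verification s = 0.
Proof.
have [_ ys] := extremal_dom (itv01 (introT andP (conj (lexx s) (ltW st)))).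
by rewrite /verification hs ys !subrr !mulr0 !(dotC _ 0) !dot0l mulr0 !addr0 mulr0.
Qed.

Lemma verification_exit (P : R) : (forall r, 0 <= r <= 1 -> `|p r| <= P) ->
  d%:R * P * (rho / 2) + H0 <= (m - 1) * (rho / 2) ^+ 2 ->
  `|w T| = rho / 2 -> 2 * (H0 * (t - s)) <= verification T.
Proof.
move=> pP m_large wT; have sTT : s <= T <= T by rewrite lexx ltW.
have /andP[psi1 _] := penalty_itv sTT.
have linear_le : - (d%:R * P * (rho / 2)) <= dot (p T) (w T).
  rewrite lerNl (le_trans (ler_norm _))// normrN (le_trans (norm_dot_le _ _))// wT -mulrA.
  by rewrite ler_wpM2l// ler_wpM2r ?divr_ge0 ?(ltW rho_gt0)// pP// itv01// itvT.
have quadratic_ge : (m - 1) * (rho / 2) ^+ 2 <= psi T * dot (w T) (w T).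
  by rewrite ler_pM ?subr_ge0 ?exprn_ge0 ?divr_ge0 ?(ltW rho_gt0)// -wT sqr_norm_le_dot.
have H0T : 0 <= H0 * (T - s) by rewrite mulr_ge0 ?extremal_energy_ge0// subr_ge0 ltW.
have H0t : H0 * (t - s) <= H0.
  by rewrite ler_piMr ?extremal_energy_ge0//; move: s_ge0 t_le1; lra.
by rewrite /verification; lra.
Qed.

End verification.

End competitor.

Lemma extremal_local_minimizer : exists2 delta : R, 0 < delta & forall s t : R,
  0 <= s -> s < t -> t <= 1 -> t - s <= delta -> energy_minimizer s t g.
Proof.
have [P P0 HP] := extremal_bounded.
pose m := 1 + (d%:R * P * (rho / 2) + H0) / (rho / 2) ^+ 2.
have rho2 : 0 < rho / 2 by rewrite divr_gt0.
have m1 : 1 <= m.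
  by rewrite lerDl divr_ge0 ?sqr_ge0// addr_ge0 ?extremal_energy_ge0// !mulr_ge0// ltW.
have m_large : d%:R * P * (rho / 2) + H0 <= (m - 1) * (rho / 2) ^+ 2.
  by rewrite /m addrAC subrr add0r divfK// expf_neq0// gt_eqF.
have diam x z : cube y0 rho x -> cube y0 rho z -> `|x - z| <= rho + rho.
  by move=> xr zr; rewrite -(subrKA y0) (le_trans (ler_normD _ _))// (distrC y0) lerD.
have [C C0 HC] := fenchel_taylor (le_trans ler01 m1)
  (addr_ge0 (ltW rho_gt0) (ltW rho_gt0)) srH diam P0.
have C10 : 0 < C + 1 by rewrite ltr_wpDl.
exists (C + 1)^-1 => [|s t s0 st t1 ts h [lh hh] hs ht]; first by rewrite invr_gt0.
have [T [/andP[sT Tt] in_tube exitT]] := exit_time s0 st t1 lh hs.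
have C_small : C * (t - s) <= 1.
  rewrite -(@divff _ (C + 1)) ?gt_eqF//; apply: ler_pM => //; first by rewrite subr_ge0 ltW.
  by rewrite lerDl.
pose V := verification s h m C.
have V_le : {ae lebesgue_measure, forall r : R, s < r < T ->
    derivable V r 1 /\ derive1 V r <= sq_speed h r}.
  apply: (@filterS _ _ (ae_filter_ringOfSetsType _) _ _ _ hh) => r Hr rsT; have /andP[sr rT] := rsT.
  have rst : s <= r <= t by rewrite ltW//= (le_trans (ltW rT)).
  have [|dx dv] := Hr rst c c_atlas; first by apply: (proj1 (in_tube r _)); rewrite !ltW.
  have r01 : 0 <= r <= 1 by case/andP: rst => sr' rt; rewrite (le_trans s0) ?(le_trans rt).
  have [|l dV lV] := verification_derive s0 t1 Tt in_tube m1 C0 C_small _ rsT dx dv.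
    by move=> x v a xr; exact: HC (extremal_in_cube r01) xr (HP r r01).
  by split; [case: dV|rewrite derive1E (derive_val (is_derive := dV))].
have V_end : 2 * (H0 * (t - s)) <= V T.
  have [TE|wT] := exitT; last exact: verification_exit HP m_large wT.
  have [_ yt] := extremal_dom (introT andP (conj (le_trans s0 (ltW st)) t1)).
  by rewrite /V /verification TE ht yt subrr !(dotC _ 0) !dot0l mulr0 !add0r.
have [K K0 HK] := (lipschitzP _ _).1 (verification_lipschitz s0 t1 lh Tt in_tube m C).
have := klipschitz_ftc_le sT Tt HK V_le (ae_sq_speed_ge0 lh hh).
rewrite (verification_start s0 st t1 hs) subr0 => V_int; rewrite extremal_energy// /energy.
have -> : (H0 * (t - s))%:E = (2^-1%:E * (2 * (H0 * (t - s)))%:E)%E.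
  by rewrite -EFinM; congr EFin; field.
by rewrite lee_wpmul2l ?lee_fin// (le_trans _ V_int)// lee_fin.
Qed.

Theorem normal_geodesic : y 1 != y 0 -> geodesic g.
Proof.
move=> y10; split.
- by split; [exact: extremal_lipschitz_curve|exact: extremal_horizontal].
- exists 1; first by rewrite lexx ler01.
  move=> /(congr1 (cmap c)); have [_ ->] := @extremal_dom 1 (introT andP (conj ler01 (lexx _))).
  have [_ ->] := @extremal_dom 0 (introT andP (conj (lexx _) ler01)).
  exact/eqP.
have [delta d0 Hd] := extremal_local_minimizer.
move=> t t01; exists (delta / 2); first by rewrite divr_gt0.
by move=> a b a0 ab b1 /ltr_distlCDr at_ /ltr_distlDr bt; apply: Hd => //; lra.
Qed.

End normal_extremals.

(** * Fixpoints and uniformly Lipschitz families *)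

Section product_complete.
Context {R : realType} {U V : completeNormedModType R}.

HB.instance Definition _ := Pointed.copy (U * V)%type (U * V)%type.

Lemma prod_cauchy_cvg (F : set_system (U * V)%type) : ProperFilter F -> cauchy F -> cvg F.
Proof.
move=> FF /cauchyP cF.
have cvg1 : cvg (fst @ F).
  apply/cauchy_cvgP/cauchy_exP => e e0; have [z Fz] := cF e e0; exists z.1.
  have : F (fst @^-1` ball z.1 e) by apply: filterS Fz => w [].
  by [].
have cvg2 : cvg (snd @ F).
  apply/cauchy_cvgP/cauchy_exP => e e0; have [z Fz] := cF e e0; exists z.2.
  have : F (snd @^-1` ball z.2 e) by apply: filterS Fz => w [].
  by [].
apply/cvg_ex; exists (lim (fst @ F), lim (snd @ F)).
have -> : F = (fun z => (z.1, z.2)) @ F.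
  by rewrite (_ : (fun z => _) = id)//; apply: funext => -[].
exact: cvg_pair.
Qed.

HB.instance Definition _ := Uniform_isComplete.Build (U * V)%type prod_cauchy_cvg.

End product_complete.

HB.instance Definition _ (R : realType) m n := Pointed.copy 'M[R]_(m, n) 'M[R]_(m, n).

Section fixpoint.
Context {R : realType} {T : Type} {V : completeNormedModType R}.
Implicit Types (f g : T -> V) (E : set (T -> V)).

Lemma geometric_small (c k : R) : 0 <= k -> k < 1 -> forall e : R, 0 < e ->
  exists N, forall m, (N <= m)%N -> c * k ^+ m <= e.
Proof.
move=> k0 k1 e e0; have := @cvg_geometric R c k.
rewrite ger0_norm// => /(_ k1)/cvgrPdist_lt/(_ e e0)[N _ HN]; exists N => m Nm.
by have := HN m Nm; rewrite sub0r normrN => /ltW; apply: le_trans; exact: ler_norm.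
Qed.

Lemma geometric_cvg (u : nat -> V) (c k : R) : 0 <= k -> k < 1 ->
  (forall m, `|u m.+1 - u m| <= c * k ^+ m) ->
  exists l, forall m, `|u m - l| <= c * k ^+ m / (1 - k).
Proof.
move=> k0 k1 step; have k1' : 0 < 1 - k by rewrite subr_gt0.
have c0 : 0 <= c by have := le_trans (normr_ge0 _) (step 0%N); rewrite expr0 mulr1.
have tail m j : `|u (m + j)%N - u m| <= c * k ^+ m * (1 - k ^+ j) / (1 - k).
  elim: j => [|j IH]; first by rewrite addn0 !subrr normr0 mulr0 mul0r.
  rewrite addnS -(subrKA (u (m + j)%N)) (le_trans (ler_normD _ _))//.
  apply: (le_trans (lerD (step _) IH)).
  rewrite exprD exprS le_eqVlt; apply/orP; left; apply/eqP; field.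
  by rewrite gt_eqF.
have dist m j : (m <= j)%N -> `|u j - u m| <= c * k ^+ m / (1 - k).
  move=> mj; rewrite -(subnKC mj) (le_trans (tail _ _))// ler_wpM2r ?invr_ge0 ?(ltW k1')//.
  by rewrite ler_piMr ?mulr_ge0 ?exprn_ge0// gerBl exprn_ge0.
have cvu : cvgn u.
  apply/cauchy_cvgP; apply: cauchy_exP => e e0.
  have e20 : 0 < e / 2 by rewrite divr_gt0.
  have [N HN] := geometric_small (c / (1 - k)) k0 k1 e20.
  exists (u N); exists N => // j Nj /=; rewrite -ball_normE /= distrC.
  rewrite (le_lt_trans (dist _ _ Nj))// mulrAC (le_lt_trans (HN _ (leqnn N)))//.
  by rewrite gtr_pMr// invf_lt1// ltr1n.
exists (limn u) => m; rewrite distrC.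
have cv : `|u j - u m| @[j --> \oo] --> `|limn u - u m|.
  by apply: cvg_norm; apply: cvgB => //; exact: cvg_cst.
rewrite -(cvg_lim _ cv)//; apply: limr_le; first by apply/cvg_ex; eexists; exact: cv.
by exists m => // j /= mj; exact: dist.
Qed.

Definition uniformly_closed E := forall (F : nat -> T -> V) f, (forall m, E (F m)) ->
  (forall e : R, 0 < e -> exists N, forall m t, (N <= m)%N -> `|F m t - f t| <= e) -> E f.

Lemma contraction_fixpoint E (Phi : (T -> V) -> T -> V) (k B : R) f0 : 0 <= k -> k < 1 ->
  E f0 -> (forall f, E f -> E (Phi f)) -> (forall f, E f -> forall t, `|f t| <= B) ->
  (forall f g delta, E f -> E g -> (forall t, `|f t - g t| <= delta) ->
    forall t, `|Phi f t - Phi g t| <= k * delta) ->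
  uniformly_closed E -> exists2 f, E f & Phi f = f.
Proof.
move=> k0 k1 E0 EPhi EB Phik Eclosed; pose F m := iter m Phi f0.
have EF m : E (F m) by elim: m => //= m; exact: EPhi.
have step m t : `|F m.+1 t - F m t| <= (2 * B) * k ^+ m.
  elim: m t => [|m IH] t; last by rewrite exprS mulrCA; exact: Phik (EF m.+1) (EF m) IH t.
  by rewrite expr0 mulr1 mulr_natl mulr2n (le_trans (ler_normB _ _))// lerD ?(EB (F _) (EF _)).
have /choice[f Hf] t := geometric_cvg k0 k1 (fun m => step m t).
have F_cvg e : 0 < e -> exists N, forall m t, (N <= m)%N -> `|F m t - f t| <= e.
  move=> e0; have [N HN] := geometric_small (2 * B / (1 - k)) k0 k1 e0.
  by exists N => m t Nm; rewrite (le_trans (Hf t m))// mulrAC HN.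
have Ef : E f by exact: Eclosed EF F_cvg.
exists f => //; apply: funext => t; apply/eqP; rewrite -subr_eq0 -normr_le0.
apply/ler_addgt0Pr => e e0; rewrite add0r.
have e20 : 0 < e / 2 by rewrite divr_gt0.
have [N HN] := F_cvg _ e20.
rewrite -(subrKA (F N.+1 t)) (le_trans (ler_normD _ _))// (splitr e) lerD ?HN//.
have fN s : `|f s - F N s| <= e / 2 by rewrite distrC HN.
by rewrite (le_trans (Phik _ _ _ Ef (EF N) fN t))// ler_piMl ?(ltW e20)// ltW.
Qed.

(* Two fixpoints of contractions that differ by at most [c]. *)
Lemma fixpoint_dist f g (k c B : R) : k < 1 -> (forall t, `|f t - g t| <= B) ->
  (forall delta, (forall t, `|f t - g t| <= delta) -> forall t, `|f t - g t| <= k * delta + c) ->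
  forall t, `|f t - g t| <= c / (1 - k).
Proof.
move=> k1 fgB improve t; have k1' : 0 < 1 - k by rewrite subr_gt0.
pose A := [set `|f t - g t| | t in setT].
have supA : has_sup A by split; [exists `|f t - g t|, t|exists B => _ [t' _ <-]].
have ub t' : `|f t' - g t'| <= sup A by apply: sup_upper_bound => //; exists t'.
have : sup A <= k * sup A + c.
  by apply: ge_sup; [exact: supA.1|move=> _ [t' _ <-]; exact: improve].
move=> supE; rewrite (le_trans (ub t))// ler_pdivlMr// mulrBr mulr1 mulrC; lra.
Qed.

End fixpoint.

Section primitive_mx.
Context {R : realType} {m n : nat}.
Implicit Types F : R -> 'M[R]_(m, n).

Lemma continuous_entry F (t : R) i j :
  {for t, continuous F} -> {for t, continuous (fun s => F s i j)}.
Proof. by move=> cF; apply: (@continuous_comp _ _ _ F (fun M : 'M[R]_(m, n) => M i j)) => //;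
  exact: coord_continuous. Qed.

Lemma continuous_mxP F (t : R) :
  (forall i j, {for t, continuous (fun s => F s i j)}) -> {for t, continuous F}.
Proof.
move=> cF; apply/cvgrPdist_le => e e0.
have near_e : \forall s \near t, forall ij : 'I_m * 'I_n, `|F t ij.1 ij.2 - F s ij.1 ij.2| <= e.
  apply: (@filter_forall _ _ (fun (ij : 'I_m * 'I_n) s => `|F t ij.1 ij.2 - F s ij.1 ij.2|
    <= e) (nbhs t)) => -[i j] /=.
  by have /cvgrPdist_le/(_ e e0) := cF i j.
apply: filterS near_e => s Hs; apply: mx_norm_le => [|i j]; first exact: ltW.
by rewrite !mxE; exact: (Hs (i, j)).
Qed.

Definition primitive_mx F (t : R) : 'M[R]_(m, n) :=
  \matrix_(i, j) primitive (fun s => F s i j) t.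

Lemma primitive_mx0 F : primitive_mx F 0 = 0.
Proof. by apply/matrixP => i j; rewrite !mxE primitive0. Qed.

Lemma is_derive_primitive_mx F (t : R) : {in `[0, 1], continuous F} -> 0 <= t <= 1 ->
  is_derive t 1 (primitive_mx F) (F t).
Proof.
move=> cF t01; apply/is_derive_mxP => i j.
rewrite (_ : (fun s => _) = primitive (fun s => F s i j)).
  by apply: is_derive_primitive => // s s01; apply: continuous_entry; exact: cF.
by apply: funext => s; rewrite mxE.
Qed.

Lemma primitive_mx_zero (t : R) : 0 <= t <= 1 ->
  primitive_mx (fun=> 0) t = 0.
Proof.
move=> t01; rewrite (derive0_constant_mx _ t01) ?primitive_mx0// => r r01.
by apply: is_derive_primitive_mx => // q _; exact: cst_continuous.
Qed.

End primitive_mx.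

Section uniformly_lipschitz_families.
Context {R : realType}.

(* [pclose th th' e] means that [th] and [th'] are at distance at most [e]. *)
Record parameter_space := ParameterSpace {
  parameter :> Type;
  pdom : set parameter;
  pclose : parameter -> parameter -> R -> Prop;
  pclose_ge0 : forall th th' e, pclose th th' e -> 0 <= e
}.

Variable Th : parameter_space.
Implicit Types (U V W : normedModType R) (th : Th).

Definition ulip V (phi : R -> Th -> V) :=
  (forall th, pdom th -> {in `[0, 1], continuous (phi ^~ th)}) /\
  exists2 C : R, 0 <= C & forall (t : R) th, 0 <= t <= 1 -> pdom th ->
    `|phi t th| <= C /\
    forall th' e, pdom th' -> pclose th th' e -> `|phi t th - phi t th'| <= C * e.

Lemma eq_ulip V (phi psi : R -> Th -> V) :
  (forall t th, pdom th -> phi t th = psi t th) -> ulip phi -> ulip psi.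
Proof.
move=> E [c [A A0 HA]]; split=> [th Dth|].
  by rewrite (_ : psi^~ th = phi^~ th); [exact: c|apply: funext => t; rewrite E].
exists A => // t th t01 Dth; have [bd lip] := HA t th t01 Dth; rewrite -E//; split => //.
by move=> th' e Dth' D; rewrite -E//; exact: lip.
Qed.

Lemma ulip_continuous V (phi : R -> Th -> V) th : ulip phi -> pdom th ->
  {in `[0, 1], continuous (phi ^~ th)}.
Proof. by move=> [c _]; exact: c. Qed.

Lemma ulip_bounded V (phi : R -> Th -> V) : ulip phi ->
  exists2 C : R, 0 <= C & forall (t : R) th, 0 <= t <= 1 -> pdom th -> `|phi t th| <= C.
Proof. by move=> [_ [C C0 HC]]; exists C => // t th t01 /(HC t th t01)[]. Qed.

Lemma ulip_lipschitz V (phi : R -> Th -> V) : ulip phi ->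
  exists2 C : R, 0 <= C & forall (t : R) th th' e, 0 <= t <= 1 -> pdom th -> pdom th' ->
    pclose th th' e -> `|phi t th - phi t th'| <= C * e.
Proof. by move=> [_ [C C0 HC]]; exists C => // t th th' e t01 /(HC t th t01)[_ +]; apply. Qed.

Lemma ulip_intro V (phi : R -> Th -> V) (B L : R) : 0 <= B -> 0 <= L ->
  (forall th, pdom th -> {in `[0, 1], continuous (phi ^~ th)}) ->
  (forall (t : R) th, 0 <= t <= 1 -> pdom th -> `|phi t th| <= B) ->
  (forall (t : R) th th' e, 0 <= t <= 1 -> pdom th -> pdom th' -> pclose th th' e ->
    `|phi t th - phi t th'| <= L * e) -> ulip phi.
Proof.
move=> B0 L0 c bd lip; split=> //; exists (B + L) => [|t th t01 Dth]; first exact: addr_ge0.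
split=> [|th' e Dth' th_th']; first by rewrite (le_trans (bd t th t01 Dth))// lerDl.
rewrite (le_trans (lip t th th' e t01 Dth Dth' th_th'))// ler_wpM2r ?lerDr//.
exact: pclose_ge0 th_th'.
Qed.

Lemma ulip_time_only V (g : R -> V) : {in `[0, 1], continuous g} -> ulip (fun t _ => g t).
Proof.
move=> cg; have [C C0 HC] := segment_bounded cg.
apply: (@ulip_intro _ _ C 0) => // [t th t01 _|t th th' e _ _ _ _]; first exact: HC.
by rewrite subrr normr0 mul0r.
Qed.

Lemma ulip_cst V (v : V) : ulip (fun _ _ => v).
Proof. by apply: ulip_time_only => t _; exact: cst_continuous. Qed.

Lemma ulipD V (phi psi : R -> Th -> V) : ulip phi -> ulip psi ->
  ulip (fun t th => phi t th + psi t th).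
Proof.
move=> Hphi Hpsi; have [A A0 HA] := ulip_bounded Hphi; have [B B0 HB] := ulip_bounded Hpsi.
have [K K0 HK] := ulip_lipschitz Hphi; have [L L0 HL] := ulip_lipschitz Hpsi.
apply: (@ulip_intro _ _ (A + B) (K + L)); rewrite ?addr_ge0//.
- move=> th Dth t t01; exact: continuousD (ulip_continuous Hphi Dth t01)
    (ulip_continuous Hpsi Dth t01).
- by move=> t th t01 Dth; rewrite (le_trans (ler_normD _ _))// lerD ?HA ?HB.
- move=> t th th' e t01 Dth Dth' D; rewrite opprD addrACA (le_trans (ler_normD _ _))// mulrDl.
  by rewrite lerD ?HK ?HL.
Qed.

Lemma ulip_op U V W (op : {bilinear U -> V -> W}) (k : R) (phi : R ->
  Th -> U) (psi : R -> Th -> V) :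
  0 <= k -> (forall u v, `|op u v| <= k * (`|u| * `|v|)) ->
  ulip phi -> ulip psi -> ulip (fun t th => op (phi t th) (psi t th)).
Proof.
move=> k0 opk Hphi Hpsi; have [A A0 HA] := ulip_bounded Hphi; have [B B0 HB] := ulip_bounded Hpsi.
have [K K0 HK] := ulip_lipschitz Hphi; have [L L0 HL] := ulip_lipschitz Hpsi.
have op_le u v (a b : R) : `|u| <= a -> `|v| <= b -> `|op u v| <= k * (a * b).
  by move=> ua vb; rewrite (le_trans (opk u v))// ler_wpM2l// ler_pM.
apply: (@ulip_intro _ _ (k * (A * B)) (k * (K * B + A * L)));
  rewrite ?mulr_ge0 ?addr_ge0 ?mulr_ge0//.
- move=> th Dth t t01.
  exact: (continuous_bounded_bilinear opk (ulip_continuous Hphi Dth t01)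
    (ulip_continuous Hpsi Dth t01)).
- by move=> t th t01 Dth; rewrite op_le ?HA ?HB.
- move=> t th th' e t01 Dth Dth' D; rewrite bilinear_subE (le_trans (ler_normD _ _))//.
  rewrite mulrDr mulrDl lerD//.
    apply: (le_trans (op_le _ _ _ _ (HK t _ _ _ t01 Dth Dth' D) (HB t _ t01 Dth))).
    by rewrite -[leRHS]mulrA [K * B * e]mulrAC.
  apply: (le_trans (op_le _ _ _ _ (HA t _ t01 Dth') (HL t _ _ _ t01 Dth Dth' D))).
  by rewrite !mulrA.
Qed.

Lemma ulip_comp U V (g : U -> V) (L : R) (phi : R -> Th -> U) : 0 <= L -> L.-lipschitz g ->
  ulip phi -> ulip (fun t th => g (phi t th)).
Proof.
move=> L0 /[dup] gL /klipschitzP glip Hphi.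
have [A A0 HA] := ulip_bounded Hphi; have [K K0 HK] := ulip_lipschitz Hphi.
apply: (@ulip_intro _ _ (`|g 0| + L * A) (L * K)); rewrite ?addr_ge0 ?mulr_ge0//.
- move=> th Dth t t01; apply: continuous_comp; first exact: ulip_continuous Hphi Dth _ t01.
  exact: klipschitz_continuous gL _.
- move=> t th t01 Dth; rewrite -[g _](subrK (g 0)) (le_trans (ler_normD _ _))// addrC lerD2l.
  by rewrite (le_trans (glip _ _ I I))// subr0 ler_wpM2l// HA.
- move=> t th th' e t01 Dth Dth' D; rewrite (le_trans (glip _ _ I I))// -mulrA ler_wpM2l//.
  exact: HK.
Qed.

Lemma ulip_at1 V (phi : R -> Th -> V) : ulip phi -> ulip (fun _ th => phi 1 th).
Proof.
move=> [c1 [A A0 HA]]; split=> [th Dth t t01|]; first exact: cst_continuous.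
by exists A => // t th _ Dth; apply: HA => //; rewrite ler01 lexx.
Qed.

Lemma ulip_entry m n (phi : R -> Th -> 'M[R]_(m, n)) i j :
  ulip phi -> ulip (fun t th => phi t th i j).
Proof.
move=> Hphi; have [A A0 HA] := ulip_bounded Hphi; have [K K0 HK] := ulip_lipschitz Hphi.
apply: (@ulip_intro _ _ A K) => //.
- by move=> th Dth t t01; apply: continuous_entry; exact: ulip_continuous Hphi Dth _ t01.
- by move=> t th t01 Dth; rewrite (le_trans (ler_norm_mx _ _ _))// HA.
- move=> t th th' e t01 Dth Dth' D; rewrite (le_trans _ (HK t th th' e t01 Dth Dth' D))//.
  by have := ler_norm_mx (phi t th - phi t th') i j; rewrite !mxE.
Qed.

Lemma ulip_matrix m n (phi : R -> Th -> 'M[R]_(m, n)) :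
  (forall i j, ulip (fun t th => phi t th i j)) -> ulip phi.
Proof.
move=> Hphi.
have [A A0 HA] := @uniform_bound _ ('I_m * 'I_n)%type
  (fun ij C => forall t th, 0 <= t <= 1 -> pdom th -> `|phi t th ij.1 ij.2| <= C)
  (fun ij C D CD HC t th t01 Dth => le_trans (HC t th t01 Dth) CD)
  (fun ij => ulip_bounded (Hphi ij.1 ij.2)).
have [K K0 HK] := @uniform_bound _ ('I_m * 'I_n)%type
  (fun ij C => forall t th th' e, 0 <= t <= 1 -> pdom th -> pdom th' -> pclose th th' e ->
    `|phi t th ij.1 ij.2 - phi t th' ij.1 ij.2| <= C * e)
  (fun ij C D CD HC t th th' e t01 Dth Dth' th_th' =>
    le_trans (HC t th th' e t01 Dth Dth' th_th') (ler_wpM2r (pclose_ge0 th_th') CD))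
  (fun ij => ulip_lipschitz (Hphi ij.1 ij.2)).
apply: (@ulip_intro _ _ A K) => //.
- move=> th Dth t t01; apply: continuous_mxP => i j.
  exact: ulip_continuous (Hphi i j) Dth _ t01.
- by move=> t th t01 Dth; apply: mx_norm_le => // i j; exact: HA (i, j) t th t01 Dth.
- move=> t th th' e t01 Dth Dth' D; apply: mx_norm_le => [|i j].
    by rewrite mulr_ge0// (pclose_ge0 D).
  by rewrite !mxE; exact: HK (i, j) t th th' e t01 Dth Dth' D.
Qed.

Lemma ulip_pair U V (phi : R -> Th -> U) (psi : R -> Th -> V) : ulip phi -> ulip psi ->
  ulip (fun t th => (phi t th, psi t th)).
Proof.
move=> Hphi Hpsi; have [A A0 HA] := ulip_bounded Hphi; have [B B0 HB] := ulip_bounded Hpsi.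
have [K K0 HK] := ulip_lipschitz Hphi; have [L L0 HL] := ulip_lipschitz Hpsi.
apply: (@ulip_intro _ _ (A + B) (K + L)); rewrite ?addr_ge0//.
- move=> th Dth t t01; apply: cvg_pair.
    exact: ulip_continuous Hphi Dth _ t01.
  exact: ulip_continuous Hpsi Dth _ t01.
- move=> t th t01 Dth; rewrite prod_normE/= ge_max.
  by rewrite (le_trans (HA _ _ _ _)) ?(le_trans (HB _ _ _ _)) ?lerDl ?lerDr.
- move=> t th th' e t01 Dth Dth' D; have e0 := pclose_ge0 D.
  rewrite prod_normE/= ge_max mulrDl.
  by rewrite (le_trans (HK _ _ _ _ _ _ _ D)) ?(le_trans
    (HL _ _ _ _ _ _ _ D)) ?lerDl ?lerDr ?mulr_ge0.
Qed.

Lemma ulip_fst U V (phi : R -> Th -> U * V) : ulip phi -> ulip (fun t th => (phi t th).1).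
Proof.
move=> Hphi; apply: (@ulip_comp _ _ fst 1) Hphi => //.
by apply/klipschitzP => x y _ _; rewrite mul1r; exact: norm_fst_le (x - y).
Qed.

Lemma ulip_snd U V (phi : R -> Th -> U * V) : ulip phi -> ulip (fun t th => (phi t th).2).
Proof.
move=> Hphi; apply: (@ulip_comp _ _ snd 1) Hphi => //.
by apply/klipschitzP => x y _ _; rewrite mul1r; exact: norm_snd_le (x - y).
Qed.

Lemma ulipN V (phi : R -> Th -> V) : ulip phi -> ulip (fun t th => - phi t th).
Proof.
move=> Hphi; apply: (@ulip_comp _ _ -%R 1) Hphi => //.
by apply/klipschitzP => x y _ _; rewrite mul1r -opprD normrN.
Qed.

Lemma ulipB V (phi psi : R -> Th -> V) : ulip phi -> ulip psi ->
  ulip (fun t th => phi t th - psi t th).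
Proof. by move=> Hphi Hpsi; apply: ulipD => //; exact: ulipN. Qed.

Lemma ulip_scale V (a : R -> Th -> R) (phi : R -> Th -> V) : ulip a -> ulip phi ->
  ulip (fun t th => a t th *: phi t th).
Proof. exact: (ulip_op (k := 1) ler01 (@norm_scale_le _ V)). Qed.

Lemma ulipM (phi psi : R -> Th -> R) : ulip phi -> ulip psi ->
  ulip (fun t th => phi t th * psi t th).
Proof.
by apply: (@ulip_op _ _ _ ( *%R) 1) => // a b; rewrite normrM mul1r.
Qed.

Lemma ulip_mulmx m n p (A : R -> Th -> 'M[R]_(m, n)) (B : R -> Th -> 'M[R]_(n, p)) :
  ulip A -> ulip B -> ulip (fun t th => A t th *m B t th).
Proof. exact: (ulip_op (ler0n _ _) (@norm_mulmx_le _ m n p)). Qed.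

Lemma ulip_dot d (u v : R -> Th -> 'rV[R]_d) : ulip u -> ulip v ->
  ulip (fun t th => dot (u t th) (v t th)).
Proof. exact: (ulip_op (ler0n _ _) (@norm_dot_le _ d)). Qed.

Lemma ulipV (phi : R -> Th -> R) (m : R) : 0 < m ->
  (forall t th, 0 <= t <= 1 -> pdom th -> m <= phi t th) ->
  ulip phi -> ulip (fun t th => (phi t th)^-1).
Proof.
move=> m0 Hm Hphi; have [K K0 HK] := ulip_lipschitz Hphi.
have phi_gt0 t th : 0 <= t <= 1 -> pdom th -> 0 < phi t th.
  by move=> t01 Dth; rewrite (lt_le_trans m0)// Hm.
have inv_le t th : 0 <= t <= 1 -> pdom th -> `|(phi t th)^-1| <= m^-1.
  move=> t01 Dth; have phi0 := phi_gt0 t th t01 Dth.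
  by rewrite ger0_norm ?invr_ge0 ?(ltW phi0)// lef_pV2// Hm.
apply: (@ulip_intro _ _ m^-1 (m^-1 * m^-1 * K)); rewrite ?mulr_ge0 ?invr_ge0 ?(ltW m0)//.
- move=> th Dth t t01; apply: continuousV (ulip_continuous Hphi Dth t01).
  by rewrite gt_eqF// phi_gt0.
- move=> t th th' e t01 Dth Dth' D.
  have phi0 := phi_gt0 t th t01 Dth; have phi0' := phi_gt0 t th' t01 Dth'.
  rewrite (_ : _ - _ = (phi t th)^-1 * (phi t th')^-1 * (phi t th' - phi t th)); last first.
    by field; rewrite !gt_eqF.
  by rewrite !normrM distrC -[leRHS]mulrA ler_pM ?mulr_ge0// ?ler_pM ?inv_le ?HK.
Qed.

Lemma ulip_primitive (phi : R -> Th -> R) : ulip phi -> ulip (fun t th => primitive (phi ^~ th) t).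
Proof.
move=> Hphi; have [A A0 HA] := ulip_bounded Hphi; have [K K0 HK] := ulip_lipschitz Hphi.
apply: (@ulip_intro _ _ A K) => //.
- by move=> th Dth; apply: continuous_primitive; exact: ulip_continuous Hphi Dth.
- move=> t th t01 Dth; apply: norm_primitive_le (ulip_continuous Hphi Dth) _ t01 => s s01.
  exact: HA.
- move=> t th th' e t01 Dth Dth' D.
  by apply: norm_primitiveB => // [||s s01]; [exact: ulip_continuous Hphi
    Dth|exact: ulip_continuous Hphi Dth'|exact: HK].
Qed.

Lemma ulip_primitive_mx m n (phi : R -> Th -> 'M[R]_(m, n)) :
  ulip phi -> ulip (fun t th => primitive_mx (phi ^~ th) t).
Proof.
move=> Hphi; apply: ulip_matrix => i j.
apply: (@eq_ulip _ (fun t th => primitive (fun s => phi s th i j) t)).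
  by move=> t th _; rewrite mxE.
by apply: ulip_primitive; exact: ulip_entry.
Qed.

End uniformly_lipschitz_families.

Lemma lipschitz_IVT {R : realType} (f : R -> R) (K a b v : R) : a <= b -> 0 <= K ->
  K.-lipschitz_`[a, b] f -> Num.min (f a) (f b) <= v <= Num.max (f a) (f b) ->
  exists2 s, a <= s <= b & f s = v.
Proof.
move=> ab K0 fK vab; have cf := klipschitz_continuous (klipschitz_clamp ab K0 fK).
have [||s sab fs] := @IVT R (f \o clamp a b) a b v ab.
- exact: continuous_subspaceT.
- by rewrite /= !clamp_id ?lexx ?ab.
by exists s => //; rewrite -fs /= clamp_id.
Qed.

(** * The unperturbed system *)

Section trigonometric_lipschitz.
Context {R : realType}.

Lemma klipschitz_derive_line (f df : R -> R) (L : R) :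
  (forall x : R, is_derive x 1 f (df x)) -> (forall x, `|df x| <= L) -> L.-lipschitz f.
Proof.
move=> Df bound; apply/klipschitzP => x y _ _.
wlog xy : x y / x <= y.
  by move=> H; have [/H//|/ltW/H] := leP x y; rewrite distrC (distrC y).
have /klipschitz_segmentP/(_ x y (lexx _) xy (lexx _)) : L.-lipschitz_`[x, y] f.
  exact: (klipschitz_derive (fun t _ => Df t) (fun t _ => bound t)).
by rewrite distrC (distrC x) (ger0_norm (_ : 0 <= y - x)) ?subr_ge0.
Qed.

Lemma sin_lipschitz : (1 : R).-lipschitz (@sin R).
Proof. by apply: (klipschitz_derive_line (@is_derive_sin R)) => x; exact: cos_max. Qed.

Lemma cos_lipschitz : (1 : R).-lipschitz (@cos R).
Proof. by apply: (klipschitz_derive_line (@is_derive_cos R)) => x;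
  rewrite normrN; exact: sin_max. Qed.

End trigonometric_lipschitz.

Section spectral_calculus.
Context {R : realType} {n : nat}.
Variables (J : 'M[R]_n) (alf : 'I_n -> R).
Implicit Types (a b phi psi : R -> R).

Definition diagf phi : 'M[R]_n := diag_mx (\row_i phi (alf i)).

Lemma eq_diagf phi psi : (forall i, phi (alf i) = psi (alf i)) -> diagf phi = diagf psi.
Proof. by move=> E; rewrite /diagf; congr diag_mx; apply/rowP => i; rewrite !mxE. Qed.

Lemma diagf_mul phi psi : diagf phi *m diagf psi = diagf (fun x => phi x * psi x).
Proof. by rewrite mulmx_diag; congr diag_mx; apply/rowP => i; rewrite !mxE. Qed.

Lemma diagfD phi psi : diagf phi + diagf psi = diagf (fun x => phi x + psi x).
Proof. by rewrite -raddfD; congr diag_mx; apply/rowP => i; rewrite !mxE. Qed.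

Lemma diagfN phi : - diagf phi = diagf (fun x => - phi x).
Proof. by rewrite -raddfN; congr diag_mx; apply/rowP => i; rewrite !mxE. Qed.

Lemma diagfZ (k : R) phi : k *: diagf phi = diagf (fun x => k * phi x).
Proof. by rewrite -linearZ; congr diag_mx; apply/rowP => i; rewrite !mxE. Qed.

Lemma diagf_cst (k : R) : diagf (fun=> k) = k%:M.
Proof. by apply/matrixP => i j; rewrite !mxE. Qed.

Hypothesis alf_gt0 : forall i, 0 < alf i.
Hypothesis J_sqr : J *m J = - diagf (fun x => x ^+ 2).

Lemma diagf_comm phi : diagf phi *m J = J *m diagf phi.
Proof.
have comm_sqr : diagf (fun x => x ^+ 2) *m J = J *m diagf (fun x => x ^+ 2).
  by rewrite -[diagf _]opprK -J_sqr mulNmx mulmxN mulmxA.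
apply/matrixP => i j; rewrite mul_diag_mx mul_mx_diag !mxE.
have /matrixP/(_ i j) := comm_sqr; rewrite mul_diag_mx mul_mx_diag !mxE.
have [->|Jij /eqP] := eqVneq (J i j) 0; first by move=> _; rewrite mulr0 mul0r.
rewrite mulrC (inj_eq (mulfI Jij)) eqrXn2 ?ltW// => /eqP ->.
by rewrite mulrC.
Qed.

(* Since [J ^ 2] is minus the diagonal matrix of the [alf i ^ 2], these matrices multiply
   as the complex numbers [a x + i x * b x]. *)
Definition complexf a b : 'M[R]_n := diagf a + J *m diagf b.

Lemma eq_complexf a b a' b' : (forall i, a (alf i) = a' (alf i)) ->
  (forall i, b (alf i) = b' (alf i)) -> complexf a b = complexf a' b'.
Proof. by move=> /eq_diagf Ea /eq_diagf Eb; rewrite /complexf Ea Eb. Qed.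

Lemma complexf_mul a b a' b' : complexf a b *m complexf a' b' =
  complexf (fun x => a x * a' x - x ^+ 2 * (b x * b' x)) (fun x => a x * b' x + b x * a' x).
Proof.
rewrite /complexf mulmxDl !mulmxDr !mulmxA diagf_comm -!mulmxA !diagf_mul.
rewrite (mulmxA (diagf b) J) diagf_comm -mulmxA diagf_mul (mulmxA J J) J_sqr mulNmx diagf_mul.
rewrite -!diagfD -!diagfN mulmxDr.
by rewrite [X in _ + X = _]addrC addrACA.
Qed.

Lemma complexf1 : complexf (fun=> 1) (fun=> 0) = 1%:M.
Proof. by rewrite /complexf !diagf_cst scalar_mxC mul_scalar_mx scale0r addr0. Qed.

Lemma complexfJ : complexf (fun=> 0) (fun=> 1) = J.
Proof. by rewrite /complexf !diagf_cst mulmx1 -scalemx1 scale0r add0r. Qed.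

Lemma complexfD a b a' b' :
  complexf a b + complexf a' b' = complexf (fun x => a x + a' x) (fun x => b x + b' x).
Proof. by rewrite /complexf addrACA -mulmxDr !diagfD. Qed.

Lemma complexfZ (k : R) a b : k *: complexf a b = complexf (fun x => k * a x) (fun x => k * b x).
Proof. by rewrite /complexf scalerDr scalemxAr !diagfZ. Qed.

Lemma is_derive_complexf (a b : R -> R -> R) (t : R) a' b' :
  (forall i, is_derive t 1 (a ^~ (alf i)) (a' (alf i))) ->
  (forall i, is_derive t 1 (b ^~ (alf i)) (b' (alf i))) ->
  is_derive t 1 (fun r => complexf (a r) (b r)) (complexf a' b').
Proof.
have diag (phi : R -> R -> R) phi' : (forall i, is_derive t 1 (phi ^~ (alf i)) (phi' (alf i))) ->
    is_derive t 1 (fun r => diagf (phi r)) (diagf phi').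
  move=> dphi; apply/is_derive_mxP => i j.
  rewrite (_ : (fun r => _) = (fun r => phi r (alf i) *+ (i == j))); last first.
    by apply: funext => r; rewrite !mxE.
  by rewrite !mxE; case: (i == j); [exact: dphi|exact: is_derive_cst].
move=> /diag da /diag db; apply: is_deriveD => //.
by apply: is_derive_eq (is_derive_mulmx (is_derive_cst J t 1) db) _; rewrite mul0mx add0r.
Qed.

Lemma ulip_complexf (Th : parameter_space (R := R)) (a b : R -> Th -> R -> R) :
  (forall i, ulip (fun t th => a t th (alf i))) -> (forall i, ulip (fun t th => b t th (alf i))) ->
  ulip (fun t th => complexf (a t th) (b t th)).
Proof.
have diag (phi : R -> Th -> R -> R) : (forall i, ulip (fun t th => phi t th (alf i))) ->
    ulip (fun t th => diagf (phi t th)).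
  move=> Hphi; apply: ulip_matrix => i j.
  apply: (@eq_ulip _ _ _ (fun t th => if i == j then phi t th (alf i) else 0)).
    by move=> t th _; rewrite !mxE; case: (i == j).
  by case: (i == j); [exact: Hphi|exact: ulip_cst].
move=> /diag Ha /diag Hb; apply: ulipD => //; apply: ulip_mulmx => //; exact: ulip_cst.
Qed.

Definition rot (s t : R) : 'M[R]_n :=
  complexf (fun x => cos (s * t * x)) (fun x => sin (s * t * x) / x).

Lemma rot0 s : rot s 0 = 1%:M.
Proof.
rewrite -complexf1; apply: eq_complexf => i; first by rewrite mulr0 mul0r cos0.
by rewrite mulr0 mul0r sin0 mul0r.
Qed.

Lemma rotVK s t : rot s (- t) *m rot s t = 1%:M.
Proof.
rewrite -complexf1 complexf_mul; apply: eq_complexf => i;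
  have x0 : alf i != 0 by rewrite gt_eqF.
  rewrite mulrN mulNr cosN sinN (_ : _ - _ = cos (s * t * alf i) ^+ 2 + sin (s * t * alf i) ^+ 2).
    by rewrite cos2Dsin2.
  by field.
by rewrite mulrN mulNr cosN sinN; field.
Qed.

Lemma rotJ s t : rot s t *m J =
  complexf (fun x => - (x * sin (s * t * x))) (fun x => cos (s * t * x)).
Proof.
rewrite -[in LHS]complexfJ complexf_mul; apply: eq_complexf => i;
  have x0 : alf i != 0 by rewrite gt_eqF.
  by field.
by rewrite mulr1 mulr0 addr0.
Qed.

Lemma is_derive_rot s (t : R) : is_derive t 1 (rot s) (s *: (rot s t *m J)).
Proof.
rewrite rotJ complexfZ.
have darg (x : R) : is_derive t 1 (fun r => s * r * x) (s * x).
  apply: is_derive_eq (is_derive_mul (is_derive_mul (is_derive_cst s t 1)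
    (is_derive_id t 1)) (is_derive_cst x t 1)) _.
  by rewrite mul0r add0r mulr1 mulr0 addr0.
apply: is_derive_complexf => i; have x0 : alf i != 0 by rewrite gt_eqF.
  apply: is_derive_eq (is_derive1_comp (is_derive_cos _) (darg (alf i))) _.
  by ring.
have dsin := is_derive1_comp (is_derive_sin _) (darg (alf i)).
apply: is_derive_eq (is_derive_mul dsin (is_derive_cst (alf i)^-1 t 1)) _.
by rewrite /cst /= mulr0 addr0; field.
Qed.

Definition rot_resolvent (s : R) : 'M[R]_n :=
  complexf (fun=> - 2^-1) (fun x => - (sin (s * x) / (x * (2 - 2 * cos (s * x))))).

Lemma rot_resolventK s : (forall i, 2 - 2 * cos (s * alf i) != 0) ->
  rot_resolvent s *m (rot s 1 - 1%:M) = 1%:M.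
Proof.
move=> nonres; rewrite (_ : rot s 1 - 1%:M =
    complexf (fun x => cos (s * x) - 1) (fun x => sin (s * x) / x)); last first.
  rewrite -complexf1 -scaleN1r complexfZ complexfD.
  by apply: eq_complexf => i; rewrite !mulr1 ?mulr0 ?addr0 ?mulN1r.
rewrite complexf_mul -complexf1; apply: eq_complexf => i; have x0 : alf i != 0 by rewrite gt_eqF.
  have q2 : sin (s * alf i) ^+ 2 = 1 - cos (s * alf i) ^+ 2
    by rewrite -(cos2Dsin2 (s * alf i)) addrC addKr.
  move: q2 (nonres i); set c := cos _; set q := sin _ => q2 c1.
  transitivity ((1 - c) / 2 + q ^+ 2 / (2 - 2 * c)); last by rewrite q2; field.
  by field; rewrite c1.
by field; rewrite nonres.
Qed.

End spectral_calculus.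

Section forced_linear_system.
Context {R : realType} {n : nat}.
Variables (J : 'M[R]_n) (alf : 'I_n -> R).
Hypothesis alf_gt0 : forall i, 0 < alf i.
Hypothesis J_sqr : J *m J = - diagf alf (fun x => x ^+ 2).
Local Notation rot := (rot J alf).
Local Notation rot_resolvent := (rot_resolvent J alf).
Implicit Types (s t : R) (xi : 'rV[R]_n).

(* The solution of [X' = U + fX], [U' = s U J + fU] with [X 0 = 0] and [X 1 = xi]. *)
Section solution.
Variables (s : R) (xi : 'rV[R]_n) (fX fU : R -> 'rV[R]_n).

Definition forcing_drift t : 'rV[R]_n := primitive_mx (fun r => fU r - s *: (fX r *m J)) t.

Definition forcing_response t : 'rV[R]_n := primitive_mx (fun r => fU r *m rot s (- r)) t.

Definition initial_velocity : 'rV[R]_n :=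
  (s *: (xi *m J) + forcing_drift 1 - forcing_response 1 *m rot s 1) *m rot_resolvent s.

Definition linear_velocity t : 'rV[R]_n := (initial_velocity + forcing_response t) *m rot s t.

Definition linear_position t : 'rV[R]_n :=
  - s^-1 *: ((linear_velocity t - initial_velocity - forcing_drift t) *m J *m
    diagf alf (fun x => x ^- 2)).

Hypotheses (fX_cont : {in `[0, 1], continuous fX}) (fU_cont : {in `[0, 1], continuous fU}).
Hypothesis s_neq0 : s != 0.

Let continuous_mulmxr (f : R -> 'rV[R]_n) (A : R -> 'M[R]_n) (t : R) :
  {for t, continuous f} -> {for t, continuous A} -> {for t, continuous (fun r => f r *m A r)}.
Proof. exact: (continuous_bounded_bilinear (@norm_mulmx_le _ 1 n n)). Qed.

Lemma is_derive_forcing_drift t : 0 <= t <= 1 ->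
  is_derive t 1 forcing_drift (fU t - s *: (fX t *m J)).
Proof.
have cfXJ r : r \in `[0, 1] -> {for r, continuous (fun r => s *: (fX r *m J))}.
  move=> r01; apply: (continuous_bounded_bilinear (@norm_scale_le _ _));
    first exact: cst_continuous.
  by apply: continuous_mulmxr; [exact: fX_cont|exact: cst_continuous].
apply: is_derive_primitive_mx => r r01; exact: continuousB (fU_cont r01) (cfXJ r r01).
Qed.

Lemma is_derive_forcing_response t : 0 <= t <= 1 ->
  is_derive t 1 forcing_response (fU t *m rot s (- t)).
Proof.
apply: is_derive_primitive_mx => r r01; apply: (continuous_mulmxr (fU_cont r01)).
apply: (@continuous_comp _ _ _ -%R (rot s)); first exact: opp_continuous.
exact: is_derive_continuous (is_derive_rot alf_gt0 J_sqr s (- r)).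
Qed.

Lemma is_derive_linear_velocity t : 0 <= t <= 1 ->
  is_derive t 1 linear_velocity (s *: (linear_velocity t *m J) + fU t).
Proof.
move=> t01; have dI := is_derive_forcing_response t01.
have dU0 := is_deriveD (is_derive_cst initial_velocity t 1) dI.
apply: is_derive_eq (is_derive_mulmx dU0 (is_derive_rot alf_gt0 J_sqr s t)) _.
by rewrite add0r -mulmxA rotVK// mulmx1 -scalemxAr mulmxA addrC.
Qed.

Let mulmxJJ_inv (v : 'rV[R]_n) : - (v *m J *m J *m diagf alf (fun x => x ^- 2)) = v.
Proof.
rewrite -!mulmxA (mulmxA J) J_sqr mulNmx mulmxN opprK diagf_mul.
rewrite (@eq_diagf _ _ _ _ (fun=> 1)) => [|i]; first by rewrite diagf_cst mulmx1.
by rewrite divff// expf_neq0// gt_eqF.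
Qed.

Lemma is_derive_linear_position t : 0 <= t <= 1 ->
  is_derive t 1 linear_position (linear_velocity t + fX t).
Proof.
move=> t01; have dU := is_derive_linear_velocity t01.
have dnum := is_deriveB (is_deriveB dU (is_derive_cst initial_velocity t 1))
  (is_derive_forcing_drift t01).
have dJ := is_derive_mulmx (is_derive_mulmx dnum (is_derive_cst J t 1))
  (is_derive_cst (diagf alf (fun x => x ^- 2)) t 1).
apply: is_derive_eq (is_deriveZ (- s^-1) dJ) _.
rewrite !mulmx0 !addr0 subr0.
rewrite (_ : s *: _ + fU t - _ = s *: ((linear_velocity t + fX t) *m J)); last first.
  by rewrite mulmxDl scalerDr opprB addrACA subrr addr0.
by rewrite -!scalemxAl scalerA mulNr mulVf// scaleN1r mulmxJJ_inv.
Qed.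

Lemma linear_position0 : linear_position 0 = 0.
Proof.
rewrite /linear_position /linear_velocity /forcing_response /forcing_drift !primitive_mx0.
by rewrite rot0 addr0 mulmx1 !subrr !mul0mx scaler0.
Qed.

Lemma linear_position1 : (forall i, 2 - 2 * cos (s * alf i) != 0) -> linear_position 1 = xi.
Proof.
move=> nonres; rewrite /linear_position /linear_velocity.
set U0 := initial_velocity.
have U0_rot : U0 *m rot s 1 = U0 + (s *: (xi *m J) + forcing_drift 1 -
  forcing_response 1 *m rot s 1).
  rewrite -[X in U0 + X]mulmx1 -(rot_resolventK alf_gt0 J_sqr nonres) mulmxA.
  by rewrite mulmxBr mulmx1 addrC subrK.
rewrite (mulmxDl U0) U0_rot -(addrA U0) subrK [U0 + _]addrC addrK addrK.
by rewrite -!scalemxAl scalerA mulNr mulVf// scaleN1r mulmxJJ_inv.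
Qed.

End solution.

Section parameter_dependence.
Variables (Th : parameter_space (R := R)) (sg : Th -> R) (fX fU : R -> Th -> 'rV[R]_n).
Variables (xi : 'rV[R]_n) (s1 m : R).
Hypotheses (sg_ulip : ulip (fun _ => sg)) (fX_ulip : ulip fX) (fU_ulip : ulip fU).
Hypotheses (s1_gt0 : 0 < s1) (sg_ge : forall th, pdom th -> s1 <= sg th).
Hypotheses (m_gt0 : 0 < m)
  (nonres : forall th, pdom th -> forall i, m <= 2 - 2 * cos (sg th * alf i)).

Let ulip_cos (phi : R -> Th -> R) : ulip phi -> ulip (fun t th => cos (phi t th)).
Proof. exact: (ulip_comp ler01 cos_lipschitz). Qed.

Let ulip_sin (phi : R -> Th -> R) : ulip phi -> ulip (fun t th => sin (phi t th)).
Proof. exact: (ulip_comp ler01 sin_lipschitz). Qed.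

Lemma ulip_rot (tau : R -> Th -> R) : ulip tau -> ulip (fun t th => rot (sg th) (tau t th)).
Proof.
move=> Htau; apply: ulip_complexf => i.
  by apply: ulip_cos; apply: ulipM; [exact: ulipM|exact: ulip_cst].
apply: ulipM; last exact: ulip_cst.
by apply: ulip_sin; apply: ulipM; [exact: ulipM|exact: ulip_cst].
Qed.

Lemma ulip_rot_resolvent : ulip (fun _ th => rot_resolvent (sg th)).
Proof.
have sx i : ulip (fun (_ : R) th => sg th * alf i) by apply: ulipM => //; exact: ulip_cst.
apply: ulip_complexf => i; first exact: ulip_cst.
apply: ulipN; apply: ulipM; first exact: ulip_sin.
apply: (@ulipV _ _ _ (alf i * m)); first exact: mulr_gt0.
  by move=> t th _ Dth; rewrite ler_wpM2l ?nonres// ltW.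
apply: ulipM; first exact: ulip_cst.
apply: ulipB; first exact: ulip_cst.
by apply: ulipM; [exact: ulip_cst|exact: ulip_cos].
Qed.

Lemma ulip_forcing_drift : ulip (fun t th => forcing_drift (sg th) (fX ^~ th) (fU ^~ th) t).
Proof.
apply: ulip_primitive_mx; apply: ulipB => //; apply: ulip_scale => //.
by apply: ulip_mulmx => //; exact: ulip_cst.
Qed.

Lemma ulip_forcing_response : ulip (fun t th => forcing_response (sg th) (fU ^~ th) t).
Proof.
apply: ulip_primitive_mx; apply: ulip_mulmx => //.
by apply: ulip_rot; apply: ulip_time_only => t _; exact: opp_continuous.
Qed.

Lemma ulip_initial_velocity :
  ulip (fun _ th => initial_velocity (sg th) xi (fX ^~ th) (fU ^~ th)).
Proof.
apply: ulip_mulmx; last exact: ulip_rot_resolvent.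
apply: ulipB; first by apply: ulipD; [apply: ulip_scale => //;
  exact: ulip_cst|exact: ulip_at1 ulip_forcing_drift].
apply: ulip_mulmx; first exact: ulip_at1 ulip_forcing_response.
by apply: ulip_rot; exact: ulip_cst.
Qed.

Lemma ulip_linear_velocity :
  ulip (fun t th => linear_velocity (sg th) xi (fX ^~ th) (fU ^~ th) t).
Proof.
apply: ulip_mulmx; first by apply: ulipD; [exact:
  ulip_initial_velocity|exact: ulip_forcing_response].
by apply: ulip_rot; apply: ulip_time_only => t _; exact: cvg_id.
Qed.

Lemma ulip_linear_position :
  ulip (fun t th => linear_position (sg th) xi (fX ^~ th) (fU ^~ th) t).
Proof.
apply: ulip_scale; first by apply: ulipN; apply: (@ulipV _ _ _ s1) => // t th _ /sg_ge.
apply: ulip_mulmx; last exact: ulip_cst.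
apply: ulip_mulmx; last exact: ulip_cst.
apply: ulipB; last exact: ulip_forcing_drift.
by apply: ulipB; [exact: ulip_linear_velocity|exact: ulip_initial_velocity].
Qed.

End parameter_dependence.

End forced_linear_system.

(** * Adapted frames and rescaling *)

Section taylor_quotients.
Context {R : realType} {E V : normedModType R}.
Variables (F : E -> V) (y0 : E) (A : set E) (C : R).
Hypotheses (F_C11 : C11_on A C F) (A_y0 : A y0) (C_ge0 : 0 <= C).
Variables (eta M : R).
Hypotheses (eta_gt0 : 0 < eta) (eta_le1 : eta <= 1).
Hypothesis in_A : forall x, `|x| <= M -> A (y0 + eta ^+ 2 *: x).

Definition increment_quotient (x : E) : V := eta^-1 *: (F (y0 + eta ^+ 2 *: x) - F y0).

Definition taylor_quotient (x : E) : V :=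
  eta ^- 3 *: (F (y0 + eta ^+ 2 *: x) - F y0 - 'd F y0 (eta ^+ 2 *: x)).

Definition diff_increment_quotient (v x : E) : V :=
  eta^-1 *: ('d F (y0 + eta ^+ 2 *: x) v - 'd F y0 v).

Let eta2_ge0 : 0 <= eta ^+ 2. Proof. by rewrite exprn_ge0// ltW. Qed.

Let shift_norm x x' : `|y0 + eta ^+ 2 *: x - (y0 + eta ^+ 2 *: x')| = eta ^+ 2 * `|x - x'|.
Proof. by rewrite opprD addrACA subrr add0r -scalerBr normrZ ger0_norm. Qed.

Let shift0_norm x : `|y0 + eta ^+ 2 *: x - y0| = eta ^+ 2 * `|x|.
Proof. by rewrite addrAC subrr add0r normrZ ger0_norm. Qed.

Let norm_quotient (k : nat) (v : V) (a : R) : `|v| <= eta ^+ k * a -> `|eta ^- k *: v| <= a.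
Proof.
move=> va; have ek : 0 < eta ^+ k by rewrite exprn_gt0.
by rewrite normrZ normfV (gtr0_norm ek) ler_pdivrMl.
Qed.

Lemma klipschitz_increment_quotient : C.-lipschitz_[set x | `|x| <= M] increment_quotient.
Proof.
apply/klipschitzP => x x' /in_A Ax /in_A Ax'.
rewrite /increment_quotient -scalerBr opprB addrA subrK -[eta in eta^-1]expr1.
apply: norm_quotient; rewrite (le_trans (C11_lipschitz F_C11 Ax' Ax))// shift_norm expr1.
by rewrite mulrCA expr2 -!mulrA ler_wpM2l ?(ltW eta_gt0)// ler_piMl ?mulr_ge0.
Qed.

Lemma klipschitz_diff_increment_quotient v :
  (C * `|v|).-lipschitz_[set x | `|x| <= M] (diff_increment_quotient v).
Proof.
apply/klipschitzP => x x' /in_A Ax /in_A Ax'.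
rewrite /diff_increment_quotient -scalerBr opprB addrA subrK -[eta in eta^-1]expr1.
apply: norm_quotient; rewrite (le_trans (C11_diff_lipschitz F_C11 v Ax' Ax))// shift_norm expr1.
rewrite [leLHS](_ : _ = eta * (eta * (C * `|v| * `|x - x'|))); last by ring.
by rewrite ler_wpM2l ?(ltW eta_gt0)// ler_piMl ?mulr_ge0.
Qed.

Lemma klipschitz_taylor_quotient : (C * (3 * M)).-lipschitz_[set x | `|x| <= M] taylor_quotient.
Proof.
apply/klipschitzP => x x' /[dup] xM /in_A Ax /[dup] x'M /in_A Ax' /=.
rewrite /taylor_quotient -scalerBr; apply: norm_quotient.
set y := y0 + _ *: x; set y' := y0 + _ *: x'.
have -> : F y - F y0 - 'd F y0 (eta ^+ 2 *: x) - (F y' - F y0 - 'd F y0 (eta ^+ 2 *: x')) =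
    (F y - F y' - 'd F y' (y - y')) + ('d F y' (y - y') - 'd F y0 (y - y')).
  rewrite subrKA (_ : y - y' = eta ^+ 2 *: x - eta ^+ 2 *: x'); last first.
    by rewrite /y /y' opprD addrACA subrr add0r.
  by rewrite (linearB ('d F y0)) (opprD (F y' - F y0)) addrACA opprB subrKA -opprD.
rewrite (le_trans (ler_normD _ _))//.
apply: (le_trans (lerD (C11_taylor F_C11 Ax' Ax) (C11_diff_lipschitz F_C11 _ A_y0 Ax'))).
rewrite shift_norm shift0_norm.
have xx'M : `|x - x'| <= 2 * M by rewrite mulr_natl mulr2n (le_trans (ler_normB _ _))// lerD.
rewrite [leLHS](_ : _ = eta ^+ 4 * (C * (`|x - x'| * `|x - x'| + `|x'| * `|x - x'|))); last by ring.
rewrite (_ : eta ^+ 4 = eta ^+ 3 * eta); last by ring.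
rewrite -mulrA ler_wpM2l ?exprn_ge0 ?(ltW eta_gt0)//.
rewrite (@le_trans _ _ (C * (`|x - x'| * `|x - x'| + `|x'| * `|x - x'|)))//.
  by rewrite ler_piMl// !(mulr_ge0, addr_ge0).
rewrite -mulrA ler_wpM2l// -mulrDl ler_wpM2r//.
by rewrite (_ : 3 * M = 2 * M + M); [exact: lerD|ring].
Qed.

Lemma increment_quotient0 : increment_quotient 0 = 0.
Proof. by rewrite /increment_quotient scaler0 addr0 subrr scaler0. Qed.

Lemma taylor_quotient0 : taylor_quotient 0 = 0.
Proof. by rewrite /taylor_quotient scaler0 addr0 subrr linear0 subr0 scaler0. Qed.

Lemma diff_increment_quotient0 v : diff_increment_quotient v 0 = 0.
Proof. by rewrite /diff_increment_quotient scaler0 addr0 subrr scaler0. Qed.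

End taylor_quotients.

Section ulip_superposition.
Context {R : realType} {Th : parameter_space (R := R)} {U V : normedModType R}.

Lemma ulip_superposition (A : set U) (g : Th -> U -> V) (L : R) (phi : R -> Th -> U) : 0 <= L ->
  (forall th, pdom th -> L.-lipschitz_A (g th)) ->
    (exists2 B, 0 <= B & forall th, pdom th -> `|g th 0| <= B) ->
  A 0 -> (forall th th' e, pclose th th' e -> g th = g th') ->
  (forall (t : R) th, 0 <= t <= 1 -> pdom th -> nbhs (phi t th) A) ->
  ulip phi -> ulip (fun t th => g th (phi t th)).
Proof.
move=> L0 gL [B B0 HB] A0 g_loc phiA Hphi.
have [P P0 HP] := ulip_bounded Hphi; have [K K0 HK] := ulip_lipschitz Hphi.
have phi_in t th : 0 <= t <= 1 -> pdom th -> A (phi t th) by move=> t01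
  /(phiA t th t01)/nbhs_singleton.
apply: (@ulip_intro _ _ _ _ (B + L * P) (L * K)); rewrite ?addr_ge0 ?mulr_ge0//.
- move=> th Dth t t01; have /klipschitzP glip := gL th Dth.
  have nA := phiA t th t01 Dth; have cphi := ulip_continuous Hphi Dth t01.
  apply/cvgrPdist_le => e e0; have L1 : 0 < L + 1 by rewrite ltr_wpDl.
  have /cvgrPdist_le/(_ (e / (L + 1)))/(_ (divr_gt0 e0 L1)) near_phi := cphi.
  apply: filterS2 near_phi (cphi _ nA) => r phir Ar.
  rewrite (le_trans (glip _ _ (nbhs_singleton nA) Ar))//.
  rewrite (@le_trans _ _ ((L + 1) * `|phi t th - phi r th|)) ?ler_wpM2r ?lerDl//.
  by rewrite mulrC -ler_pdivlMr.
- move=> t th t01 Dth; have /klipschitzP glip := gL th Dth.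
  rewrite -[g _ _](subrK (g th 0)) (le_trans (ler_normD _ _))// addrC lerD ?HB//.
  rewrite (le_trans (glip _ _ (phi_in t th t01 Dth) A0))// subr0 ler_wpM2l//; exact: HP.
- move=> t th th' e t01 Dth Dth' D; rewrite -(g_loc _ _ _ D).
  have /klipschitzP glip := gL th Dth.
  rewrite (le_trans (glip _ _ (phi_in _ _ t01 Dth) (phi_in _ _ t01 Dth')))// -mulrA ler_wpM2l//.
  exact: HK.
Qed.

End ulip_superposition.

Section adapted_frames.
Context {R : realType} (n d : nat).

(* The hyperplane at [y] is spanned by the rows of [basis + (drift y)^T *m transversal]. *)
Record adapted_frame (y0 : 'rV[R]_d) (rho : R) := AdaptedFrame {
  basis : 'M[R]_(n, d);
  transversal : 'rV[R]_d;
  dual_basis : 'M[R]_(n, d);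
  dual_transversal : 'rV[R]_d;
  drift : 'rV[R]_d -> 'rV[R]_n;
  cometric : 'rV[R]_d -> 'M[R]_n;
  dual_basisK : dual_basis *m basis^T = 1%:M;
  dual_transversal_basis : dual_transversal *m basis^T = 0;
  dual_basis_transversal : dual_basis *m transversal^T = 0;
  dual_transversalK : dual_transversal *m transversal^T = 1%:M;
  frame_resolution : transversal^T *m dual_transversal + basis^T *m dual_basis = 1%:M;
  drift0 : drift y0 = 0;
  drift_C11 : C11 (cube y0 rho) drift;
  cometric_C11 : C11 (cube y0 rho) cometric;
  cometric_sym : forall y, cube y0 rho y -> (cometric y)^T = cometric y;
  cometric_unit : cometric y0 \in unitmx
}.

End adapted_frames.

Section grad_characterization.
Context {R : realType} {d : nat}.

Lemma is_diff_grad (f : 'rV[R]_d -> R) x v : is_diff x f (dot v) -> grad f x = v.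
Proof.
by move=> [df dE]; apply/rowP => l; rewrite mxE deriveE// dE dot_delta.
Qed.

End grad_characterization.

Section frame_hamiltonian.
Context {R : realType} {n d : nat} {y0 : 'rV[R]_d} {rho : R}.
Variable F : adapted_frame n y0 rho.
Implicit Types (y p q w : 'rV[R]_d).
Local Notation b := (basis F).
Local Notation e := (transversal F).
Local Notation a := (drift F).
Local Notation K := (cometric F).

Lemma basis_dualK : b *m (dual_basis F)^T = 1%:M.
Proof. by rewrite -[LHS]trmxK trmx_mul trmxK dual_basisK trmx1. Qed.

Lemma transversal_dual : e *m (dual_basis F)^T = 0.
Proof. by rewrite -[LHS]trmxK trmx_mul trmxK dual_basis_transversal trmx0. Qed.

Definition momentum y p : 'rV[R]_n := p *m b^T + dot p e *: a y.

Definition control y p : 'rV[R]_n := momentum y p *m K y.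

Definition frame_velocity y p : 'rV[R]_d := control y p *m b + dot (control y p) (a y) *: e.

Definition frame_ham y p : R := 2^-1 * dot (control y p) (momentum y p).

Lemma dot_control_sym y u v : cube y0 rho y -> dot (u *m K y) v = dot u (v *m K y).
Proof. by move=> Ay; rewrite dot_mulmx cometric_sym. Qed.

Lemma dot_frame_velocity y p q : dot (frame_velocity y p) q = dot (control y p) (momentum y q).
Proof.
by rewrite /frame_velocity dotDl dotZl dot_mulmx /momentum dotDr dotZr (dotC e) mulrC.
Qed.

Lemma dot_momentum_frame_velocity y p : dot p (frame_velocity y p) = 2 * frame_ham y p.
Proof. by rewrite dotC dot_frame_velocity /frame_ham mulrA divff ?mul1r. Qed.

Lemma grad_frame_ham y p : cube y0 rho y -> grad (frame_ham y) p = frame_velocity y p.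
Proof.
move=> Ay; apply: is_diff_grad.
have dmom : is_diff p (momentum y) (momentum y).
  have did := is_diff_id p.
  have dlin := is_diff_bounded_bilinearl (@norm_mulmx_le _ 1 d n) b^T did.
  have ddot := is_diff_bounded_bilinearl (@norm_dot_le _ d) e did.
  exact: is_diffD dlin (is_diff_bounded_bilinearl (@norm_scale_le _ _) (a y) ddot).
have dctrl := is_diff_bounded_bilinearl (@norm_mulmx_le _ 1 n n) (K y) dmom.
have dham := is_diffZ 2^-1 (is_diff_bounded_bilinear (@norm_dot_le _ n) dctrl dmom).
apply: is_diff_eq dham _; apply: funext => q; rewrite dot_frame_velocity.
rewrite -[LHS]/(2^-1 * (dot (momentum y q *m K y) (momentum y p) + dot
  (control y p) (momentum y q))).
by rewrite dot_control_sym// (dotC (momentum y q)) -/(control y p); field.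
Qed.

Lemma is_diff_frame_ham y p : cube y0 rho y -> is_diff y (frame_ham^~ p) (fun w =>
  2^-1 * dot (momentum y p *m 'd K y w) (momentum y p) + dot p e * dot (control y p) ('d a y w)).
Proof.
move=> Ay; have [[C _ HK] [C' _ Ha]] := (cometric_C11 F, drift_C11 F).
have dK := differentiableP (C11_differentiable HK Ay).
have da := differentiableP (C11_differentiable Ha Ay).
have dmom : is_diff y (momentum^~ p) (fun w => dot p e *: 'd a y w).
  apply: is_diff_eq (is_diffD (is_diff_cst (p *m b^T) y)
    (is_diff_bounded_bilinearr (@norm_scale_le _ _) (dot p e) da)) _.
  by rewrite add0r.
have dctrl := is_diff_bounded_bilinear (@norm_mulmx_le _ 1 n n) dmom dK.
have dham := is_diffZ 2^-1 (is_diff_bounded_bilinear (@norm_dot_le _ n) dctrl dmom).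
apply: is_diff_eq dham _; apply: funext => w.
rewrite -[LHS]/(2^-1 * (dot ((dot p e *: 'd a y w) *m K y + momentum y p *m 'd K y w) (momentum y p)
  + dot (control y p) (dot p e *: 'd a y w))).
rewrite dotDl dot_control_sym// (dotC _ (momentum y p *m K y)) -/(control y p) dotZr.
by field.
Qed.

Lemma C11_frame_ham (r : R) :
  C11 (cube y0 rho `*` [set p | `|p| <= r]) (fun z => frame_ham z.1 z.2).
Proof.
set A := (X in C11 X).
have fst_C11 (V : normedModType R) (f : 'rV[R]_d -> V) : C11 (cube y0 rho) f -> C11 A (f \o fst).
  apply: C11_bounded_linear => [z|z|z []//]; first exact: cvg_fst.
  exact: norm_fst_le.
have snd_C11 : C11 A snd.
  apply: (@C11_bounded_linear _ _ _ _ snd [set p | `|p| <= r] _ idfun) => [z|z|z []//|].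
  - exact: cvg_snd.
  - exact: norm_snd_le.
  - by apply: (@C11_id _ _ _ r).
have dot_C11 := C11_op (ler0n _ d) (@norm_dot_le _ d) snd_C11 (C11_cst A e).
have mom_C11 : C11 A (fun z => momentum z.1 z.2).
  have lin_C11 := C11_op (ler0n _ d) (@norm_mulmx_le _ 1 d n) snd_C11 (C11_cst A b^T).
  exact: C11D lin_C11 (C11_op ler01 (@norm_scale_le _ _) dot_C11 (fst_C11 _ _ (drift_C11 F))).
have ctrl_C11 : C11 A (fun z => control z.1 z.2).
  have K_C11 := fst_C11 _ _ (cometric_C11 F).
  have ctrl := C11_op (ler0n _ n) (@norm_mulmx_le _ 1 n n) mom_C11 K_C11.
  exact: ctrl.
have ham_C11 := C11_op (ler0n _ n) (@norm_dot_le _ n) ctrl_C11 mom_C11.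
have := C11_op ler01 (@norm_scale_le _ _) (C11_cst A (2^-1 : R)) ham_C11; exact.
Qed.

End frame_hamiltonian.

Section rescaling.
Context {R : realType} {n d : nat} {y0 : 'rV[R]_d} {rho : R}.
Variable F : adapted_frame n y0 rho.
Local Notation b := (basis F).
Local Notation e := (transversal F).
Local Notation bs := (dual_basis F).
Local Notation es := (dual_transversal F).
Local Notation a := (drift F).
Local Notation K := (cometric F).

Definition metric0 : 'M[R]_n := invmx (K y0).

Definition frame_jacobian : 'M[R]_n := b *m lin1_mx ('d a y0).

Definition frame_curvature : 'M[R]_n := (frame_jacobian - frame_jacobian^T) *m K y0.

Local Notation B := frame_jacobian.
Local Notation J := frame_curvature.
Local Notation g0 := metric0.

Lemma mul_frame_jacobian (X : 'rV[R]_n) : X *m B = 'd a y0 (X *m b).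
Proof. by rewrite mulmxA mul_rV_lin1. Qed.

(* The state [((X, U), (Z, mu))] encodes the point [y0 + eta ^ 2 (X b + eta Z e)] with
   multiplier [s + eta mu] and control [eta ^ 2 (U + O(eta))]. *)
Section at_scale.
Variables (eta s : R) (x : ('rV[R]_n * 'rV[R]_n) * (R * R)).
Local Notation X := x.1.1.
Local Notation U := x.1.2.
Local Notation Z := x.2.1.
Local Notation mu := x.2.2.

Definition unscaled_offset : 'rV[R]_d := X *m b + (eta * Z) *: e.
Definition unscaled_point : 'rV[R]_d := y0 + eta ^+ 2 *: unscaled_offset.
Definition unscaled_multiplier : R := s + eta * mu.
Definition transverse_momentum : 'rV[R]_n := U *m g0 - s *: (X *m B).
Definition unscaled_covector : 'rV[R]_d :=
  unscaled_multiplier *: es + eta ^+ 2 *: (transverse_momentum *m bs).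

Definition drift_remainder : 'rV[R]_n :=
  taylor_quotient a y0 eta unscaled_offset + Z *: 'd a y0 e.
Definition cometric_remainder : 'M[R]_n := increment_quotient K y0 eta unscaled_offset.
Definition scaled_drift : 'rV[R]_n := X *m B + eta *: drift_remainder.
Definition scaled_momentum : 'rV[R]_n :=
  transverse_momentum + unscaled_multiplier *: scaled_drift.

Definition position_force : 'rV[R]_n :=
  (mu *: (X *m B) + unscaled_multiplier *: drift_remainder) *m K y0 +
  scaled_momentum *m cometric_remainder.
Definition scaled_control : 'rV[R]_n := U + eta *: position_force.

Definition cometric_force (w : 'rV[R]_d) : R :=
  dot (scaled_momentum *m 'd K unscaled_point w) scaled_momentum.
Definition drift_diff_remainder (w : 'rV[R]_d) : 'rV[R]_n :=
  diff_increment_quotient a y0 eta w unscaled_offset.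
Definition transverse_force : 'rV[R]_n :=
  mu *: (scaled_control *m B^T) +
  \row_j (eta / 2 * cometric_force (row j b) +
          unscaled_multiplier * dot scaled_control (drift_diff_remainder (row j b))).

Definition velocity_force : 'rV[R]_n :=
  s *: (position_force *m J) - transverse_force *m K y0.
Definition height_force : R := dot scaled_control scaled_drift.
Definition multiplier_force : R :=
  - (eta ^+ 2 / 2 * cometric_force e + unscaled_multiplier * dot
      scaled_control ('d a unscaled_point e)).

Definition perturbation : ('rV[R]_n * 'rV[R]_n) * (R * R) :=
  ((position_force, velocity_force), (height_force, multiplier_force)).

Definition area_rate : R := dot U (X *m B).

Definition height_remainder : R :=
  dot position_force scaled_drift + dot U drift_remainder.

Lemma height_forceE : height_force = area_rate + eta * height_remainder.
Proof.
rewrite /height_force {1}/scaled_control dotDl dotZl {1}/scaled_drift dotDr dotZr.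
by rewrite /height_remainder /area_rate mulrDr -addrA [X in _ + X]addrC.
Qed.

Hypothesis eta_neq0 : eta != 0.

Lemma covector_transversal : dot unscaled_covector e = unscaled_multiplier.
Proof.
rewrite /dot /unscaled_covector mulmxDl -!scalemxAl -mulmxA.
by rewrite dual_transversalK dual_basis_transversal mulmx0 !mxE mulr1 mulr0 addr0.
Qed.

Lemma covector_basis : unscaled_covector *m b^T = eta ^+ 2 *: transverse_momentum.
Proof.
rewrite /unscaled_covector mulmxDl -!scalemxAl -mulmxA.
by rewrite dual_basisK dual_transversal_basis scaler0 add0r mulmx1.
Qed.

Lemma drift_unscaled : a unscaled_point = eta ^+ 2 *: scaled_drift.
Proof.
have jac : 'd a y0 (eta ^+ 2 *: unscaled_offset) =
    eta ^+ 2 *: (X *m B) + (eta ^+ 2 * (eta * Z)) *: 'd a y0 e.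
  by rewrite linearZ linearD linearZ -mul_frame_jacobian /= scalerDr scalerA.
rewrite /scaled_drift scalerDr scalerA /drift_remainder (scalerDr (eta ^+ 2 * eta)).
rewrite /taylor_quotient drift0 subr0 jac !scalerA (_ : eta ^+ 2 * eta * eta ^- 3 = 1) ?scale1r;
  last by field.
rewrite [X in _ + X](_ : _ = a unscaled_point - eta ^+ 2 *: (X *m B)); first by rewrite addrC subrK.
by rewrite opprD addrA mulrA subrK.
Qed.

Lemma momentum_unscaled : momentum F unscaled_point unscaled_covector = eta ^+ 2 *: scaled_momentum.
Proof.
rewrite /momentum /scaled_momentum covector_basis covector_transversal drift_unscaled.
by rewrite (scalerDr _ transverse_momentum) !scalerA (mulrC _ (eta ^+ 2)).
Qed.

Lemma control_unscaled : control F unscaled_point unscaled_covector = eta ^+ 2 *: scaled_control.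
Proof.
rewrite /control momentum_unscaled -scalemxAl; congr (_ *: _).
have -> : K unscaled_point = K y0 + eta *: cometric_remainder.
  by rewrite /cometric_remainder /increment_quotient scalerA mulfV// scale1r addrC subrK.
rewrite mulmxDr -scalemxAr /scaled_control /position_force scalerDr addrA; congr (_ + _).
have -> : scaled_momentum =
    U *m g0 + eta *: (mu *: (X *m B) + unscaled_multiplier *: drift_remainder).
  rewrite /scaled_momentum /transverse_momentum /scaled_drift -addrA; congr (_ + _).
  rewrite (scalerDr unscaled_multiplier) {1}/unscaled_multiplier scalerDl -(addrA (s *: _)) addKr.
  by rewrite (scalerDr eta (mu *: _)) !scalerA (mulrC eta unscaled_multiplier).
by rewrite mulmxDl -mulmxA mulVmx ?cometric_unit// mulmx1 -scalemxAl.
Qed.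

Lemma frame_velocity_unscaled : frame_velocity F unscaled_point unscaled_covector =
  eta ^+ 2 *: (scaled_control *m b + (eta ^+ 2 * height_force) *: e).
Proof.
rewrite /frame_velocity control_unscaled drift_unscaled -scalemxAl dotZl dotZr scalerDr.
by rewrite !scalerA mulrA.
Qed.

Lemma diff_frame_ham_unscaled w :
  2^-1 * dot (momentum F unscaled_point unscaled_covector *m 'd K unscaled_point w)
      (momentum F unscaled_point unscaled_covector) +
    dot unscaled_covector e * dot (control F unscaled_point
      unscaled_covector) ('d a unscaled_point w) =
  eta ^+ 2 * (eta ^+ 2 / 2 * cometric_force w +
    unscaled_multiplier * dot scaled_control ('d a unscaled_point w)).
Proof.
rewrite momentum_unscaled control_unscaled covector_transversal -scalemxAl !dotZl dotZr.
by rewrite /cometric_force; ring.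
Qed.

Lemma diff_drift_unscaled w :
  'd a unscaled_point w = 'd a y0 w + eta *: drift_diff_remainder w.
Proof.
by rewrite /drift_diff_remainder /diff_increment_quotient scalerA mulfV// scale1r addrC subrK.
Qed.

(* [s U J + eta velocity_force = s V J - eta W K0] for the control [V] and [W] the transverse
   force, and [J g0 = B - B^T]. *)
Lemma transverse_momentum_derive :
  (s *: (U *m J) + eta *: velocity_force) *m g0 - s *: (scaled_control *m B) =
  - (s *: (scaled_control *m B^T) + eta *: transverse_force).
Proof.
have K0g0 : K y0 *m g0 = 1%:M by rewrite mulmxV// cometric_unit.
have -> : s *: (U *m J) + eta *: velocity_force =
    s *: (scaled_control *m J) - eta *: (transverse_force *m K y0).
  rewrite /velocity_force scalerBr addrA; congr (_ - _).
  by rewrite /scaled_control (mulmxDl U) scalerDr -scalemxAl !scalerA (mulrC eta).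
rewrite mulmxBl -!scalemxAl -!mulmxA K0g0 !mulmx1 mulmxBr scalerBr addrAC -addrA.
by rewrite addrACA subrr add0r opprD.
Qed.

Lemma transverse_force_entry j :
  (eta ^+ 2 *: (s *: (scaled_control *m B^T) + eta *: transverse_force)) 0 j =
  eta ^+ 2 * (eta ^+ 2 / 2 * cometric_force (row j b) +
    unscaled_multiplier * dot scaled_control ('d a unscaled_point (row j b))).
Proof.
have -> : 'd a unscaled_point (row j b) = row j B + eta *: drift_diff_remainder (row j b).
  by rewrite diff_drift_unscaled /frame_jacobian row_mul mul_rV_lin1.
have -> : transverse_force = mu *: (scaled_control *m B^T) +
    \row_k (eta / 2 * cometric_force (row k b) +
            unscaled_multiplier * dot scaled_control (drift_diff_remainder (row k b))) by [].
rewrite dotDr dotZr.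
have -> : dot scaled_control (row j B) = (scaled_control *m B^T) 0 j.
  by rewrite rowE -[RHS]dot_delta dot_mulmx trmxK.
rewrite /unscaled_multiplier.
move: (scaled_control *m B^T) cometric_force (dot scaled_control)
  drift_diff_remainder => VBt ck cd rk.
by rewrite !mxE; ring.
Qed.

End at_scale.

Lemma covector_expansion (v : 'rV[R]_d) : v = dot v e *: es + (v *m b^T) *m bs.
Proof.
rewrite -[LHS]mulmx1 -(frame_resolution F) mulmxDr mulmxA mulmxA; congr (_ + _).
by rewrite -mul_scalar_mx; congr (_ *m _); apply/matrixP => i j; rewrite !ord1 !mxE /dot mxE mulr1n.
Qed.

Theorem rescaled_hamiltonian_curve (eta s : R) (x : R -> ('rV[R]_n * 'rV[R]_n) * (R * R)) :
  eta != 0 ->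
  (forall t : R, 0 <= t <= 1 -> cube y0 rho (unscaled_point eta (x t))) ->
  (forall t : R, 0 <= t <= 1 -> is_derive t 1 x
    ((scaled_control eta s (x t),
      s *: ((x t).1.2 *m J) + eta *: velocity_force eta s (x t)),
     (eta * height_force eta s (x t), eta * multiplier_force eta s (x t)))) ->
  hamiltonian_curve (frame_ham F) (fun t => unscaled_point eta (x t))
    (fun t => unscaled_covector eta s (x t)).
Proof.
move=> eta0 in_cube dx t t01; have := dx t t01; set dxt := (X in is_derive _ _ _ X) => dxt'.
have At := in_cube t t01.
have [dX dU] : is_derive t 1 (fun r => (x r).1.1) dxt.1.1 /\ is_derive t 1
  (fun r => (x r).1.2) dxt.1.2.
  by split; [exact: is_derive_fst (is_derive_fst dxt')|exact: is_derive_snd (is_derive_fst dxt')].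
have [dZ dmu] : is_derive t 1 (fun r => (x r).2.1) dxt.2.1 /\ is_derive t 1
  (fun r => (x r).2.2) dxt.2.2.
  by split; [exact: is_derive_fst (is_derive_snd dxt')|exact: is_derive_snd (is_derive_snd dxt')].
split.
  rewrite grad_frame_ham// frame_velocity_unscaled//.
  have doffset := is_deriveD (is_derive_mulmxl b dX) (is_derive_scalel e (is_derive_cmul eta dZ)).
  apply: is_derive_eq (is_deriveD (is_derive_cst y0 t 1) (is_deriveZ (eta ^+ 2) doffset)) _.
  by rewrite add0r /= mulrA.
have dPi := is_deriveB (is_derive_mulmxl g0 dU) (is_deriveZ s (is_derive_mulmxl B dX)).
have dlam := is_deriveD (is_derive_cst s t 1) (is_derive_cmul eta dmu).
have dp := is_deriveD (is_derive_scalel es dlam) (is_deriveZ (eta ^+ 2) (is_derive_mulmxl bs dPi)).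
apply: is_derive_eq dp _; have [dH dHE] := is_diff_frame_ham F (unscaled_covector eta s (x t)) At.
have gradE w := etrans (esym (diff_grad w dH)) (congr1 (fun f => f w) dHE).
rewrite [RHS]covector_expansion dotNl mulNmx gradE diff_frame_ham_unscaled//; congr (_ + _).
  by congr (_ *: _); rewrite add0r /= /multiplier_force; ring.
rewrite /dxt /= transverse_momentum_derive// (scalemxAl (eta ^+ 2)); congr (_ *m _).
rewrite scalerN; congr (- _); apply/rowP => j.
rewrite -[RHS]dot_delta dot_mulmx trmxK -rowE gradE diff_frame_ham_unscaled//.
by rewrite transverse_force_entry.
Qed.

End rescaling.

Section force_regularity.
Context {R : realType} {n d : nat} {y0 : 'rV[R]_d} {rho : R}.
Variable F : adapted_frame n y0 rho.
Variables (Th : parameter_space (R := R)) (eta sg : Th -> R) (M : R).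
Variable x : R -> Th -> ('rV[R]_n * 'rV[R]_n) * (R * R).
Hypotheses (M_ge0 : 0 <= M) (eta_gt0 : forall th, pdom th -> 0 < eta th).
Hypotheses (eta_le1 : forall th, pdom th -> eta th <= 1)
  (eta_small : forall th, pdom th -> eta th ^+ 2 * M <= rho).
Hypothesis eta_local : forall th th' e, pclose th th' e -> eta th = eta th'.
Hypotheses (sg_ulip : ulip (fun _ => sg)) (x_ulip : ulip x).
Hypothesis offset_bounded : forall (t : R) th, 0 <= t <= 1 -> pdom th ->
  `|unscaled_offset F (eta th) (x t th)| < M.
Local Notation b := (basis F).
Local Notation e := (transversal F).
Local Notation a := (drift F).
Local Notation K := (cometric F).
Local Notation offset t th := (unscaled_offset F (eta th) (x t th)).

Let X_ulip := ulip_fst (ulip_fst x_ulip).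
Let U_ulip := ulip_snd (ulip_fst x_ulip).
Let Z_ulip := ulip_fst (ulip_snd x_ulip).
Let mu_ulip := ulip_snd (ulip_snd x_ulip).

Lemma ulip_eta : ulip (fun (_ : R) th => eta th).
Proof.
apply: (@ulip_intro _ _ _ _ 1 0) => // [th _ t _|t th _ Dth|t th th' e' _ _ _ /eta_local ->].
- exact: cst_continuous.
- by rewrite ger0_norm ?eta_le1// ltW// eta_gt0.
- by rewrite subrr normr0 mul0r.
Qed.

Lemma ulip_unscaled_offset : ulip (fun t th => offset t th).
Proof.
apply: ulipD; first by apply: ulip_mulmx => //; exact: ulip_cst.
by apply: ulip_scale; [apply: ulipM => //; exact: ulip_eta|exact: ulip_cst].
Qed.

Let offset_nbhs (t : R) th : 0 <= t <= 1 -> pdom th -> nbhs (offset t th) [set y | `|y| <= M].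
Proof.
move=> t01 Dth; have lt_M := offset_bounded t01 Dth.
apply/nbhs_ballP; exists (M - `|offset t th|); first by rewrite /= subr_gt0.
move=> z; rewrite -ball_normE/= ltrBrDr => zM.
by rewrite -[z](subrK (offset t th)) (le_trans (ler_normD _ _))// distrC ltW.
Qed.

Let in_cube th y : pdom th -> `|y| <= M -> cube y0 rho (y0 + eta th ^+ 2 *: y).
Proof.
move=> Dth yM; rewrite /cube/= addrAC subrr add0r normrZ.
have eta0 := ltW (eta_gt0 Dth); rewrite ger0_norm ?exprn_ge0//.
by rewrite (le_trans _ (eta_small Dth))// ler_wpM2l// exprn_ge0.
Qed.

Let A_y0 : (exists th : Th, pdom th) -> cube y0 rho y0.
Proof.
move=> [th Dth]; have := @in_cube th 0 Dth; rewrite scaler0 addr0; apply.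
by rewrite normr0.
Qed.

Let ulip_offset_comp (V : normedModType R) (g : Th -> 'rV[R]_d -> V) (L : R) : 0 <= L ->
  (forall th, pdom th -> L.-lipschitz_[set y | `|y| <= M] (g th)) ->
  (forall th, pdom th -> g th 0 = 0) -> (forall th th' e, pclose th th' e -> g th = g th') ->
  ulip (fun t th => g th (offset t th)).
Proof.
move=> L0 gL g0 gloc; apply: (ulip_superposition L0 gL) => //; last exact: ulip_unscaled_offset.
- by exists 0 => // th /g0 ->; rewrite normr0.
- by rewrite /= normr0.
Qed.

Lemma ulip_drift_remainder : ulip (fun t th => drift_remainder F (eta th) (x t th)).
Proof.
have [C C0 HC] := drift_C11 F.
apply: ulipD; last by apply: ulip_scale => //; exact: ulip_cst.
apply: (@ulip_offset_comp _ (fun th => taylor_quotient a y0 (eta th)) (C * (3 * M))).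
- by rewrite !mulr_ge0.
- move=> th Dth; apply: (klipschitz_taylor_quotient HC) => //; rewrite ?eta_gt0 ?eta_le1//.
    by apply: A_y0; exists th.
  by move=> y; exact: in_cube.
- by move=> th _; exact: taylor_quotient0.
- by move=> th th' e' /eta_local ->.
Qed.

Lemma ulip_cometric_remainder : ulip (fun t th => cometric_remainder F (eta th) (x t th)).
Proof.
have [C C0 HC] := cometric_C11 F.
apply: (@ulip_offset_comp _ (fun th => increment_quotient K y0 (eta th)) C) => //.
- by move=> th Dth; apply: (klipschitz_increment_quotient HC);
    rewrite ?eta_gt0 ?eta_le1// => y; exact: in_cube.
- by move=> th _; exact: increment_quotient0.
- by move=> th th' e' /eta_local ->.
Qed.

Let ulip_diff_increment_quotient (V : normedModType R) (G : 'rV[R]_d ->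
  V) w : C11 (cube y0 rho) G ->
  ulip (fun t th => diff_increment_quotient G y0 (eta th) w (offset t th)).
Proof.
move=> [C C0 HC]; apply: (@ulip_offset_comp _ (fun th => diff_increment_quotient G
  y0 (eta th) w) (C * `|w|)).
- by rewrite mulr_ge0.
- by move=> th Dth; apply: (klipschitz_diff_increment_quotient HC);
    rewrite ?eta_gt0 ?eta_le1// => y; exact: in_cube.
- by move=> th _; exact: diff_increment_quotient0.
- by move=> th th' e' /eta_local ->.
Qed.

Let ulip_diff_unscaled (V : normedModType R) (G : 'rV[R]_d -> V) w : C11 (cube y0 rho) G ->
  ulip (fun t th => 'd G (unscaled_point F (eta th) (x t th)) w).
Proof.
move=> HG; have Hq := ulip_diff_increment_quotient w HG.
apply: eq_ulip (ulipD (ulip_cst _ ('d G y0 w)) (ulip_scale ulip_eta Hq)) => t th Dth.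
by rewrite /diff_increment_quotient scalerA mulfV ?scale1r ?gt_eqF ?eta_gt0// addrC subrK.
Qed.

Lemma ulip_unscaled_multiplier : ulip (fun t th => unscaled_multiplier (eta th) (sg th) (x t th)).
Proof. by apply: ulipD => //; apply: ulipM => //; exact: ulip_eta. Qed.

Let ulip_XB : ulip (fun t th => (x t th).1.1 *m frame_jacobian F).
Proof. by apply: ulip_mulmx => //; exact: ulip_cst. Qed.

Lemma ulip_scaled_drift : ulip (fun t th => scaled_drift F (eta th) (x t th)).
Proof. by apply: ulipD => //; apply: ulip_scale; [exact: ulip_eta|exact: ulip_drift_remainder]. Qed.

Lemma ulip_scaled_momentum : ulip (fun t th => scaled_momentum F (eta th) (sg th) (x t th)).
Proof.
apply: ulipD; last by apply: ulip_scale; [exact: ulip_unscaled_multiplier|exact: ulip_scaled_drift].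
apply: ulipB; first by apply: ulip_mulmx => //; exact: ulip_cst.
exact: ulip_scale.
Qed.

Lemma ulip_position_force : ulip (fun t th => position_force F (eta th) (sg th) (x t th)).
Proof.
apply: ulipD; last by apply: ulip_mulmx; [exact:
  ulip_scaled_momentum|exact: ulip_cometric_remainder].
apply: ulip_mulmx; last exact: ulip_cst.
apply: ulipD; first exact: ulip_scale.
by apply: ulip_scale; [exact: ulip_unscaled_multiplier|exact: ulip_drift_remainder].
Qed.

Lemma ulip_scaled_control : ulip (fun t th => scaled_control F (eta th) (sg th) (x t th)).
Proof. by apply: ulipD => //; apply: ulip_scale; [exact: ulip_eta|exact: ulip_position_force]. Qed.

Let ulip_cometric_force w : ulip (fun t th => cometric_force F (eta th) (sg th) (x t th) w).
Proof.
have HP := ulip_scaled_momentum; apply: ulip_dot => //; apply: ulip_mulmx => //.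
exact: ulip_diff_unscaled (cometric_C11 F).
Qed.

Lemma ulip_transverse_force : ulip (fun t th => transverse_force F (eta th) (sg th) (x t th)).
Proof.
apply: ulipD.
  by apply: ulip_scale => //; apply: ulip_mulmx; [exact: ulip_scaled_control|exact: ulip_cst].
apply: ulip_matrix => i j.
apply: (@eq_ulip _ _ _ (fun t th => eta th / 2 * cometric_force F (eta th)
  (sg th) (x t th) (row j b) +
  unscaled_multiplier (eta th) (sg th) (x t th) *
  dot (scaled_control F (eta th) (sg th) (x t th))
    (drift_diff_remainder F (eta th) (x t th) (row j b)))).
  by move=> t th _; rewrite mxE.
apply: ulipD.
  by apply: ulipM; [apply: ulipM; [exact: ulip_eta|exact: ulip_cst]|exact: ulip_cometric_force].
apply: ulipM; first exact: ulip_unscaled_multiplier.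
by apply: ulip_dot; [exact: ulip_scaled_control|exact: ulip_diff_increment_quotient (drift_C11 F)].
Qed.

Lemma ulip_velocity_force : ulip (fun t th => velocity_force F (eta th) (sg th) (x t th)).
Proof.
apply: ulipB.
  by apply: ulip_scale => //; apply: ulip_mulmx; [exact: ulip_position_force|exact: ulip_cst].
by apply: ulip_mulmx; [exact: ulip_transverse_force|exact: ulip_cst].
Qed.

Lemma ulip_multiplier_force : ulip (fun t th => multiplier_force F (eta th) (sg th) (x t th)).
Proof.
apply: ulipN; apply: ulipD.
  apply: ulipM; last exact: ulip_cometric_force.
  by apply: ulipM; [apply: ulipM; exact: ulip_eta|exact: ulip_cst].
apply: ulipM; first exact: ulip_unscaled_multiplier.
by apply: ulip_dot; [exact: ulip_scaled_control|exact: ulip_diff_unscaled (drift_C11 F)].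
Qed.

Lemma ulip_perturbation : ulip (fun t th => perturbation F (eta th) (sg th) (x t th)).
Proof.
apply: ulip_pair; apply: ulip_pair.
- exact: ulip_position_force.
- exact: ulip_velocity_force.
- by apply: ulip_dot; [exact: ulip_scaled_control|exact: ulip_scaled_drift].
- exact: ulip_multiplier_force.
Qed.

Lemma ulip_height_remainder :
  ulip (fun t th => height_remainder F (eta th) (sg th) (x t th)).
Proof.
apply: ulipD; apply: ulip_dot => //.
- exact: ulip_position_force.
- exact: ulip_scaled_drift.
- exact: ulip_drift_remainder.
Qed.

End force_regularity.

(** * Shooting *)

Section right_neighborhoods.
Context {R : realType}.

Lemma near_scale_small (C e : R) : 0 < e -> \forall eta \near 0^'+, eta * C <= e.
Proof.
move=> e0; have [C0|C0] := leP C 0.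
  by near=> eta; rewrite (le_trans _ (ltW e0))// mulr_ge0_le0// ltW//;
    near: eta; exact: nbhs_right_gt.
near=> eta; rewrite -ler_pdivlMr//; near: eta; apply: nbhs_right_le; exact: divr_gt0.
Unshelve. all: end_near.
Qed.

Lemma near_right_segment (P : R -> Prop) : (\forall u \near 0^'+, P u) ->
  \forall u \near 0^'+, forall v, 0 < v <= u -> P v.
Proof.
move=> [e /= e0 He]; have := nbhs_right_lt e0; apply: filterS => u ue v /andP[v0 vu].
by apply: He => //=; rewrite sub0r normrN gtr0_norm// (le_lt_trans vu).
Qed.

End right_neighborhoods.

Section self_consistent_forcing.
Context {R : realType} {V : completeNormedModType R}.
Implicit Types (f : R -> V) (s t eta : R).

Record forced_parameter := ForcedParameter {
  scale : R;
  multiplier : R;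
  forcing : R -> V
}.

Definition admissible_forcing f := {in `[0, 1], continuous f} /\ forall t, `|f t| <= 1.

Definition forced_dom (eta0 s1 s2 : R) : set forced_parameter := [set th |
  [/\ 0 < scale th <= eta0, s1 <= multiplier th <= s2 & admissible_forcing (forcing th)]].

Definition forced_close th th' (delta : R) := [/\ scale th = scale th',
  `|multiplier th - multiplier th'| <= delta & forall t, `|forcing th t - forcing th' t| <= delta].

Lemma forced_close_ge0 th th' delta : forced_close th th' delta -> 0 <= delta.
Proof. by move=> [_ /(le_trans (normr_ge0 _))]. Qed.

Definition forced_space (eta0 s1 s2 : R) : parameter_space :=
  ParameterSpace (forced_dom eta0 s1 s2) forced_close_ge0.

Lemma admissible_forcing0 : admissible_forcing (fun=> 0).
Proof. by split=> [t _|t]; [exact: cst_continuous|rewrite normr0]. Qed.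

Lemma uniformly_closed_admissible : uniformly_closed admissible_forcing.
Proof.
move=> F f adm F_cvg; split=> [t t01|t].
  apply/cvgrPdist_le => e e0; have e30 : 0 < e / 3 by rewrite divr_gt0.
  have [m /(_ m _ (leqnn m)) Fm] := F_cvg _ e30.
  have [/(_ t t01)/cvgrPdist_le/(_ _ e30) near_F _] := adm m.
  apply: filterS near_F => r Fmr; rewrite -(subrKA (F m t)) (le_trans (ler_normD _ _))//.
  rewrite [leRHS](_ : e = e / 3 + (e / 3 + e / 3)); last by field.
  rewrite lerD//; first by rewrite distrC.
  by rewrite -(subrKA (F m r)) (le_trans (ler_normD _ _))// lerD.
apply/ler_addgt0Pr => e /F_cvg[m /(_ m t (leqnn m)) Fm].
rewrite -[f t](subrK (F m t)) addrC (le_trans (ler_normD _ _))// lerD//; last by rewrite distrC.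
by have [_] := adm m.
Qed.

Section parameter_space_families.
Variables (eta0 s1 s2 : R).

Lemma ulip_multiplier : ulip (fun (_ : R) (th : forced_space eta0 s1 s2) => multiplier th).
Proof.
apply: (@ulip_intro _ _ _ _ (`|s1| + `|s2|) 1) => //.
- by move=> th Dth t t01; exact: cst_continuous.
- move=> t th _ [_ /andP[sl su] _]; rewrite ler_norml.
  move: (ler_norm s2) (ler_norm (- s1)) (normr_ge0 s1) (normr_ge0 s2); rewrite normrN => *; lra.
- by move=> t th th' e _ _ _ [_ ss' _]; rewrite mul1r.
Qed.

Lemma ulip_forcing : ulip (fun t (th : forced_space eta0 s1 s2) => forcing th t).
Proof.
apply: (@ulip_intro _ _ _ _ 1 1) => //.
- by move=> th [_ _ []].
- by move=> t th _ [_ _ []].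
- by move=> t th th' e _ _ _ [_ _ ff']; rewrite mul1r.
Qed.

Variables (force : R -> forced_space eta0 s1 s2 -> V) (C : R).
Hypothesis force_continuous : forall th, pdom th -> {in `[0, 1], continuous (force ^~ th)}.
Hypothesis force_lipschitz : forall t th, 0 <= t <= 1 -> pdom th -> `|force t th| <= C /\
  forall th' delta, pdom th' -> pclose th th' delta -> `|force t th - force t th'| <= C * delta.
Variable eta : R.
Hypotheses (eta_gt0 : 0 < eta) (eta_le : eta <= eta0) (eta_small : eta * C <= 2^-1).

Definition self_consistent s f :=
  admissible_forcing f /\ f = fun t => eta *: force (clamp 0 1 t) (ForcedParameter eta s f).

Lemma forced_domE s f : s1 <= s <= s2 -> admissible_forcing f ->
  forced_dom eta0 s1 s2 (ForcedParameter eta s f).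
Proof. by move=> sb adm; split; rewrite //= eta_gt0. Qed.

Let clamp01 t : 0 <= clamp 0 1 t <= 1. Proof. exact: clamp_itv. Qed.

Lemma forcing_small s f t : s1 <= s <= s2 -> self_consistent s f -> `|f t| <= eta * C.
Proof.
move=> sb [adm ->]; rewrite normrZ (gtr0_norm eta_gt0) ler_wpM2l ?(ltW eta_gt0)//.
by have [] := force_lipschitz (clamp01 t) (forced_domE sb adm).
Qed.

Let force_dist s s' f f' (delta : R) t : s1 <= s <= s2 -> s1 <= s' <= s2 ->
  admissible_forcing f -> admissible_forcing f' -> `|s - s'| <= delta ->
  (forall t, `|f t - f' t| <= delta) ->
  `|eta *: force (clamp 0 1 t) (ForcedParameter eta s f) -
    eta *: force (clamp 0 1 t) (ForcedParameter eta s' f')| <= 2^-1 * delta.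
Proof.
move=> sb sb' adm adm' ss' ff'; have delta0 : 0 <= delta := le_trans (normr_ge0 _) ss'.
have [_ lip] := force_lipschitz (clamp01 t) (forced_domE sb adm).
rewrite -scalerBr normrZ (gtr0_norm eta_gt0) (le_trans _ (ler_wpM2r delta0 eta_small))// -mulrA.
by rewrite ler_wpM2l ?(ltW eta_gt0)//; apply: lip => //; exact: forced_domE.
Qed.

Lemma self_consistent_exists s : s1 <= s <= s2 -> exists f, self_consistent s f.
Proof.
move=> sb; pose Phi f t := eta *: force (clamp 0 1 t) (ForcedParameter eta s f).
suff [f adm fE] : exists2 f, admissible_forcing f & Phi f = f by exists f; split=> //; exact: esym.
apply: (contraction_fixpoint (k := 2^-1) (B := 1) _ _ admissible_forcing0 _ _ _
  uniformly_closed_admissible).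
- by rewrite invr_ge0.
- by rewrite invf_lt1// ltr1n.
- move=> f adm; have D := forced_domE sb adm; split=> [t t01|t].
    apply: (continuous_bounded_bilinear (@norm_scale_le _ _)); first exact: cst_continuous.
    exact: (continuous_clamp (ler01 : 0 <= 1 :> R) (force_continuous D)).
  rewrite /Phi normrZ (gtr0_norm eta_gt0).
  have [Fb _] := force_lipschitz (clamp01 t) D.
  rewrite (le_trans (ler_wpM2l (ltW eta_gt0) Fb))// (le_trans eta_small)//.
  by rewrite invf_le1// ler1n.
- by move=> f [].
- move=> f g delta admf admg fg t; apply: force_dist => //.
  by rewrite subrr normr0; exact: le_trans (fg 0).
Qed.

Lemma self_consistent_lipschitz s s' f f' : s1 <= s <= s2 -> s1 <= s' <= s2 ->
  self_consistent s f -> self_consistent s' f' -> forall t, `|f t - f' t| <= `|s - s'|.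
Proof.
move=> sb sb' [adm fE] [adm' fE'] t.
have := @fixpoint_dist _ _ _ f f' 2^-1 (2^-1 * `|s - s'|) 2.
rewrite (_ : _ / (1 - 2^-1) = `|s - s'|); last by field.
apply=> [|r|delta ff' r]; first by rewrite invf_lt1// ltr1n.
  by rewrite mulr2n (le_trans (ler_normB _ _))// lerD//; [case: adm|case: adm'].
have delta0 : 0 <= delta := le_trans (normr_ge0 _) (ff' 0).
rewrite -mulrDr {1}fE fE'; apply: force_dist => // [|r']; first by rewrite lerDr.
by rewrite (le_trans (ff' r'))// lerDl.
Qed.

End parameter_space_families.

End self_consistent_forcing.

Section shooting.
Context {R : realType} {n d : nat} {y0 : 'rV[R]_d} {rho : R}.
Variables (F : adapted_frame n y0 rho) (alf : 'I_n -> R) (xi : 'rV[R]_n) (s1 s2 m : R).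
Hypotheses (rho_gt0 : 0 < rho) (alf_gt0 : forall i, 0 < alf i).
Hypothesis curvature_sqr :
  frame_curvature F *m frame_curvature F = - diagf alf (fun x => x ^+ 2).
Hypotheses (s1_gt0 : 0 < s1) (s12 : s1 <= s2) (m_gt0 : 0 < m).
Hypothesis nonresonant : forall s i, s1 <= s <= s2 -> m <= 2 - 2 * cos (s * alf i).
Local Notation J := (frame_curvature F).
Local Notation state := (('rV[R]_n * 'rV[R]_n) * (R * R))%type.
Implicit Types (s t eta : R) (f : R -> state).

Definition trajectory s f t : state :=
  ((linear_position J alf s xi (fun r => (f r).1.1) (fun r => (f r).1.2) t,
    linear_velocity J alf s xi (fun r => (f r).1.1) (fun r => (f r).1.2) t),
   (primitive (fun r => (f r).2.1) t, primitive (fun r => (f r).2.2) t)).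

Definition start_velocity s f : 'rV[R]_n :=
  initial_velocity J alf s xi (fun r => (f r).1.1) (fun r => (f r).1.2).

(* The height reached by the unperturbed trajectory, to be adjusted through the multiplier. *)
Definition enclosed_area s : R := primitive (fun t => area_rate F (trajectory s (fun=> 0) t)) 1.

Section uniform_families.
Variable eta0 : R.
Local Notation Th := (forced_space (V := state) eta0 s1 s2).

Let fX_ulip := ulip_fst (ulip_fst (ulip_forcing (V := state) eta0 s1 s2)).
Let fU_ulip := ulip_snd (ulip_fst (ulip_forcing (V := state) eta0 s1 s2)).
Let sg_ulip := ulip_multiplier (V := state) eta0 s1 s2.

Let sg_ge (th : Th) : pdom th -> s1 <= multiplier th. Proof. by move=> [_ /andP[]]. Qed.

Let sg_nonresonant (th : Th) : pdom th -> forall i, m <= 2 - 2 * cos (multiplier th * alf i).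
Proof. by move=> [_ sb _] i; exact: nonresonant. Qed.

Lemma ulip_start_velocity : ulip (fun (_ : R) (th : Th) => start_velocity
  (multiplier th) (forcing th)).
Proof. exact: (ulip_initial_velocity J alf_gt0 xi sg_ulip fX_ulip fU_ulip
  m_gt0 sg_nonresonant). Qed.

Lemma ulip_trajectory : ulip (fun t (th : Th) => trajectory (multiplier th) (forcing th) t).
Proof.
apply: ulip_pair; apply: ulip_pair.
- exact: (ulip_linear_position J alf_gt0 xi sg_ulip fX_ulip fU_ulip s1_gt0
    sg_ge m_gt0 sg_nonresonant).
- exact: (ulip_linear_velocity J alf_gt0 xi sg_ulip fX_ulip fU_ulip m_gt0 sg_nonresonant).
- apply: ulip_primitive; exact: ulip_fst (ulip_snd (ulip_forcing _ _ _)).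
- apply: ulip_primitive; exact: ulip_snd (ulip_snd (ulip_forcing _ _ _)).
Qed.

Lemma ulip_area_rate : ulip (fun t (th : Th) => area_rate F
  (trajectory (multiplier th) (forcing th) t)).
Proof.
have [U_ulip X_ulip] := (ulip_snd (ulip_fst ulip_trajectory), ulip_fst (ulip_fst ulip_trajectory)).
by apply: ulip_dot => //; apply: ulip_mulmx => //; exact: ulip_cst.
Qed.

End uniform_families.

Lemma trajectory_offset_bounded : exists2 M : R, 0 < M &
  forall t (th : forced_space (V := state) 1 s1 s2), 0 <= t <= 1 -> pdom th ->
  `|unscaled_offset F (scale th) (trajectory (multiplier th) (forcing th) t)| < M.
Proof.
have scale_gt0 (th : forced_space (V := state) 1 s1 s2) : pdom th -> 0 < scale th.
  by case=> /andP[].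
have scale_le1 (th : forced_space (V := state) 1 s1 s2) : pdom th -> scale th <= 1.
  by case=> /andP[].
have scale_local (th th' : forced_space (V := state) 1 s1 s2) delta :
    pclose th th' delta -> scale th = scale th' by case.
have [C C0 HC] := ulip_bounded (ulip_unscaled_offset F scale_gt0 scale_le1
  scale_local (ulip_trajectory 1)).
by exists (C + 1) => [|t th t01 Dth]; [rewrite ltr_wpDl|rewrite ltr_pwDr// HC].
Qed.

Section self_consistent_trajectories.
Variables (M eta0 : R).
Hypotheses (M_gt0 : 0 < M) (eta0_le1 : eta0 <= 1) (eta0_small : eta0 ^+ 2 * M <= rho).
Hypothesis offset_bounded : forall t (th : forced_space (V := state) 1 s1 s2),
  0 <= t <= 1 -> pdom th ->
  `|unscaled_offset F (scale th) (trajectory (multiplier th) (forcing th) t)| < M.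
Local Notation Th := (forced_space (V := state) eta0 s1 s2).

Definition trajectory_force t (th : Th) : state :=
  perturbation F (scale th) (multiplier th) (trajectory (multiplier th) (forcing th) t).

Let scale_gt0 (th : Th) : pdom th -> 0 < scale th. Proof. by case=> /andP[]. Qed.

Let scale_le1 (th : Th) : pdom th -> scale th <= 1.
Proof. by case=> /andP[_ scale_le] _ _; exact: le_trans scale_le eta0_le1. Qed.

Let scale_small (th : Th) : pdom th -> scale th ^+ 2 * M <= rho.
Proof.
case=> /andP[scale0 scale_le] _ _; rewrite (le_trans _ eta0_small)// ler_wpM2r ?(ltW M_gt0)//.
by rewrite lerXn2r// nnegrE ltW// (lt_le_trans scale0).
Qed.

Let scale_local (th th' : Th) delta : pclose th th' delta -> scale th = scale th'.
Proof. by case. Qed.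

Let sg_ulip := ulip_multiplier (V := state) eta0 s1 s2.

Lemma trajectory_offset_lt t (th : Th) : 0 <= t <= 1 -> pdom th ->
  `|unscaled_offset F (scale th) (trajectory (multiplier th) (forcing th) t)| < M.
Proof.
move=> t01 Dth; apply: offset_bounded => //; have [scale_eta0 sb adm] := Dth.
by split=> //; rewrite scale_gt0 ?scale_le1.
Qed.

Lemma ulip_trajectory_force : ulip trajectory_force.
Proof.
exact: (ulip_perturbation (ltW M_gt0) scale_gt0 scale_le1 scale_small scale_local sg_ulip
  (ulip_trajectory eta0) trajectory_offset_lt).
Qed.

Lemma ulip_trajectory_height_remainder : ulip (fun t (th : Th) =>
  height_remainder F (scale th) (multiplier th) (trajectory (multiplier th) (forcing th) t)).
Proof.
exact: (ulip_height_remainder (ltW M_gt0) scale_gt0 scale_le1 scale_small scale_local sg_ulip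
  (ulip_trajectory eta0) trajectory_offset_lt).
Qed.

Section at_scale.
Variables (C eta : R).
Hypothesis force_lipschitz : forall t (th : Th), 0 <= t <= 1 -> pdom th ->
  `|trajectory_force t th| <= C /\ forall th' delta, pdom th' -> pclose th th' delta ->
  `|trajectory_force t th - trajectory_force t th'| <= C * delta.
Hypotheses (eta_gt0 : 0 < eta) (eta_le : eta <= eta0) (eta_small : eta * C <= 2^-1).
Local Notation self_consistent := (self_consistent trajectory_force eta).
Local Notation param s f := (ForcedParameter eta s f : Th).

Definition height s f : R :=
  primitive (fun t => height_force F eta s (trajectory s f t)) 1.

Let force_continuous (th : Th) : pdom th -> {in `[0, 1], continuous (trajectory_force ^~ th)}.
Proof. exact: ulip_continuous ulip_trajectory_force. Qed.

Let param_dom s f : s1 <= s <= s2 -> admissible_forcing f -> pdom (param s f).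
Proof. exact: forced_domE. Qed.

Let continuous_height_force s f : s1 <= s <= s2 -> admissible_forcing f ->
  {in `[0, 1], continuous (fun t => height_force F eta s (trajectory s f t))}.
Proof.
by move=> sb adm; exact: ulip_continuous (ulip_fst
  (ulip_snd ulip_trajectory_force)) (param_dom sb adm).
Qed.

Lemma trajectory_derive s f t : s1 <= s <= s2 -> self_consistent s f -> 0 <= t <= 1 ->
  is_derive t 1 (trajectory s f) ((scaled_control F eta s (trajectory s f t),
    s *: ((trajectory s f t).1.2 *m J) + eta *: velocity_force F eta s (trajectory s f t)),
   (eta * height_force F eta s (trajectory s f t),
    eta * multiplier_force F eta s (trajectory s f t))).
Proof.
move=> sb [[f_cont _] fE] t01; have s0 : s != 0.
  by rewrite gt_eqF// (lt_le_trans s1_gt0)//; case/andP: sb.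
have ft : f t = eta *: perturbation F eta s (trajectory s f t).
  by rewrite {1}fE clamp_id.
have fst_cont (U V : normedModType R) (g : R -> U * V) r :
    {for r, continuous g} -> {for r, continuous (fun r => (g r).1)}.
  by move=> g_cont; apply: (@continuous_comp _ _ _ g fst) => //; exact: cvg_fst.
have snd_cont (U V : normedModType R) (g : R -> U * V) r :
    {for r, continuous g} -> {for r, continuous (fun r => (g r).2)}.
  by move=> g_cont; apply: (@continuous_comp _ _ _ g snd) => //; exact: cvg_snd.
have fX_cont r : r \in `[0, 1] -> {for r, continuous (fun r => (f r).1.1)}.
  by move=> /f_cont/fst_cont; exact: fst_cont.
have fU_cont r : r \in `[0, 1] -> {for r, continuous (fun r => (f r).1.2)}.
  by move=> /f_cont/fst_cont; exact: snd_cont.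
have dX := is_derive_linear_position alf_gt0 curvature_sqr xi fX_cont fU_cont s0 t01.
have dU := is_derive_linear_velocity alf_gt0 curvature_sqr s xi (fun r => (f r).1.1) fU_cont t01.
have dZ : is_derive t 1 (primitive (fun r => (f r).2.1)) (f t).2.1.
  by apply: is_derive_primitive => // r /f_cont/snd_cont; exact: fst_cont.
have dmu : is_derive t 1 (primitive (fun r => (f r).2.2)) (f t).2.2.
  by apply: is_derive_primitive => // r /f_cont/snd_cont; exact: snd_cont.
apply: is_derive_eq (is_derive_pair (is_derive_pair dX dU) (is_derive_pair dZ dmu)) _.
by rewrite ft.
Qed.

Lemma trajectory_in_cube s f t : s1 <= s <= s2 -> self_consistent s f -> 0 <= t <= 1 ->
  `|unscaled_point F eta (trajectory s f t) - y0| < eta0 ^+ 2 * M.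
Proof.
move=> sb [adm _] t01; rewrite /unscaled_point addrAC subrr add0r normrZ.
rewrite ger0_norm ?exprn_ge0 ?(ltW eta_gt0)//.
rewrite (@lt_le_trans _ _ (eta ^+ 2 * M))//.
  by rewrite ltr_pM2l ?exprn_gt0//; exact: trajectory_offset_lt t01 (param_dom sb adm).
by rewrite ler_wpM2r ?(ltW M_gt0)// lerXn2r// nnegrE ltW// (lt_le_trans eta_gt0).
Qed.

Lemma trajectory_hamiltonian_curve s f : s1 <= s <= s2 -> self_consistent s f ->
  hamiltonian_curve (frame_ham F) (fun t => unscaled_point F eta (trajectory s f t))
    (fun t => unscaled_covector F eta s (trajectory s f t)).
Proof.
move=> sb fE; apply: rescaled_hamiltonian_curve => [|t t01|t t01]; first by rewrite gt_eqF.
  by rewrite /cube/= (le_trans (ltW (trajectory_in_cube sb fE t01))).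
exact: trajectory_derive.
Qed.

Lemma trajectory_start s f : unscaled_point F eta (trajectory s f 0) = y0.
Proof.
rewrite /unscaled_point /unscaled_offset /= linear_position0// primitive0.
by rewrite mul0mx mulr0 scale0r addr0 scaler0 addr0.
Qed.

Lemma trajectory_end s f : s1 <= s <= s2 -> self_consistent s f ->
  unscaled_point F eta (trajectory s f 1) =
  y0 + eta ^+ 2 *: (xi *m basis F + (eta * (eta * height s f)) *: transversal F).
Proof.
move=> sb fE; have [adm _] := fE; have s0 : s != 0.
  by rewrite gt_eqF// (lt_le_trans s1_gt0)//; case/andP: sb.
rewrite /unscaled_point /unscaled_offset /= linear_position1// => [|i]; last first.
  by rewrite gt_eqF// (lt_le_trans m_gt0)// nonresonant.
have dZ t : 0 <= t <= 1 -> is_derive t 1 (fun r => eta^-1 * (trajectory s f r).2.1)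
    (height_force F eta s (trajectory s f t)).
  move=> t01; have dx := is_derive_fst (is_derive_snd (trajectory_derive sb fE t01)).
  by apply: is_derive_eq (is_derive_cmul eta^-1 dx) _; rewrite /= mulKf// gt_eqF.
rewrite /height (primitiveE dZ (continuous_height_force sb adm)) ?ler01 ?lexx//.
by rewrite /= primitive0 mulr0 subr0 mulVKf// gt_eqF.
Qed.

Variables (CU eps : R).
Hypothesis start_velocity_lipschitz : forall (th th' : Th) delta, pdom th -> pdom th' ->
  pclose th th' delta -> `|start_velocity (multiplier th) (forcing th) -
    start_velocity (multiplier th') (forcing th')| <= CU * delta.
Hypothesis velocity_small : eta * (C * (CU + 1)) <= eps.

Lemma trajectory_initial_velocity s f : s1 <= s <= s2 -> self_consistent s f ->
  exists2 v : 'rV[R]_d, is_derive (0 : R) 1 (fun t => unscaled_point F eta (trajectory s f t)) v &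
    `|eta ^- 2 *: (v *m (dual_basis F)^T) - start_velocity s (fun=> 0)| <= eps.
Proof.
move=> sb fE; have [adm _] := fE.
have i0 : 0 <= (0 : R) <= 1 by rewrite lexx ler01.
have [dy _] := trajectory_hamiltonian_curve sb fE i0; eexists; first exact: dy.
rewrite grad_frame_ham; last first.
  by rewrite /cube/= (le_trans (ltW (trajectory_in_cube sb fE i0))).
rewrite frame_velocity_unscaled ?gt_eqF// -scalemxAl scalerA mulVf ?scale1r ?expf_neq0 ?gt_eqF//.
rewrite mulmxDl -scalemxAl -mulmxA.
rewrite basis_dualK transversal_dual mulmx1 scaler0 addr0 /scaled_control.
have -> : (trajectory s f 0).1.2 = start_velocity s f.
  by rewrite /= /linear_velocity /forcing_response primitive_mx0 addr0 rot0 mulmx1.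
rewrite addrAC (le_trans (ler_normD _ _))// (le_trans _ velocity_small)//.
rewrite mulrDr mulr1 mulrDr lerD//.
  rewrite mulrA mulrC; apply: (start_velocity_lipschitz (th := param s f)
    (th' := param s (fun=> 0))).
  - exact: param_dom.
  - by apply: param_dom => //; exact: admissible_forcing0.
  - have small := forcing_small force_lipschitz eta_gt0 eta_le _ sb fE.
    split=> //= [|t]; last by rewrite subr0 small.
    by rewrite subrr normr0; exact: le_trans (small 0).
rewrite normrZ (gtr0_norm eta_gt0) ler_wpM2l ?(ltW eta_gt0)//.
have [force_le _] := force_lipschitz i0 (param_dom sb adm).
apply: le_trans force_le; apply: le_trans (norm_fst_le (trajectory_force 0 (param s f))).
exact: norm_fst_le (trajectory_force 0 (param s f)).1.
Qed.

Lemma height_lipschitz s s' f f' : s1 <= s <= s2 -> s1 <= s' <= s2 ->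
  self_consistent s f -> self_consistent s' f' -> `|height s f - height s' f'| <= C * `|s - s'|.
Proof.
move=> sb sb' fE fE'; have [[adm _] [adm' _]] := (fE, fE').
apply: norm_primitiveB; rewrite ?ler01 ?lexx//;
  [exact: continuous_height_force|exact: continuous_height_force|].
move=> t t01; have [_ lip] := force_lipschitz t01 (param_dom sb adm).
have ff' := self_consistent_lipschitz force_lipschitz eta_gt0 eta_le eta_small sb sb' fE fE'.
apply: (@le_trans _ _ `|trajectory_force t (param s f) - trajectory_force t (param s' f')|).
  rewrite -[height_force F eta s _]/((trajectory_force t (param s f)).2.1).
  rewrite -[height_force F eta s' _]/((trajectory_force t (param s' f')).2.1).
  move: (trajectory_force t _) (trajectory_force t _) => x x'.
  exact: le_trans (norm_fst_le (x' - x).2) (norm_snd_le (x' - x)).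
by apply: lip => //; exact: param_dom.
Qed.

Variables (CA CD : R).
Hypothesis area_rate_lipschitz : forall t (th th' : Th) delta, 0 <= t <= 1 -> pdom th ->
  pdom th' -> pclose th th' delta ->
  `|area_rate F (trajectory (multiplier th) (forcing th) t) -
    area_rate F (trajectory (multiplier th') (forcing th') t)| <= CA * delta.
Hypothesis height_remainder_bounded : forall t (th : Th), 0 <= t <= 1 -> pdom th ->
  `|height_remainder F (scale th) (multiplier th)
    (trajectory (multiplier th) (forcing th) t)| <= CD.
Hypothesis height_small : eta * (CD + CA * C) <= 1.

Lemma height_near_area s f : s1 <= s <= s2 -> self_consistent s f ->
  `|height s f - enclosed_area s| <= 1.
Proof.
move=> sb fE; have [adm _] := fE; have D0 := param_dom sb admissible_forcing0.
rewrite (le_trans _ height_small)//; apply: norm_primitiveB; rewrite ?ler01 ?lexx//.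
- exact: continuous_height_force.
- exact: ulip_continuous (ulip_area_rate eta0) D0.
move=> t t01; rewrite height_forceE addrAC (le_trans (ler_normD _ _))//
  (mulrDr eta CD) [leRHS]addrC lerD//.
  rewrite mulrCA; apply: (area_rate_lipschitz t01 (param_dom sb adm) D0).
  have small := forcing_small force_lipschitz eta_gt0 eta_le _ sb fE.
  split=> //= [|r]; last by rewrite subr0 small.
  by rewrite subrr normr0; exact: le_trans (small 0).
rewrite normrM (gtr0_norm eta_gt0) ler_wpM2l ?(ltW eta_gt0)//.
exact: (height_remainder_bounded t01 (param_dom sb adm)).
Qed.

Lemma height_attained Zh : 0 <= C -> enclosed_area s2 + 1 <= Zh <= enclosed_area s1 - 1 ->
  exists s f, [/\ s1 <= s <= s2, self_consistent s f & height s f = Zh].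
Proof.
move=> C0 /andP[Zh_ge Zh_le].
have /choice[f fE] s : exists f, s1 <= s <= s2 -> self_consistent s f.
  have [sb|nsb] := pselect (s1 <= s <= s2); last by exists (fun=> 0).
  have [f fE] := self_consistent_exists force_continuous force_lipschitz
    eta_gt0 eta_le eta_small sb.
  by exists f.
have near s : s1 <= s <= s2 -> `|height s (f s) - enclosed_area s| <= 1.
  by move=> sb; exact: height_near_area sb (fE s sb).
have := near s1; have := near s2; rewrite !lexx s12 => /(_ isT) near2 /(_ isT) near1.
have [||s sb sZh] := @lipschitz_IVT R (fun s => height s (f s)) C s1 s2 Zh s12 C0; last first.
- by exists s, (f s); split=> //; exact: fE.
- rewrite ge_min le_max; apply/andP; split; apply/orP; [right|left].
    by rewrite (le_trans _ Zh_ge)// -lerBlDl; have /ler_normlW := near2.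
  by rewrite (le_trans Zh_le)// lerBlDl -lerBlDr; move: near1; rewrite distrC => /ler_normlW.
- apply/klipschitzP => s s'; rewrite /= !in_itv/= => sb sb'.
  exact: height_lipschitz (fE s sb) (fE s' sb').
Qed.

Lemma shooting_at_scale Zh : 0 <= C -> enclosed_area s2 + 1 <= Zh <= enclosed_area s1 - 1 ->
  exists s y p, [/\ s1 <= s <= s2, hamiltonian_curve (frame_ham F) y p,
    y 0 = y0 /\ y 1 = y0 + eta ^+ 2 *: (xi *m basis F + (eta * (eta * Zh)) *: transversal F),
    forall t, 0 <= t <= 1 -> `|y t - y0| < eta0 ^+ 2 * M &
    exists2 v, is_derive (0 : R) 1 y v &
      `|eta ^- 2 *: (v *m (dual_basis F)^T) - start_velocity s (fun=> 0)| <= eps].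
Proof.
move=> C0 /(height_attained C0)[s [f [sb fE <-]]].
exists s, (fun t => unscaled_point F eta (trajectory s f t)),
  (fun t => unscaled_covector F eta s (trajectory s f t)); split=> //.
- exact: trajectory_hamiltonian_curve.
- by rewrite trajectory_start trajectory_end.
- by move=> t; exact: trajectory_in_cube.
- exact: trajectory_initial_velocity.
Qed.

End at_scale.

End self_consistent_trajectories.

Theorem shooting (eps Zh : R) : 0 < eps ->
  enclosed_area s2 + 1 <= Zh <= enclosed_area s1 - 1 ->
  \forall eta \near 0^'+, exists s y p, [/\ s1 <= s <= s2,
    hamiltonian_curve (frame_ham F) y p,
    y 0 = y0 /\ y 1 = y0 + eta ^+ 2 *: (xi *m basis F + (eta * (eta * Zh)) *: transversal F),
    forall t, 0 <= t <= 1 -> `|y t - y0| < rho / 2 &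
    exists2 v, is_derive (0 : R) 1 y v &
      `|eta ^- 2 *: (v *m (dual_basis F)^T) - start_velocity s (fun=> 0)| <= eps].
Proof.
move=> eps0 Zhb; have [M M0 offset_lt] := trajectory_offset_bounded.
pose eta0 := Num.min 1 (rho / 2 / M).
have eta0_gt0 : 0 < eta0 by rewrite lt_min ltr01 !divr_gt0.
have eta0_le1 : eta0 <= 1 by rewrite ge_min lexx.
have eta0_small : eta0 ^+ 2 * M <= rho / 2.
  rewrite -ler_pdivlMr// expr2 (le_trans (ler_piMl (ltW eta0_gt0) eta0_le1))//.
  by rewrite ge_min lexx orbT.
have eta0_small' : eta0 ^+ 2 * M <= rho by rewrite (le_trans eta0_small)//
  ler_piMr ?invf_le1 ?ler1n ?ltW.
have [force_cont [C C0 HC]] := ulip_trajectory_force M0 eta0_le1 eta0_small' offset_lt.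
have [CA _ HA] := ulip_lipschitz (ulip_area_rate eta0).
have [CD _ HD] := ulip_bounded (ulip_trajectory_height_remainder M0 eta0_le1 eta0_small' offset_lt).
have [CU _ HU] := ulip_lipschitz (ulip_start_velocity eta0).
near=> eta; have eta_gt0 : 0 < eta by near: eta; exact: nbhs_right_gt.
have eta_le : eta <= eta0 by near: eta; exact: nbhs_right_le.
have eta_small : eta * C <= 2^-1 by near: eta; apply: near_scale_small; rewrite invr_gt0.
have height_small : eta * (CD + CA * C) <= 1 by near: eta; exact: near_scale_small.
have velocity_small : eta * (C * (CU + 1)) <= eps by near: eta; exact: near_scale_small.
have start_lip (th th' : forced_space (V := state) eta0 s1 s2) delta Dth Dth' D :=
  HU 0 th th' delta (introT andP (conj (lexx 0) ler01)) Dth Dth' D.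
have [s [y [p [sb sol ends near_y0 vel]]]] := shooting_at_scale M0 eta0_le1 eta0_small' offset_lt HC
  eta_gt0 eta_le eta_small start_lip velocity_small HA HD height_small C0 Zhb.
by exists s, y, p; split=> // t t01; rewrite (lt_le_trans (near_y0 t t01)).
Unshelve. all: end_near.
Qed.

End shooting.

(** * Enclosed area and conjugate multipliers *)

Section rotating_area.
Context {R : realType} {n : nat}.
Variables (J B g : 'M[R]_n).
Hypotheses (g_sym : g^T = g) (mulJg : J *m g = B - B^T).

Definition gdot (u v : 'rV[R]_n) : R := dot (u *m g) v.
Definition bdot (u v : 'rV[R]_n) : R := dot (u *m B) v.

Lemma gdotC u v : gdot u v = gdot v u.
Proof. by rewrite /gdot dot_mulmx g_sym dotC. Qed.

Lemma gdotDl u v w : gdot (u + v) w = gdot u w + gdot v w.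
Proof. by rewrite /gdot mulmxDl dotDl. Qed.

Lemma gdotZl (k : R) u w : gdot (k *: u) w = k * gdot u w.
Proof. by rewrite /gdot -scalemxAl dotZl. Qed.

Lemma gdotDr u v w : gdot w (u + v) = gdot w u + gdot w v.
Proof. exact: dotDr. Qed.

Lemma gdotZr (k : R) u w : gdot w (k *: u) = k * gdot w u.
Proof. exact: dotZr. Qed.

Lemma gdot_skew u v : gdot (u *m J) v = bdot u v - bdot v u.
Proof. by rewrite /gdot /bdot -mulmxA mulJg mulmxBr dotBl (dot_mulmx u B^T) trmxK (dotC u). Qed.

Lemma gdot_skewC u v : gdot (u *m J) v = - gdot u (v *m J).
Proof. by rewrite (gdotC u) !gdot_skew opprB. Qed.

Lemma gdot_skew0 u : gdot (u *m J) u = 0.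
Proof. by rewrite gdot_skew subrr. Qed.

Implicit Types t r : R.

Variables (s : R) (X U : R -> 'rV[R]_n).
Hypothesis s_neq0 : s != 0.
Hypothesis dX : forall t : R, 0 <= t <= 1 -> is_derive t 1 X (U t).
Hypothesis dU : forall t : R, 0 <= t <= 1 -> is_derive t 1 U (s *: (U t *m J)).
Hypothesis X0 : X 0 = 0.

Lemma velocity_first_integral t : 0 <= t <= 1 -> s *: (X t *m J) = U t - U 0.
Proof.
move=> t01; apply/eqP; rewrite eq_sym subr_eq addrC -subr_eq; apply/eqP.
have := @derive0_constant_mx _ _ _ 0 1 (fun r => U r - s *: (X r *m J)) t.
rewrite X0 mul0mx scaler0 subr0; apply=> // r r01.
 apply: is_derive_eq (is_deriveB (dU r01) (is_deriveZ s (is_derive_mulmxl J (dX r01)))) _.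
by rewrite subrr.
Qed.

Lemma energy_conserved t : 0 <= t <= 1 -> gdot (U t) (U t) = gdot (U 0) (U 0).
Proof.
apply: (derive0_constant (b := 1) (f := fun r => gdot (U r) (U r))) => r r01.
apply: is_derive_eq (is_derive_dot (is_derive_mulmxl g (dU r01)) (dU r01)) _.
rewrite -[LHS]/(gdot (s *: (U r *m J)) (U r) + gdot (U r) (s *: (U r *m J))).
by rewrite (gdotC (U r)) gdotZl gdot_skew0 mulr0 addr0.
Qed.

Lemma continuous_area_rate : {in `[0, 1], continuous (fun t => bdot (X t) (U t))}.
Proof.
move=> t t01; apply: is_derive_continuous.
exact: is_derive_dot (is_derive_mulmxl B (dX t01)) (dU t01).
Qed.

(* [2^-1 X . B X + (2 s)^-1 (t |U0|^2 - <X, U0>)] is a primitive of the area rate, because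
   [s X J = U - U0] and [|U|] is conserved. *)
Lemma rotating_area : primitive (fun t => bdot (X t) (U t)) 1 =
  2^-1 * bdot (X 1) (X 1) + (2 * s)^-1 * (gdot (U 0) (U 0) - gdot (X 1) (U 0)).
Proof.
pose c := gdot (U 0) (U 0).
pose P t := 2^-1 * bdot (X t) (X t) + (2 * s)^-1 * (t * c - gdot (X t) (U 0)).
have dP t : 0 <= t <= 1 -> is_derive t 1 P (bdot (X t) (U t)).
  move=> t01; have dXX := is_derive_dot (is_derive_mulmxl B (dX t01)) (dX t01).
  have dXU0 := is_derive_dot (is_derive_mulmxl g (dX t01)) (is_derive_cst (U 0) t 1).
  have dtc := is_derive_mul (is_derive_id t 1) (is_derive_cst c t 1).
  apply: is_derive_eq (is_deriveD (is_derive_cmul 2^-1 dXX)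
    (is_derive_cmul (2 * s)^-1 (is_deriveB dtc dXU0))) _.
  rewrite -[LHS]/(2^-1 * (bdot (U t) (X t) + bdot (X t) (U t)) +
    (2 * s)^-1 * (1 * c + t * 0 - (gdot (U t) (U 0) + gdot (X t) 0))).
  rewrite (gdotC _ 0) [gdot 0 _]/gdot mul0mx dot0l addr0 mul1r mulr0 addr0.
  have <- : bdot (X t) (U t) - s^-1 * (c - gdot (U t) (U 0)) = bdot (U t) (X t).
    have -> : c - gdot (U t) (U 0) = s * gdot (X t *m J) (U t).
      by rewrite -gdotZl velocity_first_integral// -(scaleN1r (U 0)) gdotDl gdotZl
        energy_conserved// (gdotC (U 0)) mulN1r.
    by rewrite gdot_skew mulKf// opprB addrC subrK.
  by field.
rewrite (primitiveE dP continuous_area_rate) ?ler01 ?lexx// /P X0 /bdot /gdot !mul0mx.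
by rewrite !dot0l !mul0r subrr !mulr0 addr0 subr0 mul1r.
Qed.

End rotating_area.

Section half_cotangent.
Context {R : realType}.
Implicit Types (al s u : R).

(* This is [al / 2 * cot (s * al / 2)]; its poles are the conjugate multipliers. *)
Definition half_cot al s : R := al * sin (s * al) / (2 - 2 * cos (s * al)).

Definition conjugate_multiplier al (k : nat) : R := (pi *+ 2) *+ k.+1 / al.

Let twopi_ge0 : 0 <= pi *+ 2 :> R. Proof. by rewrite mulrn_wge0// pi_ge0. Qed.

Lemma conjugate_multiplier_ge al k : 0 < al -> pi *+ 2 / al <= conjugate_multiplier al k.
Proof.
move=> al0; rewrite ler_wpM2r ?invr_ge0 ?(ltW al0)// (mulrS (pi *+ 2) k) lerDl.
by rewrite mulrn_wge0.
Qed.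

Lemma conjugate_multiplier_gt0 al k : 0 < al -> 0 < conjugate_multiplier al k.
Proof.
move=> al0; apply: lt_le_trans (conjugate_multiplier_ge k al0).
by rewrite divr_gt0// mulrn_wgt0// pi_gt0.
Qed.

Lemma conjugate_multiplier_gap al k l : 0 < al -> (k < l)%N ->
  conjugate_multiplier al k + pi *+ 2 / al <= conjugate_multiplier al l.
Proof.
move=> al0 kl; rewrite -mulrDl ler_wpM2r ?invr_ge0 ?(ltW al0)// -mulrSr.
exact: ler_wpMn2l.
Qed.

Lemma cos_lt1 (v : R) : 0 < v < pi / 2 -> cos v < 1.
Proof.
move=> v_itv; rewrite lt_neqAle cos_le1 andbT; apply/negP => /eqP cos1.
have := cos2Dsin2 v; rewrite cos1 expr1n -[RHS]addr0 => /addrI/eqP; rewrite sqrf_eq0.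
by rewrite gt_eqF// sin_gt0_pihalf.
Qed.

Lemma half_cot_ge al k u : 0 < al -> 0 < u -> u * al < pi / 2 ->
  (2 * u)^-1 <= half_cot al (conjugate_multiplier al k + u).
Proof.
move=> al0 u0 ual; have v_itv : 0 < u * al < pi / 2 by rewrite mulr_gt0.
rewrite /half_cot (_ : (_ + u) * al = u * al + (pi *+ 2) *+ k.+1); last first.
  by rewrite mulrDl divfK ?gt_eqF// addrC.
rewrite (periodicn (@sinD2pi R)) (periodicn (@cosD2pi R)).
have [sin_gt0 cos1] := (sin_gt0_pihalf v_itv, cos_lt1 v_itv).
have cos0 : 0 < cos (u * al).
  by apply: cos_gt0_pihalf; have [v0 ->] := andP v_itv;
    rewrite (lt_trans _ v0)// oppr_lt0 divr_gt0// pi_gt0.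
have sin_le : sin (u * al) <= u * al.
  have /klipschitzP/(_ (u * al) 0 I I) := @sin_lipschitz R.
  by rewrite sin0 !subr0 mul1r (gtr0_norm sin_gt0) (gtr0_norm (andP v_itv).1).
have den0 : 0 < 2 - 2 * cos (u * al) by rewrite subr_gt0 -[ltRHS]mulr1 ltr_pM2l.
rewrite ler_pdivlMr// mulrC ler_pdivrMr ?mulr_gt0//.
have sqr : sin (u * al) * sin (u * al) = (1 - cos (u * al)) * (1 + cos (u * al)).
  by rewrite -expr2 sin2cos2; ring.
have sin_sqr_le : sin (u * al) * sin (u * al) <= sin (u * al) * (u * al) by rewrite ler_wpM2l// ltW.
have : 0 <= (1 - cos (u * al)) * cos (u * al) by rewrite mulr_ge0 ?ltW ?subr_gt0.
by move: sin_sqr_le; rewrite sqr; lra.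
Qed.

End half_cotangent.

Section right_derivative.
Context {R : realType} {m n : nat}.

Lemma is_derive_eq_right (F G : R -> 'M[R]_(m, n)) v w :
  is_derive (0 : R) 1 F v -> is_derive (0 : R) 1 G w ->
  (forall t : R, 0 <= t <= 1 -> F t = G t) -> v = w.
Proof.
move=> dF dG FG; apply/matrixP => i j.
have [/is_derive_mxP/(_ i j) dFij /is_derive_mxP/(_ i j) dGij] := (dF, dG).
have := cvg_diff_quotient dFij; rewrite (_ : diff_quotient _ ^~ 0 =
  diff_quotient (fun t => G t i j) ^~ 0).
  by move=> cvgF; exact: cvg_unique cvgF (cvg_diff_quotient dGij).
apply: funext => k; rewrite /diff_quotient add0r !FG ?lexx ?ler01//.
by rewrite invr_ge0 ler0n invf_le1 ?ltr0n// ler1n.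
Qed.

End right_derivative.

Section unforced_area.
Context {R : realType} {n d : nat} {y0 : 'rV[R]_d} {rho : R}.
Variables (F : adapted_frame n y0 rho) (alf : 'I_n -> R) (i0 : 'I_n).
Hypothesis alf_gt0 : forall i, 0 < alf i.
Hypothesis curvature_sqr :
  frame_curvature F *m frame_curvature F = - diagf alf (fun x => x ^+ 2).
Hypothesis cube_y0 : cube y0 rho y0.
Local Notation J := (frame_curvature F).
Local Notation xi := (delta_mx 0 i0 : 'rV[R]_n).
Local Notation al := (alf i0).
Local Notation gdot := (gdot (metric0 F)).
Local Notation bdot := (bdot (frame_jacobian F)).
Local Notation unforced s := (trajectory F alf xi s (fun=> 0)).
Local Notation U0 s := (start_velocity F alf xi s (fun=> 0)).
Implicit Types (s t u : R).

Lemma metric0_sym : (metric0 F)^T = metric0 F.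
Proof. by rewrite /metric0 trmx_inv cometric_sym. Qed.

Lemma curvature_metric0 : J *m metric0 F = frame_jacobian F - (frame_jacobian F)^T.
Proof. by rewrite -mulmxA mulmxV ?mulmx1// cometric_unit. Qed.

Lemma delta_diagf phi : xi *m diagf alf phi = phi al *: xi.
Proof.
apply/rowP => j; rewrite mul_mx_diag !mxE /=.
by have [->|_] := eqVneq j i0; rewrite ?mulr1 ?mul1r ?mulr0 ?mul0r.
Qed.

Lemma unforced_start s : U0 s = s *: (half_cot al s *: xi - 2^-1 *: (xi *m J)).
Proof.
have i1 : 0 <= (1 : R) <= 1 by rewrite ler01 lexx.
have -> : U0 s = (s *: (xi *m J)) *m rot_resolvent J alf s.
  rewrite -[LHS]/(initial_velocity J alf s xi (fun=> 0) (fun=> 0)) /initial_velocity.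
  have -> : forcing_drift J s (fun=> 0) (fun=> 0) 1 = 0.
    by rewrite /forcing_drift mul0mx scaler0 subr0 primitive_mx_zero.
  have -> : forcing_response J alf s (fun=> 0) 1 = 0.
    rewrite /forcing_response (_ : (fun r => _) = fun=> 0) ?primitive_mx_zero//.
    by apply: funext => r; rewrite mul0mx.
  by rewrite mul0mx addr0 subr0.
rewrite -scalemxAl /rot_resolvent /complexf mulmxDr; congr (_ *: _).
rewrite (diagf_cst alf (- 2^-1)) mul_mx_scalar -mulmxA (mulmxA J) curvature_sqr mulNmx diagf_mul.
rewrite mulmxN delta_diagf scaleNr addrC; congr (_ + _); rewrite -scaleNr; congr (_ *: _).
rewrite /half_cot invfM; move: (2 - _)^-1 => c; by field; rewrite gt_eqF.
Qed.

Lemma unforced_derive s t : s != 0 -> 0 <= t <= 1 ->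
  is_derive t 1 (fun r => (unforced s r).1.1) (unforced s t).1.2 /\
  is_derive t 1 (fun r => (unforced s r).1.2) (s *: ((unforced s t).1.2 *m J)).
Proof.
move=> s0 t01; have zero_cont : {in `[0, 1], continuous ((fun=> 0) : R -> 'rV[R]_n)}.
  by move=> r _; exact: cst_continuous.
split.
  apply: is_derive_eq (is_derive_linear_position alf_gt0 curvature_sqr xi
    zero_cont zero_cont s0 t01) _.
  by rewrite addr0.
apply: is_derive_eq (is_derive_linear_velocity alf_gt0 curvature_sqr s xi _ zero_cont t01) _.
by rewrite addr0.
Qed.

Lemma gdot_delta : gdot xi xi = metric0 F i0 i0.
Proof. by rewrite /gdot dot_delta -rowE mxE. Qed.

Lemma gdot_curvature : gdot (xi *m J) (xi *m J) = al ^+ 2 * metric0 F i0 i0.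
Proof.
rewrite (gdot_skewC metric0_sym curvature_metric0) -mulmxA curvature_sqr mulmxN delta_diagf.
by rewrite -scaleNr gdotZr mulNr opprK gdot_delta.
Qed.

Lemma gdot_unforced_start s :
  gdot (U0 s) (xi *m J) = - (s / 2 * (al ^+ 2 * metric0 F i0 i0)).
Proof.
rewrite unforced_start gdotZl gdotDl gdotZl -scaleNr gdotZl gdot_curvature.
rewrite (gdotC metric0_sym xi) (gdot_skew0 curvature_metric0); ring.
Qed.

Lemma enclosed_areaE s : s != 0 -> (forall i, 2 - 2 * cos (s * alf i) != 0) ->
  enclosed_area F alf xi s = 2^-1 * bdot xi xi +
    2^-1 * metric0 F i0 i0 * (s * (al ^+ 2 / 4 + half_cot al s ^+ 2) - half_cot al s).
Proof.
move=> s0 nonres.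
have dX t t01 := (unforced_derive s0 t01 : _ /\ is_derive t 1 _ _).
have X0 : (unforced s 0).1.1 = 0 by exact: linear_position0.
have X1 : (unforced s 1).1.1 = xi by exact: linear_position1.
have start : (unforced s 0).1.2 = U0 s.
  by rewrite /= /linear_velocity /forcing_response primitive_mx0 addr0 rot0 mulmx1.
have := rotating_area metric0_sym curvature_metric0 s0 (fun t t01 => (dX t t01).1)
  (fun t t01 => (dX t t01).2) X0.
rewrite X1 start => areaE; rewrite /enclosed_area.
rewrite (_ : (fun t => _) = (fun t => bdot (unforced s t).1.1 (unforced s t).1.2)); last first.
  by apply: funext => t; rewrite /area_rate dotC.
rewrite {}areaE; congr (_ + _); rewrite unforced_start; move: (half_cot al s) => kappa.
have xiJ : gdot xi (xi *m J) = 0.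
  by rewrite (gdotC metric0_sym) (gdot_skew0 curvature_metric0).
rewrite -!scaleNr !(gdotZl, gdotZr, gdotDl, gdotDr) gdot_curvature
  (gdot_skew0 curvature_metric0) xiJ.
by rewrite gdot_delta; field.
Qed.

Hypothesis metric0_gt0 : 0 < metric0 F i0 i0.

Let al_gt0 : 0 < al := alf_gt0 i0.

Lemma near_nonresonant s : \forall u \near 0^'+, forall i, 2 - 2 * cos ((s + u) * alf i) != 0.
Proof.
apply: (@filter_forall _ _ (fun i u => 2 - 2 * cos ((s + u) * alf i) != 0) 0^'+) => i.
have neq1 (c : R) : c < 1 -> 2 - 2 * c != 0 by move=> c1; rewrite gt_eqF//; lra.
have [cos1|cos_neq1] := eqVneq (cos (s * alf i)) 1.
  have sin_eq0 : sin (s * alf i) = 0 by apply/eqP; rewrite -norm_cos_eq1 cos1 normr1.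
  near=> u; have u0 : 0 < u by near: u; exact: nbhs_right_gt.
  rewrite (mulrDl s u) cosD sin_eq0 mul0r subr0 cos1 mul1r; apply: neq1; apply: cos_lt1.
  rewrite mulr_gt0//= -ltr_pdivlMr//; near: u; apply: nbhs_right_lt.
  by rewrite !divr_gt0// pi_gt0.
have cos_lt : cos (s * alf i) < 1 by rewrite lt_neqAle cos_neq1 cos_le1.
near=> u; apply: neq1; near: u.
have cos_cvg : cos ((s + u) * alf i) @[u --> 0^'+] --> cos (s * alf i).
  rewrite -[s in cos (s * _)]addr0; apply: cvg_at_right_filter.
  apply: continuous_cvg; first exact: continuous_cos.
  apply: cvgM; last exact: cvg_cst.
  by apply: cvgD; [exact: cvg_cst|exact: cvg_id].
exact: cvgr_lt cos_cvg _ cos_lt.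
Unshelve. all: end_near.
Qed.

Lemma enclosed_area_pole k (Z : R) :
  \forall u \near 0^'+, Z <= enclosed_area F alf xi (conjugate_multiplier al k + u).
Proof.
pose b0 := 2^-1 * bdot xi xi; pose w := `|Z - b0| + 1.
have w0 : 0 < w by rewrite ltr_wpDl.
have s0_gt0 : 0 < pi *+ 2 / al :> R by rewrite divr_gt0// mulrn_wgt0// pi_gt0.
near=> u; have u0 : 0 < u by near: u; exact: nbhs_right_gt.
have ual : u * al < pi / 2.
  by rewrite -ltr_pdivlMr//; near: u; apply: nbhs_right_lt; rewrite !divr_gt0// pi_gt0.
have us : u <= pi *+ 2 / al / 4 by near: u; apply: nbhs_right_le; rewrite divr_gt0.
have uw : u <= metric0 F i0 i0 / (4 * w) by near: u; apply: nbhs_right_le;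
  rewrite divr_gt0// mulr_gt0.
have nonres : forall i, 2 - 2 * cos ((conjugate_multiplier al k + u) * alf i) != 0.
  by near: u; exact: near_nonresonant.
have s_ge : pi *+ 2 / al <= conjugate_multiplier al k + u.
  by rewrite (le_trans (conjugate_multiplier_ge k al_gt0))// lerDl ltW.
have cot_ge := half_cot_ge k al_gt0 u0 ual.
move: (conjugate_multiplier al k + u) nonres s_ge cot_ge => s nonres s_ge cot_ge.
have s_gt0 : 0 < s := lt_le_trans s0_gt0 s_ge.
rewrite enclosed_areaE ?gt_eqF// -/b0; set kap := half_cot al s in cot_ge *.
have kap_gt0 : 0 < kap by rewrite (lt_le_trans _ cot_ge)// invr_gt0 mulr_gt0.
have s_kap : 2 <= s * kap.
  rewrite (@le_trans _ _ (4 * u * (2 * u)^-1))//; first by rewrite le_eqVlt; apply/orP; left;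
    apply/eqP; field; rewrite gt_eqF.
  by rewrite ler_pM ?invr_ge0 ?mulr_ge0 ?(ltW u0)// (le_trans _ s_ge)// mulrC -ler_pdivlMr.
have kap_le : kap <= s * (al ^+ 2 / 4 + kap ^+ 2) - kap.
  have := ler_wpM2r (ltW kap_gt0) s_kap.
  have := mulr_ge0 (ltW s_gt0) (sqr_ge0 al).
  by move=> sal skap; nra.
rewrite -lerBlDl (@le_trans _ _ w)//; first by rewrite (le_trans (ler_norm _))// lerDl.
apply: (@le_trans _ _ (2^-1 * metric0 F i0 i0 * kap)); last by rewrite ler_wpM2l// mulr_ge0// ltW.
apply: (@le_trans _ _ (2^-1 * metric0 F i0 i0 * (2 * u)^-1));
  last by rewrite ler_wpM2l// mulr_ge0// ltW.
rewrite (_ : 2^-1 * metric0 F i0 i0 / (2 * u) = metric0 F i0 i0 / (4 * u));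
  last by field; rewrite gt_eqF.
by move: uw; rewrite !ler_pdivlMr ?mulr_gt0// mulrCA (mulrC u) mulrCA.
Unshelve. all: end_near.
Qed.

Lemma nonresonant_bound s1 s2 : s1 <= s2 ->
  (forall s i, s1 <= s <= s2 -> 2 - 2 * cos (s * alf i) != 0) ->
  exists2 m : R, 0 < m & forall s i, s1 <= s <= s2 -> m <= 2 - 2 * cos (s * alf i).
Proof.
move=> s12 nonres; have gt0 s i : s1 <= s <= s2 -> 0 < 2 - 2 * cos (s * alf i).
  by move=> sb; rewrite lt_neqAle eq_sym nonres//= subr_ge0 -[leRHS]mulr1 ler_pM2l// cos_le1.
have [|i|C C0 HC] := @uniform_bound _ 'I_n (fun i C => forall s, s1 <= s <= s2 ->
    (2 - 2 * cos (s * alf i))^-1 <= C).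
- by move=> i C D CD HC s sb; rewrite (le_trans (HC s sb)).
- have [|c cb cmin] := @EVT_min R (fun s => 2 - 2 * cos (s * alf i)) s1 s2 s12.
    apply: continuous_subspaceT => s; apply: cvgB; first exact: cvg_cst.
    apply: cvgM; first exact: cvg_cst.
    apply: (@continuous_comp _ _ _ (fun s => s * alf i) cos); last exact: continuous_cos.
    exact: mulrr_continuous.
  have c0 := gt0 c i cb; exists (2 - 2 * cos (c * alf i))^-1 => [|s sb].
    by rewrite invr_ge0 ltW.
  by rewrite lef_pV2 ?posrE ?gt0// cmin.
exists (C + 1)^-1 => [|s i sb]; first by rewrite invr_gt0 ltr_wpDl.
rewrite -[leRHS]invrK lef_pV2 ?posrE ?invr_gt0 ?gt0 ?ltr_wpDl//.
by rewrite (le_trans (HC i s sb))// lerDl.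
Qed.

Lemma start_velocity_expanding s s' : `|s - s'| * (al ^+ 2 / 2 * metric0 F i0 i0) <=
  n%:R * (`|U0 s - U0 s'| * `|xi *m J *m metric0 F|).
Proof.
rewrite (le_trans _ (norm_dot_le _ _))// -[dot _ _]dotC dot_mulmx metric0_sym dotC -/(gdot _ _).
rewrite -(scaleN1r (U0 s')) gdotDl gdotZl !gdot_unforced_start.
rewrite [X in _ <= `|X|](_ : _ = - ((s - s') * (al ^+ 2 / 2 * metric0 F i0 i0))); last by field.
rewrite normrN normrM ler_wpM2l//; exact: ler_norm.
Qed.

Definition shooting_window (u w Zh : R) k := [/\ 0 < u, u <= w,
  (forall s i, conjugate_multiplier al k + u <= s <= conjugate_multiplier al k + w ->
    2 - 2 * cos (s * alf i) != 0) &
  enclosed_area F alf xi (conjugate_multiplier al k + w) + 1 <= Zh <=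
    enclosed_area F alf xi (conjugate_multiplier al k + u) - 1].

Lemma shooting_windows N :
  exists u w Zh, w <= pi / al /\ forall k : 'I_N, shooting_window u w Zh k.
Proof.
pose sk := conjugate_multiplier al; pose area := enclosed_area F alf xi.
have /filter_ex[w [w_le w0 nonres]] : \forall w \near 0^'+, [/\ w <= pi / al, 0 < w &
    forall (k : 'I_N) v, 0 < v <= w -> forall i, 2 - 2 * cos ((sk k + v) * alf i) != 0].
  near=> w; split; near: w; first by apply: nbhs_right_le; rewrite divr_gt0// pi_gt0.
    exact: nbhs_right_gt.
  apply: (@filter_forall _ _ (fun (k : 'I_N) w => forall v, 0 < v <= w ->
    forall i, 2 - 2 * cos ((sk k + v) * alf i) != 0) 0^'+) => k.
  exact: near_right_segment (near_nonresonant (sk k)).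
pose Zh := 1 + \sum_(k < N) `|area (sk k + w)|.
have /filter_ex[u [u0 uw area_ge]] : \forall u \near 0^'+, [/\ 0 < u, u <= w &
    forall k : 'I_N, Zh + 1 <= area (sk k + u)].
  near=> u; split; near: u; [exact: nbhs_right_gt|exact: nbhs_right_le|].
  apply: (@filter_forall _ _ (fun (k : 'I_N) u => Zh + 1 <= area (sk k + u)) 0^'+) => k.
  exact: enclosed_area_pole.
exists u, w, Zh; split=> // k; split=> // [s i /andP[us sw]|].
  rewrite -(subrKC (sk k) s); apply: (nonres k).
  by rewrite lerBlDl sw andbT (lt_le_trans u0)// lerBrDl.
rewrite lerBrDr area_ge andbT addrC lerD2l (le_trans (ler_norm _))// (bigD1 k)//= lerDl.
exact: sumr_ge0.
Unshelve. all: end_near.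
Qed.

Lemma shooting_windows_apart (u w Zh : R) k l s s' : k != l -> w <= pi / al ->
  shooting_window u w Zh k -> shooting_window u w Zh l ->
  conjugate_multiplier al k + u <= s <= conjugate_multiplier al k + w ->
  conjugate_multiplier al l + u <= s' <= conjugate_multiplier al l + w -> pi / al <= `|s - s'|.
Proof.
move=> kl w_le Wk Wl; wlog lt_kl : k l s s' kl Wk Wl / (k < l)%N.
  move: (kl); rewrite neq_ltn => /orP[lt_kl|lt_lk] Hwlog sb sb'; first exact: (Hwlog k l).
  by rewrite distrC; apply: (Hwlog l k) => //; rewrite eq_sym.
move=> /andP[_ sb] /andP[sb' _]; have [u0 _ _ _] := Wk.
rewrite distrC (le_trans _ (ler_norm _))//.
by have := conjugate_multiplier_gap al_gt0 lt_kl; rewrite mulr2n mulrDl; lra.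
Qed.

Let W : R := n%:R * `|xi *m J *m metric0 F|.

Let W_ge0 : 0 <= W. Proof. by rewrite mulr_ge0. Qed.

Lemma start_velocity_separated (eps : R) (V : 'rV[R]_n) s s' : pi / al <= `|s - s'| ->
  `|V - U0 s| <= eps -> `|V - U0 s'| <= eps -> pi * al * metric0 F i0 i0 <= 4 * (eps * W).
Proof.
move: (start_velocity_expanding s s'); move: (U0 s) (U0 s') => v v' expand ss' Vv Vv'.
have vv' : `|v - v'| <= 2 * eps.
  by rewrite -(subrKA V) (le_trans (ler_normD _ _))// mulr_natl mulr2n lerD// distrC.
have gap_le : pi / al * (al ^+ 2 / 2 * metric0 F i0 i0) <= 2 * eps * W.
  rewrite (@le_trans _ _ (`|s - s'| * (al ^+ 2 / 2 * metric0 F i0 i0)))//.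
    by rewrite ler_wpM2r// mulr_ge0 ?(ltW metric0_gt0)// divr_ge0 ?sqr_ge0.
  by rewrite (le_trans expand)// mulrCA ler_wpM2r.
rewrite (_ : pi * al * metric0 F i0 i0 = 2 * (pi / al * (al ^+ 2 / 2 * metric0 F i0 i0)));
  last first.
  by field; rewrite gt_eqF.
by move: gap_le; lra.
Qed.

Hypothesis rho_gt0 : 0 < rho.

Theorem multiple_hamiltonian_curves N : exists Zh : R, \forall eta \near 0^'+,
  exists Y P : 'I_N -> R -> 'rV[R]_d, (forall k, [/\ hamiltonian_curve (frame_ham F) (Y k) (P k),
    Y k 0 = y0,
    Y k 1 = y0 + eta ^+ 2 *: (xi *m basis F + (eta * (eta * Zh)) *: transversal F) &
    forall t, 0 <= t <= 1 -> `|Y k t - y0| < rho / 2]) /\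
  forall k l, k != l -> exists2 t, 0 <= t <= 1 & Y k t != Y l t.
Proof.
have [u [w [Zh [w_le Hw]]]] := shooting_windows N; exists Zh.
pose sk := conjugate_multiplier al.
pose gap := pi * al * metric0 F i0 i0.
have gap0 : 0 < gap by rewrite !mulr_gt0// pi_gt0.
pose eps := gap / (4 * (W + 1)).
have W1 : 0 < W + 1 by rewrite ltr_wpDl.
have eps0 : 0 < eps by rewrite divr_gt0// mulr_gt0.
pose solution eta (k : 'I_N) s y p := [/\ sk k + u <= s <= sk k + w,
  hamiltonian_curve (frame_ham F) y p,
  y 0 = y0 /\ y 1 = y0 + eta ^+ 2 *: (xi *m basis F + (eta * (eta * Zh)) *: transversal F),
  forall t, 0 <= t <= 1 -> `|y t - y0| < rho / 2 &
  exists2 v, is_derive (0 : R) 1 y v &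
    `|eta ^- 2 *: (v *m (dual_basis F)^T) - U0 s| <= eps].
have solutions : \forall eta \near 0^'+, forall k, exists s y p, solution eta k s y p.
  apply: (@filter_forall _ _ (fun k eta => exists s y p, solution eta k s y p) 0^'+) => k.
  have [u0 uw nonres Zhb] := Hw k.
  have s1_gt0 : 0 < sk k + u by rewrite addr_gt0// conjugate_multiplier_gt0.
  have s12 : sk k + u <= sk k + w by rewrite lerD2l.
  have [m m0 Hm] := nonresonant_bound s12 nonres.
  exact: (shooting rho_gt0 alf_gt0 curvature_sqr s1_gt0 s12 m0 Hm eps0 Zhb).
near=> eta; have /choice[s /choice[Y /choice[P sol]]] : forall k,
  exists s y p, solution eta k s y p.
  by near: eta.
exists Y, P; split=> [k|k l kl]; first by have [_ ? [? ?] ? _] := sol k; split.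
apply: contrapT => same; have [sbk _ _ _ [v dv Hv]] := sol k;
  have [sbl _ _ _ [v' dv' Hv']] := sol l.
have vv : v = v'.
  apply: (is_derive_eq_right dv dv') => t t01; apply/eqP; apply: contrapT => /negP neq.
  by apply: same; exists t.
have /start_velocity_separated := shooting_windows_apart kl w_le (Hw k) (Hw l) sbk sbl.
move=> /(_ eps (eta ^- 2 *: (v *m (dual_basis F)^T)) Hv); rewrite vv => /(_ Hv').
by rewrite -/gap leNgt mulrCA /eps mulrAC ltr_pdivrMr ?mulr_gt0// ltr_pM2l// ltr_pM2l// ltrDl ltr01.
Unshelve. all: end_near.
Qed.

End unforced_area.

(** * Normal form of a skew matrix *)

Section positive_definite.
Context {R : realType}.

Definition posdef n (g : 'M[R]_n) := forall v : 'rV[R]_n, v != 0 -> 0 < dot (v *m g) v.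

Lemma posdef_congr n (g M : 'M[R]_n) : M \in unitmx -> posdef g -> posdef (M *m g *m M^T).
Proof.
move=> uM pg v v0; rewrite !mulmxA dot_mulmx trmxK; apply: pg.
by apply: contra_neq v0 => vM; rewrite -(mulmxK uM v) vM mul0mx.
Qed.

Lemma posdef_unit n (g : 'M[R]_n) : posdef g -> g \in unitmx.
Proof.
move=> pg; rewrite -row_free_unit -kermx_eq0; apply/rowV0P => v /sub_kermxP vg.
by apply/eqP; apply: contraT => /pg; rewrite vg dot0l ltxx.
Qed.

Lemma posdef_diag_gt0 n (g : 'M[R]_n) i : posdef g -> 0 < g i i.
Proof.
move=> pg; have : delta_mx 0 i != 0 :> 'rV[R]_n.
  by apply/eqP => /rowP/(_ i); rewrite !mxE !eqxx => /eqP; rewrite oner_eq0.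
by move=> /pg; rewrite dot_delta -rowE mxE.
Qed.

Lemma posdef_schur n (g : 'M[R]_(1 + n)) : g^T = g -> posdef g ->
  exists M, M \in unitmx /\ exists2 h : 'M[R]_n, h^T = h /\ posdef h &
    M *m g *m M^T = block_mx (g 0 0)%:M 0 0 h.
Proof.
move=> gs pg; pose a := g 0 0; pose r := ursubmx g.
have a0 : 0 < a := posdef_diag_gt0 0 pg.
have ulE : ulsubmx g = a%:M by rewrite [LHS]mx11_scalar /a !mxE; congr ((g _ _)%:M); exact: val_inj.
have dlE : dlsubmx g = r^T by rewrite /r trmx_ursub gs.
pose c := - a^-1 *: r^T; pose M : 'M[R]_(1 + n) := block_mx 1%:M 0 c 1%:M.
have uM : M \in unitmx by rewrite unitmxE det_lblock !det1 mulr1 unitr1.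
have ca : c *m a%:M + r^T = 0.
  by rewrite mul_mx_scalar /c scalerA mulrN divff ?gt_eqF// scaleN1r addNr.
have ac : a%:M *m c^T + r = 0.
  by rewrite -[a%:M]tr_scalar_mx -trmx_mul -[X in _ + X]trmxK -linearD ca linear0.
have ME : M *m g *m M^T = block_mx a%:M 0 0 (c *m r + drsubmx g).
  rewrite -{1}[g]submxK ulE dlE -/r /M tr_block_mx !trmx1 trmx0 !mulmx_block.
  by rewrite !mul1mx !mul0mx !mulmx1 !mulmx0 !addr0 ca ac mul0mx add0r.
exists M; split=> //; exists (c *m r + drsubmx g) => //; split.
  have : (M *m g *m M^T)^T = M *m g *m M^T by rewrite !trmx_mul trmxK gs mulmxA.
  by rewrite ME tr_block_mx => /eq_block_mx[].
move=> v v0; have := posdef_congr uM pg; rewrite ME => /(_ (row_mx 0 v)).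
rewrite /dot tr_row_mx mul_row_block !mul0mx mulmx0 !add0r mul_row_col mul0mx add0r.
by apply; apply: contra_neq v0; rewrite -[0 : 'rV_(1 + n)]row_mx0 => /eq_row_mx[].
Qed.

Lemma cholesky n (g : 'M[R]_n) : g^T = g -> posdef g ->
  exists2 L, L \in unitmx & L *m g *m L^T = 1%:M.
Proof.
elim: n g => [|n IH] g gs pg; first by exists 1%:M; [exact: unitmx1|apply/matrixP => -[]].
move: g gs pg; rewrite -[n.+1]/(1 + n)%N => g gs pg.
have a0 : 0 < g 0 0 := posdef_diag_gt0 0 pg.
have [M [uM [h [hs ph] ME]]] := posdef_schur gs pg; have [L uL LE] := IH h hs ph.
set a := g 0 0 in a0 ME; have sa : 0 < Num.sqrt a by rewrite sqrtr_gt0.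
pose N : 'M[R]_(1 + n) := block_mx (Num.sqrt a)^-1%:M 0 0 L.
exists (N *m M).
  rewrite unitmx_mul uM andbT unitmxE det_lblock det_scalar1 unitrM -unitmxE uL andbT.
  by rewrite unitrV unitfE gt_eqF.
rewrite trmx_mul mulmxA -!mulmxA [M *m _]mulmxA [M *m g *m _]mulmxA ME.
rewrite mulmxA mulmx_block !mul0mx !mulmx0 !addr0 !add0r.
rewrite tr_block_mx mulmx_block !trmx0 !mul0mx !mulmx0 !addr0 !add0r LE tr_scalar_mx -!scalar_mxM.
rewrite (_ : _ * a * _ = 1) ?scalar_mx_block//.
by rewrite -{2}(sqr_sqrtr (ltW a0)); field; rewrite gt_eqF.
Qed.

End positive_definite.

Section skew_normal_form.
Import complex.
Context {R : realType}.

Lemma symmetric_diagonalizable n (S : 'M[R]_n) : S^T = S ->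
  exists2 Q, Q \in unitmx & exists D : 'rV[R]_n, Q *m S = diag_mx D *m Q.
Proof.
move=> Ss; pose rc := real_complex R; pose A := map_mx rc S.
have Ar : A \is a realmx.
  by apply/mxOverP => i j; rewrite mxE; apply/complex_realP; eexists.
have As : A \is symmetricmx.
  apply/is_hermitianmxP; rewrite expr0 scale1r map_mx_id//.
  by rewrite /A map_trmx Ss.
have Ah := realsym_hermsym As Ar.
have /orthomx_spectralP spectralE := hermitian_normalmx Ah.
have Dr := hermitian_spectral_diag_real Ah.
have uP := spectral_unit A.
have sim : similar_in unitmx A (diag_mx (spectral_diag A)).
  exists (spectralmx A) => //; apply/(similarP uP).
  by rewrite {2}spectralE !mulmxA mulmxV// mul1mx.
have Br : diag_mx (spectral_diag A) \is a realmx.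
  apply/mxOverP => i j; rewrite mxE; move/mxOverP: Dr => Dr.
  by case: eqP => _; rewrite ?mulr1n ?mulr0n ?Dr// realE lexx.
have [P] := real_similar sim Ar Br; rewrite inE => /andP[/mxOverP Pr Pu] /(similarP Pu) PE.
pose re (z : complex R) := complex.Re z.
have reK (z : complex R) : z \is Num.real -> rc (re z) = z by move=> /complex_realP[k ->].
have PK : map_mx rc (map_mx re P) = P by apply/matrixP => i j; rewrite !mxE reK.
have DK : map_mx rc (map_mx re (spectral_diag A)) = spectral_diag A.
  by apply/matrixP => i j; rewrite !mxE reK//; move/mxOverP: Dr; exact.
exists (map_mx re P); first by rewrite -(map_unitmx rc) PK.
exists (map_mx re (spectral_diag A)).
have inj (X Y : 'M[R]_n) : map_mx rc X = map_mx rc Y -> X = Y.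
  by move=> /matrixP XY; apply/matrixP => i j; have := XY i j; rewrite !mxE => /complexI.
by apply: inj; rewrite !map_mxM map_diag_mx PK DK.
Qed.

Lemma mulmx_congr_skew m n (b : 'M[R]_(m, n)) (A : 'M[R]_n) :
  b *m A *m b^T - (b *m A *m b^T)^T = b *m (A - A^T) *m b^T.
Proof. by rewrite !trmx_mul trmxK mulmxBr mulmxBl !mulmxA. Qed.

Lemma skew_sqr_eigenvalue_lt0 n (Om : 'M[R]_n) (lam : R) (v : 'rV[R]_n) :
  Om^T = - Om -> Om \in unitmx -> v != 0 -> v *m (Om *m Om) = lam *: v -> lam < 0.
Proof.
move=> Oms uOm v0 vE; have vOm0 : v *m Om != 0.
  by apply: contra_neq v0 => vOm; rewrite -(mulmxK uOm v) vOm mul0mx.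
have energy : lam * dot v v = - dot (v *m Om) (v *m Om).
  by rewrite -dotZl -vE mulmxA dot_mulmx Oms mulmxN dotNr.
by rewrite -(pmulr_llt0 _ (dot_sqr_gt0 v0)) energy oppr_lt0 dot_sqr_gt0.
Qed.

(* With [L g L^T = 1], the operator [Om g^-1] is conjugate to the skew matrix [L Om L^T], whose
   square is symmetric and negative definite. *)
Lemma skew_normal_form n (g Om : 'M[R]_n) :
  g^T = g -> posdef g -> Om^T = - Om -> Om \in unitmx ->
  exists2 P, P \in unitmx & exists2 alf : 'I_n -> R, forall i, 0 < alf i &
    let J := P *m (Om *m invmx g) *m invmx P in J *m J = - diagf alf (fun x => x ^+ 2).
Proof.
move=> gs pg Oms uOm; have [L uL LE] := cholesky gs pg.
pose O1 := L *m Om *m L^T.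
have O1s : O1^T = - O1 by rewrite /O1 !trmx_mul trmxK Oms mulNmx mulmxN mulmxA.
have uO1 : O1 \in unitmx by rewrite !unitmx_mul uL uOm unitmx_tr uL.
have sqr_sym : (O1 *m O1)^T = O1 *m O1 by rewrite trmx_mul O1s mulNmx mulmxN opprK.
have [Q uQ [D QD]] := symmetric_diagonalizable sqr_sym.
have D_lt0 i : D 0 i < 0.
  apply: (skew_sqr_eigenvalue_lt0 O1s uO1 (v := row i Q)).
    apply/eqP => rowQ0; have : row i (Q *m invmx Q) = 0 by rewrite row_mul rowQ0 mul0mx.
    by rewrite mulmxV// => /rowP/(_ i); rewrite !mxE eqxx => /eqP; rewrite oner_eq0.
  by rewrite -row_mul QD row_mul row_diag_mx -scalemxAl -rowE.
have uQL : Q *m L \in unitmx by rewrite unitmx_mul uQ.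
exists (Q *m L) => //.
exists (fun i => Num.sqrt (- D 0 i)) => [i|J]; first by rewrite sqrtr_gt0 oppr_gt0.
have ginv : invmx g = L^T *m L.
  have gLL : g *m (L^T *m L) = 1%:M.
    by rewrite mulmxA; apply: mulmx1C; rewrite mulmxA.
  by rewrite -[LHS]mulmx1 -gLL mulKmx//; have [] := mulmx1_unit gLL.
have -> : J = Q *m O1 *m invmx Q.
  apply: (can_inj (mulmxK uQL)); rewrite /J ginv mulmxKV// [in RHS]mulmxA mulmxKV//.
  by rewrite /O1 !mulmxA.
rewrite 2!mulmxA mulmxKV // -[Q *m O1 *m O1]mulmxA QD mulmxK //.
apply/matrixP => i j; rewrite !mxE sqr_sqrtr ?oppr_ge0 ?ltW//.
by rewrite mulNrn opprK.
Qed.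

End skew_normal_form.

(** * Contact frames *)

Section contact_frame.
Context {R : realType} {n : nat} {M : contact_subriemannian_manifold R n.+1}.
Variables (c : chart R n.+1 M) (y0 : 'rV[R]_n.+1) (W : set 'rV[R]_n.+1).
Variables (al : 'rV[R]_n.+1 -> 'rV[R]_n.+1) (k : 'I_n.+1).
Hypotheses (c_atlas : atlas c) (W_open : open W) (W_y0 : W y0) (W_img : W `<=` cimg c).
Hypotheses (al_smooth : smooth_map_on W al) (al_k : forall y, W y -> al y 0 k != 0).
Hypothesis distrP : forall y v, W y -> distr c (cinv c y) v <-> dot (al y) v = 0.
Implicit Types (y v w p : 'rV[R]_n.+1).

Local Notation ev := (delta_mx 0 k : 'rV[R]_n.+1).
Local Notation g_ y := (metric c (cinv c y)).

Let W_cdom y : W y -> cdom c (cinv c y). Proof. by move=> /W_img/cimgP[]. Qed.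

Lemma distrB y u v : W y -> distr c (cinv c y) u -> distr c (cinv c y) v ->
  distr c (cinv c y) (u - v).
Proof.
by move=> Wy /(distrP _ Wy) du /(distrP _ Wy) dv; apply/(distrP _ Wy); rewrite dotBr du dv subrr.
Qed.

Definition normal_covector : 'rV[R]_n.+1 := (al y0 0 k)^-1 *: al y0.
Local Notation es := normal_covector.

Lemma normal_covectorK : es *m ev^T = 1%:M.
Proof.
apply/matrixP => i j; rewrite !ord1 -[LHS]/(dot es ev) dot_delta !mxE mulVf//.
exact: al_k.
Qed.

Section contact_basis.
Variables (b bs : 'M[R]_(n, n.+1)).
Hypotheses (bs_b : bs *m b^T = 1%:M) (al_b : al y0 *m b^T = 0) (bs_ev : bs *m ev^T = 0).

Lemma contact_resolution : ev^T *m es + b^T *m bs = 1%:M.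
Proof.
have dual : col_mx es bs *m row_mx ev^T b^T = 1%:M.
  rewrite mul_col_row normal_covectorK bs_ev bs_b (_ : es *m b^T = 0) -?scalar_mx_block//.
  by rewrite -scalemxAl al_b scaler0.
have := @mulmx1C _ n.+1 (col_mx es bs) (row_mx ev^T b^T) dual.
by rewrite -(mul_row_col ev^T b^T es bs).
Qed.

Definition contact_drift y : 'rV[R]_n := - (al y 0 k)^-1 *: (al y *m b^T).

Definition contact_frame y : 'M[R]_(n, n.+1) := b + (contact_drift y)^T *m ev.

Definition contact_gram y : 'M[R]_n :=
  \matrix_(i, j) g_ y (row i (contact_frame y)) (row j (contact_frame y)).

Lemma mul_contact_frame (u : 'rV[R]_n) y :
  u *m contact_frame y = u *m b + dot u (contact_drift y) *: ev.
Proof.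
by rewrite mulmxDr mulmxA [u *m _^T]mx11_scalar mul_scalar_mx.
Qed.

Lemma contact_frame_distr (u : 'rV[R]_n) y : W y -> distr c (cinv c y) (u *m contact_frame y).
Proof.
move=> Wy; apply/(distrP _ Wy).
rewrite mul_contact_frame dotDr dotZr dot_delta dotC dot_mulmx.
by rewrite dotZr mulNr mulNr mulrAC mulVf ?mul1r ?al_k// addrN.
Qed.

Lemma contact_frame_dual y : contact_frame y *m bs^T = 1%:M.
Proof.
rewrite mulmxDl -mulmxA -[ev *m _]trmxK trmx_mul trmxK bs_ev trmx0 mulmx0 addr0.
by rewrite -[LHS]trmxK trmx_mul trmxK bs_b trmx1.
Qed.

Lemma contact_frame_span y v : W y -> distr c (cinv c y) v ->
  v = v *m bs^T *m contact_frame y.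
Proof.
move=> Wy dv; apply/eqP; rewrite -subr_eq0; apply/eqP; set w := v - _.
have dw : distr c (cinv c y) w by apply: distrB => //; exact: contact_frame_distr.
have wbs : w *m bs^T = 0 by rewrite mulmxBl -(mulmxA (v *m bs^T)) contact_frame_dual mulmx1 subrr.
have wE : w = dot w es *: ev.
  rewrite -[LHS]mulmx1 -[1%:M]trmx1 -contact_resolution linearD /= !trmx_mul !trmxK mulmxDr !mulmxA.
  by rewrite wbs mul0mx addr0 [w *m _]mx11_scalar mul_scalar_mx.
have /(distrP _ Wy)/eqP := dw.
by rewrite wE dotZr dot_delta mulf_eq0 (negbTE (al_k Wy)) orbF => /eqP ->; rewrite scale0r.
Qed.

Lemma metric_mul_frame (u v : 'rV[R]_n) y : W y ->
  g_ y (u *m contact_frame y) (v *m contact_frame y) = dot (u *m contact_gram y) v.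
Proof.
move=> Wy; have cy := W_cdom Wy.
have dF i : distr c (cinv c y) (row i (contact_frame y)).
  by rewrite rowE; exact: contact_frame_distr.
have metric_suml (a : 'rV[R]_n) w : distr c (cinv c y) w ->
    g_ y (a *m contact_frame y) w = \sum_i a 0 i * g_ y (row i (contact_frame y)) w.
  move=> dw; rewrite mulmx_sum_row.
  suff [] : distr c (cinv c y) (\sum_i a 0 i *: row i (contact_frame y)) /\
    g_ y (\sum_i a 0 i *: row i (contact_frame y)) w =
    \sum_i a 0 i * g_ y (row i (contact_frame y)) w by [].
  elim/big_ind2: _ => [|x1 x2 z1 z2 [d1 e1] [d2 e2]|i _].
  - by split; [exact: distr0|rewrite metric0l].
  - split.
      by move: d1 d2 => /(distrP _ Wy) d1 /(distrP _ Wy) d2;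
        apply/(distrP _ Wy); rewrite dotDr d1 d2 addr0.
    by rewrite -[x2]scale1r metric_linear// mul1r e1 e2.
  - have di := dF i; split; last first.
      rewrite -[_ *: _]addr0 metric_linear//; last exact: distr0.
      by rewrite metric0l// addr0.
    by move: di => /(distrP _ Wy) di; apply/(distrP _ Wy); rewrite dotZr di mulr0.
have du := contact_frame_distr u Wy; have dv := contact_frame_distr v Wy.
rewrite metric_suml// dot_mulmx dot_sum; apply: eq_bigr => i _; congr (_ * _).
rewrite metric_symmetric// metric_suml// !mxE; apply: eq_bigr => j _.
by rewrite !mxE (metric_symmetric c_atlas cy).
Qed.

Lemma contact_gram_sym y : W y -> (contact_gram y)^T = contact_gram y.
Proof.
move=> Wy; apply/matrixP => i j; rewrite !mxE metric_symmetric//; first exact: W_cdom.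
- by rewrite rowE; exact: contact_frame_distr.
- by rewrite rowE; exact: contact_frame_distr.
Qed.

Lemma contact_gram_posdef y : W y -> posdef (contact_gram y).
Proof.
move=> Wy v v0; rewrite -metric_mul_frame//; apply: metric_pos => //; first exact: W_cdom.
  exact: contact_frame_distr.
apply: contra_neq v0 => vF.
by rewrite -[v]mulmx1 -(contact_frame_dual y) mulmxA vF mul0mx.
Qed.

Lemma contact_gram_unit y : W y -> contact_gram y \in unitmx.
Proof. by move=> Wy; apply: posdef_unit; exact: contact_gram_posdef. Qed.

Lemma smooth_contact_drift j : smooth_on W (fun y => contact_drift y 0 j).
Proof.
apply: (@eq_smooth_on _ _ _ (fun y => (al y 0 k)^-1 * \sum_l al y 0 l * - b j l)) => //.
  move=> y _; rewrite !mxE mulNr -mulrN -sumrN; congr (_ * _).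
  by apply: eq_bigr => l _; rewrite mxE mulrN.
apply: smooth_onM => //; first by apply: smooth_onV => //; exact: al_smooth.
by apply: smooth_on_sum => // l _; apply: smooth_onM => //; exact: smooth_on_cst.
Qed.

Lemma smooth_contact_cometric i j : smooth_on W (fun y => invmx (contact_gram y) i j).
Proof.
apply: smooth_on_invmx => // [y|p q]; first exact: contact_gram_unit.
have frame_smooth m : smooth_map_on W (fun y => row m (contact_frame y)).
  move=> l; apply: (@eq_smooth_on _ _ _ (fun y => b m l + contact_drift y 0 m * ev 0 l)) => //.
    by move=> y _; rewrite !mxE big_ord1 !mxE.
  apply: smooth_onD => //; first exact: smooth_on_cst.
  by apply: smooth_onM => //; [exact: smooth_contact_drift|exact: smooth_on_cst].
apply: (@eq_smooth_on _ _ _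
  (fun y => g_ y (row p (contact_frame y)) (row q (contact_frame y)))) => //.
  by move=> y _; rewrite mxE.
by apply: metric_smooth => // y Wy; rewrite rowE; exact: contact_frame_distr.
Qed.

Variable rho : R.
Hypothesis cube_W : cube y0 rho `<=` W.

Lemma contact_drift0 : contact_drift y0 = 0.
Proof. by rewrite /contact_drift al_b scaler0. Qed.

Definition contact_adapted_frame : adapted_frame n y0 rho.
Proof.
apply: (@AdaptedFrame _ _ _ y0 rho b ev bs es contact_drift (fun y => invmx (contact_gram y))).
- exact: bs_b.
- by rewrite -scalemxAl al_b scaler0.
- exact: bs_ev.
- exact: normal_covectorK.
- exact: contact_resolution.
- exact: contact_drift0.
- apply: C11_matrix => i j; rewrite ord1; exact: class_C2_C11 cube_W (smooth_contact_drift j 2).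
- apply: C11_matrix => i j; exact: class_C2_C11 cube_W (smooth_contact_cometric i j 2).
- by move=> y /cube_W Wy; rewrite trmx_inv contact_gram_sym.
- by rewrite unitmx_inv contact_gram_unit.
Defined.
Local Notation F := contact_adapted_frame.

Lemma frame_velocityE y p : frame_velocity F y p = control F y p *m contact_frame y.
Proof. by rewrite mul_contact_frame. Qed.

Lemma control_gram y p : W y -> control F y p *m contact_gram y = momentum F y p.
Proof. by move=> Wy; rewrite -mulmxA mulVmx ?contact_gram_unit// mulmx1. Qed.

Lemma frame_ham_fenchel y v p : W y -> distr c (cinv c y) v ->
  dot p v <= 2^-1 * g_ y v v + frame_ham F y p.
Proof.
move=> Wy dv; have vE := contact_frame_span Wy dv; set u := v *m bs^T in vE.
pose V := control F y p; have dV := contact_frame_distr V Wy.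
have pv : dot p v = dot (V *m contact_gram y) u.
  rewrite control_gram// vE mul_contact_frame dotDr dotZr (dotC p) dot_mulmx /momentum dotDl dotZl.
  by rewrite (dotC u) (dotC u) mulrC.
have hamE : frame_ham F y p = 2^-1 * dot (V *m contact_gram y) V.
  by rewrite control_gram// /frame_ham dotC.
have cross : dot (u *m contact_gram y) V = dot (V *m contact_gram y) u.
  by rewrite dot_mulmx contact_gram_sym// dotC.
have := metric_ge0 c_atlas (W_cdom Wy) (distrB Wy dv dV).
by rewrite hamE pv vE -mulmxBl !metric_mul_frame// mulmxBl dotBl !dotBr cross; lra.
Qed.

Lemma sr_hamiltonian_contact : sr_hamiltonian c (frame_ham F) (cube y0 rho).
Proof.
split.
- by move=> y /cube_W/W_img.
- by move=> r; exact: C11_frame_ham.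
- by move=> y p Ay; rewrite grad_frame_ham// frame_velocityE;
    apply: contact_frame_distr; exact: cube_W.
- move=> y p Ay; have Wy := cube_W Ay; rewrite grad_frame_ham// frame_velocityE metric_mul_frame//.
  by rewrite control_gram// /frame_ham mulrA divff// mul1r dotC.
- by move=> y p Ay; rewrite grad_frame_ham// dot_momentum_frame_velocity.
- by move=> y v p /cube_W; exact: frame_ham_fenchel.
Qed.

End contact_basis.

Section change_of_basis.
Variables (b : 'M[R]_(n, n.+1)) (P : 'M[R]_n).

Lemma contact_drift_mul y : contact_drift (P *m b) y = contact_drift b y *m P^T.
Proof. by rewrite /contact_drift trmx_mul mulmxA -scalemxAl. Qed.

Lemma contact_frame_mul y : contact_frame (P *m b) y = P *m contact_frame b y.
Proof. by rewrite /contact_frame mulmxDr contact_drift_mul trmx_mul trmxK mulmxA. Qed.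

Lemma contact_gram_mul y : W y -> contact_gram (P *m b) y = P *m contact_gram b y *m P^T.
Proof.
move=> Wy; apply/matrixP => i j; rewrite [LHS]mxE contact_frame_mul !row_mul metric_mul_frame//.
by rewrite -row_mul dot_sum [RHS]mxE; apply: eq_bigr => l _; rewrite !mxE.
Qed.

End change_of_basis.

Lemma al_differentiable : differentiable al y0.
Proof.
by apply: differentiable_mx => i j; rewrite ord1;
  exact: class_C1_differentiable W_open (al_smooth j 1) W_y0.
Qed.

Definition form_jacobian : 'M[R]_n.+1 := lin1_mx ('d al y0).

Definition form_curl : 'M[R]_n.+1 := form_jacobian - form_jacobian^T.

Lemma form_diffE v w : form_diff al y0 v w = dot (v *m form_curl) w.
Proof.
have derivE u z : 'D_u (fun y => form_app al y z) y0 = dot (u *m form_jacobian) z.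
  rewrite (_ : (fun y => _) = (fun y => dot (al y) z)); last by apply: funext => y; rewrite dot_sum.
  have dal := differentiableP al_differentiable.
  have [ddot dotE] := is_diff_bounded_bilinearl (@norm_dot_le _ _) z dal.
  by rewrite deriveE// dotE mul_rV_lin1.
by rewrite /form_diff !derivE mulmxBr dotBl; congr (_ - _); rewrite dot_mulmx dotC.
Qed.

Lemma diff_contact_drift (b : 'M[R]_(n, n.+1)) w : al y0 *m b^T = 0 ->
  'd (contact_drift b) y0 w = - (al y0 0 k)^-1 *: ('d al y0 w *m b^T).
Proof.
move=> al_b; have dal := differentiableP al_differentiable.
have dnum := is_diff_bounded_bilinearl (@norm_mulmx_le _ 1 n.+1 n) b^T dal.
have dscal : differentiable (fun y => - (al y 0 k)^-1) y0.
  apply: differentiableN; apply: (class_C1_differentiable W_open _ W_y0).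
  exact: (smooth_onV W_open al_k (al_smooth k) 1).
have [_ ->] := is_diff_bounded_bilinear (@norm_scale_le _ _) (differentiableP dscal) dnum.
by rewrite /= al_b scaler0 add0r.
Qed.

Lemma contact_frame_jacobian (b bs : 'M[R]_(n, n.+1)) rho (bs_b : bs *m b^T = 1%:M)
    (al_b : al y0 *m b^T = 0) (bs_ev : bs *m ev^T = 0) (cube_W : cube y0 rho `<=` W) :
  frame_jacobian (contact_adapted_frame bs_b al_b bs_ev cube_W) =
  - (al y0 0 k)^-1 *: (b *m form_jacobian *m b^T).
Proof.
rewrite /frame_jacobian -mulmxA scalemxAr; congr (_ *m _); apply/row_matrixP => i.
by rewrite !rowE mul_rV_lin1 diff_contact_drift// -scalemxAr mulmxA mul_rV_lin1.
Qed.

Definition ker_dual : 'M[R]_(n, n.+1) := row' k 1%:M.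

Definition ker_basis : 'M[R]_(n, n.+1) := ker_dual *m (1%:M - es^T *m ev).

Lemma ker_dual_transversal : ker_dual *m ev^T = 0.
Proof.
rewrite trmx_delta -colE; apply/colP => i; rewrite !mxE.
by rewrite [_ == k]eq_sym (negbTE (neq_lift _ _)).
Qed.

Lemma ker_basisK : ker_dual *m ker_basis^T = 1%:M.
Proof.
rewrite trmx_mul linearB /= trmx1 trmx_mul trmxK mulmxA mulmxBr mulmx1 mulmxA.
rewrite ker_dual_transversal mul0mx subr0; apply/matrixP => i j.
rewrite !mxE (bigD1 (lift k i))//= !mxE eqxx mul1r big1 => [|l li].
  by rewrite addr0 (inj_eq (@lift_inj _ k)) eq_sym.
by rewrite !mxE eq_sym (negbTE li) mul0r.
Qed.

Lemma al_ker_basis : al y0 *m ker_basis^T = 0.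
Proof.
rewrite trmx_mul linearB /= trmx1 trmx_mul trmxK mulmxA mulmxBr mulmx1 mulmxA.
have -> : al y0 *m ev^T = (al y0 0 k)%:M.
  by rewrite [LHS]mx11_scalar; congr (_%:M); rewrite -[LHS]/(dot (al y0) ev) dot_delta.
by rewrite mul_scalar_mx scalerA mulfV ?al_k// scale1r subrr mul0mx.
Qed.

Hypothesis nondeg : forall v, distr c (cinv c y0) v ->
  (forall w, distr c (cinv c y0) w -> form_diff al y0 v w = 0) -> v = 0.

Definition ker_curl : 'M[R]_n := - (al y0 0 k)^-1 *: (ker_basis *m form_curl *m ker_basis^T).

Lemma ker_curl_skew : ker_curl^T = - ker_curl.
Proof.
rewrite /ker_curl -scalerN [LHS]linearZ /=; congr (_ *: _).
by rewrite /form_curl -mulmx_congr_skew [LHS]linearB /= trmxK opprB.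
Qed.

Lemma ker_curl_unit : ker_curl \in unitmx.
Proof.
rewrite -row_free_unit -kermx_eq0; apply/rowV0P => u /sub_kermxP/eqP.
rewrite /ker_curl -scalemxAr scaler_eq0 oppr_eq0 invr_eq0 (negbTE (al_k W_y0)) /= => /eqP u_curl.
have ker_distr z : distr c (cinv c y0) (z *m ker_basis).
  by apply/(distrP _ W_y0); rewrite dotC dot_mulmx al_ker_basis dotC dot0l.
have u_ker : u *m ker_basis = 0.
  apply: nondeg => // w dw; rewrite form_diffE.
  rewrite (contact_frame_span ker_basisK al_ker_basis ker_dual_transversal W_y0 dw).
  rewrite mul_contact_frame contact_drift0 ?al_ker_basis// (dotC _ 0) dot0l scale0r addr0.
  rewrite dotC dot_mulmx -mulmxA -[u *m _ *m _]mulmxA.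
  by rewrite (mulmxA ker_basis) u_curl dotC dot0l.
by rewrite -[u]mulmx1 -[1%:M]trmx1 -ker_basisK trmx_mul trmxK mulmxA u_ker mul0mx.
Qed.

Lemma normalized_contact_frame (rho : R) : cube y0 rho `<=` W ->
  exists F : adapted_frame n y0 rho, [/\ sr_hamiltonian c (frame_ham F) (cube y0 rho),
    posdef (metric0 F) & exists2 alf : 'I_n -> R, forall i, 0 < alf i &
      frame_curvature F *m frame_curvature F = - diagf alf (fun x => x ^+ 2)].
Proof.
move=> cube_W; pose g := contact_gram ker_basis y0.
have [P uP [alf alf_gt0 J_sqr]] := skew_normal_form (contact_gram_sym ker_basis W_y0)
  (contact_gram_posdef ker_basisK ker_dual_transversal W_y0) ker_curl_skew ker_curl_unit.
pose b := P *m ker_basis; pose bs := (invmx P)^T *m ker_dual.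
have bs_b : bs *m b^T = 1%:M.
  by rewrite trmx_mul mulmxA -[_ *m ker_dual *m _]mulmxA ker_basisK mulmx1 -trmx_mul mulmxV// trmx1.
have al_b : al y0 *m b^T = 0 by rewrite trmx_mul mulmxA al_ker_basis mul0mx.
have bs_ev : bs *m ev^T = 0 by rewrite -mulmxA ker_dual_transversal mulmx0.
pose F := contact_adapted_frame bs_b al_b bs_ev cube_W; exists F.
have pg : posdef g := contact_gram_posdef ker_basisK ker_dual_transversal W_y0.
have metricE : metric0 F = P *m g *m P^T by rewrite /metric0 invmxK contact_gram_mul.
split; first exact: sr_hamiltonian_contact.
  by rewrite metricE; exact: posdef_congr uP pg.
exists alf => //; suff -> : frame_curvature F = P *m (ker_curl *m invmx g) *m invmx P by [].
have ug : g \in unitmx := posdef_unit pg.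
have -> : frame_curvature F = P *m ker_curl *m P^T *m invmx (P *m g *m P^T).
  rewrite -metricE invmxK /frame_curvature contact_frame_jacobian; congr (_ *m _).
  rewrite linearZ /= -scalerBr /ker_curl -scalemxAr -scalemxAl; congr (_ *: _).
  by rewrite mulmx_congr_skew -/form_curl /b (trmx_mul P) !mulmxA.
have uPgP : P *m g *m P^T \in unitmx by rewrite !unitmx_mul uP ug unitmx_tr.
apply: (canLR (mulmxK uPgP)).
by rewrite !mulmxA mulmxKV// mulmxKV.
Qed.

End contact_frame.

(** * Counting geodesics *)

Section counting_geodesics.
Context {R : realType} {d : nat} {M : contact_subriemannian_manifold R d}.
Variables (c : chart R d M) (y0 y1 : 'rV[R]_d).

Lemma counting_ge (T : choiceType) (A : set T) m (f : 'I_m -> T) :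
  injective f -> (forall i, A (f i)) -> (m%:R%:E <= counting A :> \bar R)%E.
Proof.
move=> injf Af; rewrite /counting; case: asboolP => [finA|_]; last exact: leey.
rewrite lee_fin ler_nat.
have -> : m = size [seq f i | i <- enum 'I_m] by rewrite size_map size_enum_ord.
apply: uniq_leq_size; first by rewrite map_inj_uniq// enum_uniq.
by move=> _ /mapP[i _ ->]; rewrite in_fset_set// inE.
Qed.

Lemma nu_ge m (Y : 'I_m -> R -> 'rV[R]_d) :
  (forall i, [/\ geodesic (cinv c \o Y i), Y i 0 = y0, Y i 1 = y1 &
    forall t : R, 0 <= t <= 1 -> cimg c (Y i t)]) ->
  (forall i j, i != j -> exists2 t : R, 0 <= t <= 1 & Y i t != Y j t) ->
  (m%:R%:E <= nu c (cinv c y0) (cinv c y1))%E.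
Proof.
move=> HY apart.
apply: (@counting_ge _ _ _
  (fun i (t : `[0%R, 1%R :> R]%classic) => cinv c (Y i (\val t)))) => [i j ij|i].
  apply/eqP; apply: contraT => /apart[t t01 /negP[]].
  have t_itv : (t \in `[0%R, 1%R :> R]%classic) by rewrite inE /= in_itv.
  have := congr1 (fun g => cmap c (g (exist _ t t_itv))) ij; rewrite /=.
  have [_ _ _ /(_ t t01)/cimgP[_ ->]] := HY i; have [_ _ _ /(_ t t01)/cimgP[_ ->]] := HY j.
  by move=> ->.
have [geo Y0 Y1 Yc] := HY i; exists (cinv c \o Y i) => //; split => //=; rewrite ?Y0 ?Y1//.
by move=> p [t /=]; rewrite in_itv/= => t01 <-; have [] := cimgP (Yc t t01).
Qed.

End counting_geodesics.

Section many_geodesics.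
Context {R : realType}.

Lemma normalized_frame_exists n (M : contact_subriemannian_manifold R n.+1)
    (c : chart R n.+1 M) (y0 : 'rV[R]_n.+1) : atlas c -> cimg c y0 ->
  exists2 rho : R, 0 < rho & exists F : adapted_frame n y0 rho,
    [/\ sr_hamiltonian c (frame_ham F) (cube y0 rho), posdef (metric0 F) &
      exists2 alf : 'I_n -> R, forall i, 0 < alf i &
        frame_curvature F *m frame_curvature F = - diagf alf (fun x => x ^+ 2)].
Proof.
move=> c_atlas cy0; have [W [al [[oW Wy0] Wc al_smooth contact]]] := distr_contact c_atlas cy0.
have [al0 _ nondeg] := contact _ Wy0.
have [k al_k] : exists k, al y0 0 k != 0.
  apply/existsP; apply: contraNT al0; rewrite negb_exists => /forallP al0.
  by apply/eqP/rowP => k; rewrite mxE; apply/eqP; rewrite -[_ == _]negbK al0.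
pose V := W `&` [set y | al y 0 k != 0].
have oV : open V.
  rewrite openE => y [Wy ky]; apply: (@filterI _ _ (nbhs_filter y)).
    by apply: open_nbhs_nbhs; split.
  exact: cvgr_neq0 (class_C_continuous (al_smooth k 0) Wy) ky.
have VW : V `<=` W by move=> y [].
have [rho rho_gt0 cube_V] := open_cube oV (conj Wy0 al_k); exists rho => //.
apply: (normalized_contact_frame (k := k) c_atlas oV _ _ _ _ _ nondeg cube_V) => //.
- by move=> y /VW /Wc.
- by move=> i p; apply: class_C_subset VW (al_smooth i p).
- by move=> y [].
- by move=> y v /VW /contact[_ + _]; rewrite dot_sum; apply.
Qed.

Lemma near_point_many_geodesics d (M : contact_subriemannian_manifold R d) (c : chart R d M)
    (y0 : 'rV[R]_d) m (r : R) : atlas c -> cimg c y0 -> 0 < r ->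
  exists2 y1, `|y1 - y0| < r & (m%:R%:E <= nu c (cinv c y0) (cinv c y1))%E.
Proof.
case: d M c y0 => [M|n M] c y0 c_atlas cy0 r0; first by have := csr_dim_gt1 M.
have n0 : (0 < n)%N := csr_dim_gt1 M.
have [rho rho_gt0 [F [srH pos [alf alf_gt0 J_sqr]]]] := normalized_frame_exists c_atlas cy0.
pose i0 : 'I_n := Ordinal n0; pose xi : 'rV[R]_n := delta_mx 0 i0.
have cube_y0 : cube y0 rho y0 by rewrite /cube/= subrr normr0 ltW.
have [Zh curves] := multiple_hamiltonian_curves alf_gt0 J_sqr cube_y0
  (posdef_diag_gt0 i0 pos) rho_gt0 m.
pose y1 eta := y0 + eta ^+ 2 *: (xi *m basis F + (eta * (eta * Zh)) *: transversal F).
have y1_cvg : y1 eta @[eta --> 0^'+] --> y0.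
  have -> : y0 = y1 0 by rewrite /y1 expr0n scale0r addr0.
  apply: cvg_at_right_filter; apply: cvgD; first exact: cvg_cst.
  apply: cvgZ; first exact: exprn_continuous.
  apply: cvgD; first exact: cvg_cst.
  apply: cvgZ; last exact: cvg_cst.
  by apply: cvgM => //; apply: cvgM => //; exact: cvg_cst.
have /cvgrPdist_lt/(_ r r0) y1_close := y1_cvg.
have [eta [[Y [P [HY apart]]] [eta_gt0 y1_near]]] :=
  filter_ex (filterI curves (filterI (nbhs_right_gt 0) y1_close)).
exists (y1 eta); first by rewrite distrC.
apply: nu_ge apart => i; have [sol Y0 Y1 Y_near] := HY i; split => //.
  apply: (normal_geodesic c_atlas rho_gt0 srH sol Y_near); rewrite Y0 Y1.
  apply/eqP => /(congr1 (fun v => (v - y0) *m (dual_basis F)^T)).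
  rewrite subrr mul0mx addrAC subrr add0r -scalemxAl mulmxDl -scalemxAl -mulmxA.
  rewrite basis_dualK transversal_dual mulmx1 scaler0 addr0 => /eqP.
  rewrite scaler_eq0 expf_eq0 (gt_eqF eta_gt0) andbF /= => /eqP/rowP/(_ i0).
  by rewrite !mxE !eqxx => /eqP; rewrite oner_eq0.
move=> t t01; have [img _ _ _ _ _] := srH; apply: img;
  rewrite /cube/= (le_trans (ltW (Y_near t t01)))//.
by rewrite ler_piMr ?invf_le1 ?ler1n// ltW.
Qed.

End many_geodesics.

Theorem theorem9 (R : realType) (d : nat)
    (M : contact_subriemannian_manifold R d) (q : M)
    (c : chart R d M) (c_chart : atlas c) (c_q : cdom c q) :
  exists q_ : nat -> M,
    (q_ n @[n --> \oo] --> q) /\ (nu c q (q_ n) @[n --> \oo] --> +oo%E).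
Proof.
pose y0 := cmap c q; have y0_img : cimg c y0 by exists q.
have qE : cinv c y0 = q by exact: cmapK.
have /choice[y1 Hy1] n : exists y1, `|y1 - y0| < n.+1%:R^-1 /\ (n%:R%:E <= nu c q (cinv c y1))%E.
  have r_gt0 : 0 < n.+1%:R^-1 :> R by rewrite invr_gt0.
  have [y1 y1_near nu_y1] := near_point_many_geodesics n c_chart y0_img r_gt0.
  by exists y1; rewrite -qE.
have y1_cvg : y1 n @[n --> \oo] --> y0.
  apply/cvgrPdist_lt => e e0; have /cvgrPdist_lt/(_ e e0) := @cvg_harmonic R.
  apply: filterS => n; rewrite sub0r normrN /harmonic ger0_norm ?invr_ge0// distrC.
  exact: lt_trans (Hy1 n).1.
exists (cinv c \o y1); split; first by rewrite -qE; exact: cvg_comp y1_cvg (cinv_continuous y0_img).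
apply/cvgeyPge => A; near=> n; apply: le_trans (Hy1 n).2; rewrite lee_fin.
by near: n; exact: nbhs_infty_ger.
Unshelve. all: by end_near. Qed.
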